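(* Every algebraic model of the curvature tensor of a structure from the list (a)–(g) in the context is geometrically realizable by a compact manifold. That is: for each of the types (a)–(g) (in both the complex and the para-complex version where ''(para)'' appears) and each algebraic curvature model $\mathfrak{M}$ of that type, there exist a compact manifold $M$ of the same dimension equipped with a structure of the corresponding geometric type (of the same signature, where relevant) and a point $P\in M$ such that the model defined at $P$ by the structure and its curvature tensor is isomorphic to $\mathfrak{M}$.
   Context: Geometric structures (smooth, on an $m$-dimensional manifold $M$; sign $+$ is the para-complex case, sign $-$ the complex case, treated separately, with corresponding upper/lower signs). An affine structure is a torsion free connection $\nabla$ on $TM$. An almost (para)-complex structure is an endomorphism $J_\pm$ of $TM$ with $J_\pm^2=\pm\operatorname{Id}$, $\operatorname{Tr}J_\pm=0$; it is integrable if near every point there are coordinates with $J_\pm\partial_{x_i}=\partial_{x_{i+\bar m}}$, $J_\pm\partial_{x_{i+\bar m}}=\pm\partial_{x_i}$ ($1\le i\le\bar m$, $m=2\bar m$). An almost (para)-Hermitian structure is a pair $(g,J_\pm)$ with $g$ a pseudo-Riemannian metric and $g(J_\pm x,J_\pm y)=\mp g(x,y)$; it is (para)-Hermitian if $J_\pm$ is integrable, and (para)-Kähler if $\nabla^gJ_\pm=0$ for the Levi-Civita connection $\nabla^g$. A Weyl structure is a pair $(g,\nabla)$ with $\nabla$ torsion free and $\nabla g=-2\omega\otimes g$ for some smooth $1$-form $\omega$. A (para)-Kähler–Weyl structure is a triple $(g,J_\pm,\nabla)$ with $(g,J_\pm)$ (para)-Hermitian, $(g,\nabla)$ Weyl,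 and $\nabla J_\pm=0$. The curvature operator of a connection is $R(x,y)=\nabla_x\nabla_y-\nabla_y\nabla_x-\nabla_{[x,y]}$ and, when a metric is present, $R(x,y,z,w)=g(R(x,y)z,w)$. The connection used is $\nabla$ itself for affine, Weyl and (para)-Kähler–Weyl structures, and the Levi-Civita connection of $g$ in the other cases. Algebraic curvature models. Let $V$ be an $m$-dimensional real vector space; where present, $\langle\cdot,\cdot\rangle$ is a non-degenerate symmetric bilinear form of signature $(p,q)$ on $V$, and $J_\pm$ is an endomorphism of $V$ with $J_\pm^2=\pm\operatorname{Id}$, $\operatorname{Tr}J_\pm=0$, $\langle J_\pm x,J_\pm y\rangle=\mp\langle x,y\rangle$. The identities below are required for all vectors. (a) Affine: $(V,A)$ with $A\in\otimes^2V^*\otimes\operatorname{End}(V)$, $A(x,y)=-A(y,x)$ and $A(x,y)z+A(y,z)x+A(z,x)y=0$. (b) Pseudo-Riemannian: $(V,\langle\cdot,\cdot\rangle,A)$ with $A\in\otimes^4V^*$ satisfying (i) $A(x,y,z,w)+A(y,x,z,w)=0$; (ii) $A(x,y,z,w)+A(y,z,x,w)+A(z,x,y,w)=0$; (iii) $A(x,y,z,w)+A(x,y,w,z)=0$. (c) Almost (para)-Hermitian: $(V,\langle\cdot,\cdot\rangle,J_\pm,A)$ with $A$ satisfying (i)–(iii). (d) (Para)-Hermitian: $(V,\langle\cdot,\cdot\rangle,J_\pm,A)$ with $A$ satisfying (i)–(iii) and, with $J=J_\pm$, $$0=A(x,y,z,w)+A(Jx,Jy,Jz,Jw)\pm\{A(Jx,Jy,z,w)+A(x,y,Jz,Jw)+A(Jx,y,Jz,w)+A(x,Jy,z,Jw)+A(Jx,y,z,Jw)+A(x,Jy,Jz,w)\}.$$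 (e) (Para)-Kähler: $(V,\langle\cdot,\cdot\rangle,J_\pm,A)$ with $A$ satisfying (i)–(iii) and $A(x,y,z,w)=\mp A(x,y,J_\pm z,J_\pm w)$. (f) Weyl: $(V,\langle\cdot,\cdot\rangle,A)$ with $A\in\otimes^4V^*$ satisfying (i), (ii) and $A(x,y,z,w)+A(x,y,w,z)=2\psi(x,y)\langle z,w\rangle$ for some alternating $2$-form $\psi$ on $V$. (g) (Para)-Kähler–Weyl: $(V,\langle\cdot,\cdot\rangle,J_\pm,A)$ with $A$ as in (f) and $A(x,y,z,w)=\mp A(x,y,J_\pm z,J_\pm w)$. Two models are isomorphic if there is a linear isomorphism between the underlying vector spaces which intertwines all the given data ($A$, and $\langle\cdot,\cdot\rangle$ and $J_\pm$ where present). Almost (para)-complex and (para)-complex structures alone, which also occur in the paper's list of structures, carry no curvature tensor. *)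

(* Defs.v *)
From HB Require Import structures.
From mathcomp Require Import all_boot all_order all_algebra.
From mathcomp Require Import all_classical all_reals all_analysis.

Set Implicit Arguments.
Unset Strict Implicit.
Unset Printing Implicit Defensive.

Import Order.TTheory GRing.Theory Num.Theory numFieldNormedType.Exports.

Local Open Scope classical_set_scope.
Local Open Scope ring_scope.

(* The para-complex case ([pc = true]) takes the upper signs of the text, the
   complex case the lower ones: [sgn pc] is the sign "+-", [- sgn pc] is "-+". *)
Definition sgn (R : realType) (pc : bool) : R := if pc then 1 else -1.
Arguments sgn {R} pc.

Section LinearAlgebra.
Context {R : realType} {V : vectType R}.
Implicit Types (ip : V -> V -> R) (J : 'End(V)) (A : V -> V -> V -> V -> R).

Definition endo_trace (f : 'End(V)) : R :=
  \sum_(i < \dim {:V}) coord (vbasis {:V}) i (f (vbasis {:V})`_i).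

Definition bilinear_form (b : V -> V -> R) : Prop :=
  (forall x, scalar (b x)) /\ (forall y, scalar (b^~ y)).

(* By Sylvester's law, signature (p, q) amounts to a basis with Gram matrix
   diag(-1, .., -1, 1, .., 1) (p times -1, q times 1).  [basis_of] forces
   p + q = dim V, and the form is non-degenerate. *)
Definition has_signature (p q : nat) ip : Prop :=
  exists b : (p + q).-tuple V, basis_of {:V} b /\
    forall i j : 'I_(p + q), ip b`_i b`_j =
      if i == j then (if (i < p)%N then -1 else 1) else 0.

Definition inner_product (p q : nat) ip : Prop :=
  [/\ bilinear_form ip, (forall x y, ip x y = ip y x) & has_signature p q ip].

Definition almost_cpx (pc : bool) J : Prop :=
  (forall x, J (J x) = sgn pc *: x) /\ endo_trace J = 0.

Definition J_compatible (pc : bool) ip J : Prop :=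
  forall x y, ip (J x) (J y) = - sgn pc * ip x y.

Definition tensor4 A : Prop :=
  [/\ forall y z w, scalar (fun x => A x y z w),
      forall x z w, scalar (fun y => A x y z w),
      forall x y w, scalar (fun z => A x y z w)
    & forall x y z, scalar (fun w => A x y z w)].

Definition affine_model (A : V -> V -> 'End(V)) : Prop :=
  [/\ (forall x, linear (A x)) /\ (forall y, linear (A^~ y)),
      forall x y, A x y = - A y x
    & forall x y z, A x y z + A y z x + A z x y = 0].

Definition antisym12 A : Prop := forall x y z w, A x y z w + A y x z w = 0.

Definition bianchi A : Prop :=
  forall x y z w, A x y z w + A y z x w + A z x y w = 0.

Definition antisym34 A : Prop := forall x y z w, A x y z w + A x y w z = 0.

Definition riemann_tensor A : Prop :=
  [/\ tensor4 A, antisym12 A, bianchi A & antisym34 A].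

Definition weyl_tensor ip A : Prop :=
  [/\ tensor4 A, antisym12 A, bianchi A
    & exists psi : V -> V -> R,
      [/\ bilinear_form psi, (forall x, psi x x = 0)
        & forall x y z w,
            A x y z w + A x y w z = 2 * psi x y * ip z w]].

Definition hermitian_identity (pc : bool) J A : Prop :=
  forall x y z w, 0 = A x y z w + A (J x) (J y) (J z) (J w)
    + sgn pc * (A (J x) (J y) z w + A x y (J z) (J w)
              + A (J x) y (J z) w + A x (J y) z (J w)
              + A (J x) y z (J w) + A x (J y) (J z) w).

Definition kaehler_identity (pc : bool) J A : Prop :=
  forall x y z w, A x y z w = - sgn pc * A x y (J z) (J w).

Definition riemannian_model p q ip A : Prop :=
  inner_product p q ip /\ riemann_tensor A.

Definition almost_hermitian_model pc p q ip J A : Prop :=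
  [/\ inner_product p q ip, almost_cpx pc J, J_compatible pc ip J
    & riemann_tensor A].

Definition hermitian_model pc p q ip J A : Prop :=
  almost_hermitian_model pc p q ip J A /\ hermitian_identity pc J A.

Definition kaehler_model pc p q ip J A : Prop :=
  almost_hermitian_model pc p q ip J A /\ kaehler_identity pc J A.

Definition weyl_model p q ip A : Prop :=
  inner_product p q ip /\ weyl_tensor ip A.

Definition kaehler_weyl_model pc p q ip J A : Prop :=
  [/\ inner_product p q ip, almost_cpx pc J, J_compatible pc ip J,
      weyl_tensor ip A & kaehler_identity pc J A].

End LinearAlgebra.

Section Isomorphism.
Context {R : realType} {V W : vectType R}.

Definition iso_affine (A : V -> V -> 'End(V)) (B : W -> W -> 'End(W)) : Prop :=
  exists F : 'Hom(V, W), bijective F /\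
    forall x y z, F (A x y z) = B (F x) (F y) (F z).

Definition iso_metric (ip : V -> V -> R) (A : V -> V -> V -> V -> R)
    (ip' : W -> W -> R) (B : W -> W -> W -> W -> R) : Prop :=
  exists F : 'Hom(V, W), [/\ bijective F,
    forall x y, ip x y = ip' (F x) (F y)
  & forall x y z w, A x y z w = B (F x) (F y) (F z) (F w)].

Definition iso_hermitian
    (ip : V -> V -> R) (J : 'End(V)) (A : V -> V -> V -> V -> R)
    (ip' : W -> W -> R) (J' : 'End(W)) (B : W -> W -> W -> W -> R) : Prop :=
  exists F : 'Hom(V, W), [/\ bijective F,
    forall x y, ip x y = ip' (F x) (F y),
    forall x, F (J x) = J' (F x)
  & forall x y z w, A x y z w = B (F x) (F y) (F z) (F w)].

End Isomorphism.

Section Smooth.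
Context {R : realType} {E F : normedModType R}.

(* [E] is meant to be finite-dimensional and [U] open: the directional
   derivatives of order at most k exist on U and those of order k are
   continuous there. *)
Fixpoint Ck (k : nat) (U : set E) (f : E -> F) : Prop :=
  if k is k'.+1 then
    forall v, (forall x, U x -> derivable f x v) /\ Ck k' U ('D_v f)
  else forall x, U x -> {for x, continuous f}.

Definition smooth_on (U : set E) (f : E -> F) : Prop := forall k, Ck k U f.

End Smooth.

(* A chart is given by its domain and by total functions [fwd] and [bwd], of
   which only the restrictions to [dom] and [fwd @` dom] are relevant. *)
Record chart (R : realType) (m : nat) (T : topologicalType) := Chart {
  dom : set T;
  fwd : T -> 'rV[R]_m;
  bwd : 'rV[R]_m -> T;
  dom_open : open dom;
  cod_open : open (fwd @` dom);
  fwdK : forall P, dom P -> bwd (fwd P) = P;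
  fwd_continuous : forall P, dom P -> {for P, continuous fwd};
  bwd_continuous : forall x, (fwd @` dom) x -> {for x, continuous bwd} }.

Definition cod (R : realType) m (T : topologicalType) (c : chart R m T) :
  set 'rV[R]_m := fwd c @` dom c.

Definition smooth_transition (R : realType) m (T : topologicalType)
    (c c' : chart R m T) : Prop :=
  smooth_on (fwd c @` (dom c `&` dom c')) (fwd c' \o bwd c).

(* The smooth structure is the one generated by the atlas formed by the
   preferred charts [chart_at P], one around each point. *)
Record manifold (R : realType) (m : nat) := Manifold {
  carrier :> topologicalType;
  carrier_hausdorff : hausdorff_space carrier;
  carrier_second_countable : @second_countable carrier;
  chart_at : carrier -> chart R m carrier;
  chart_at_dom : forall P, dom (chart_at P) P;
  chart_at_smooth : forall P Q, smooth_transition (chart_at P) (chart_at Q) }.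

Section Manifold.
Context {R : realType} {m : nat} {M : manifold R m}.
Let E := 'rV[R]_m.
Implicit Types (c : chart R m M) (P Q : M) (X Y Z : M -> E) (f : M -> R).

Definition smooth_chart c : Prop :=
  forall P, smooth_transition (chart_at P) c /\ smooth_transition c (chart_at P).

(* The tangent space T_P M is 'rV[R]_m, a tangent vector being identified with
   its components in the preferred chart [chart_at P].  A vector field is thus a
   function M -> 'rV[R]_m (and a tensor field a function on M with values in
   the tensors on 'rV[R]_m), but its value at P is to be read in [chart_at P]:
   neither continuity nor smoothness is that of the bare function.
   [tcoord c P v] gives the components of v : T_P M in the chart c, and
   [coordvec c P i] is the coordinate vector d/dx_i of the chart c at P. *)
Definition tcoord c P (v : E) : E :=
  'D_v (fwd c \o bwd (chart_at P)) (fwd (chart_at P) P).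

Definition coordvec c P (i : 'I_m) : E :=
  'D_(delta_mx 0 i) (fwd (chart_at P) \o bwd c) (fwd c P).

Definition local_field c X : E -> E := fun x => tcoord c (bwd c x) (X (bwd c x)).

Definition smooth_fun f : Prop :=
  forall P, smooth_on (cod (chart_at P)) (f \o bwd (chart_at P)).

Definition smooth_field X : Prop :=
  forall P, smooth_on (cod (chart_at P)) (local_field (chart_at P) X).

Definition field_act X f : M -> R := fun P =>
  'D_(X P) (f \o bwd (chart_at P)) (fwd (chart_at P) P).

(* The Lie bracket [X, Y], computed at P in the chart [chart_at P]. *)
Definition lie_bracket X Y : M -> E := fun P =>
  let c := chart_at P in
  'D_(X P) (local_field c Y) (fwd c P) - 'D_(Y P) (local_field c X) (fwd c P).

Implicit Types (nabla : (M -> E) -> (M -> E) -> (M -> E)) (g : M -> E -> E -> R)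
  (J : M -> 'End(E)) (omega : M -> E -> R).

Definition connection nabla : Prop :=
  [/\ forall X Y, smooth_field X -> smooth_field Y -> smooth_field (nabla X Y),
      forall f X X' Y, smooth_fun f -> smooth_field X -> smooth_field X' ->
        smooth_field Y -> forall P,
        nabla (fun Q => f Q *: X Q + X' Q) Y P = f P *: nabla X Y P + nabla X' Y P,
      forall X Y Y', smooth_field X -> smooth_field Y -> smooth_field Y' ->
        forall P, nabla X (fun Q => Y Q + Y' Q) P = nabla X Y P + nabla X Y' P
    & forall f X Y, smooth_fun f -> smooth_field X -> smooth_field Y ->
        forall P, nabla X (fun Q => f Q *: Y Q) P =
          field_act X f P *: Y P + f P *: nabla X Y P].

Definition torsion_free nabla : Prop :=
  forall X Y, smooth_field X -> smooth_field Y ->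
    forall P, nabla X Y P - nabla Y X P = lie_bracket X Y P.

Definition affine_structure nabla : Prop := connection nabla /\ torsion_free nabla.

Definition curvature nabla X Y Z : M -> E := fun P =>
  nabla X (nabla Y Z) P - nabla Y (nabla X Z) P - nabla (lie_bracket X Y) Z P.

(* [Rm] is the value at P of the curvature operator: R(X, Y)Z at P depends only
   on the values of X, Y, Z at P, and every tangent vector is such a value. *)
Definition curvature_at nabla P (Rm : E -> E -> 'End(E)) : Prop :=
  forall X Y Z, smooth_field X -> smooth_field Y -> smooth_field Z ->
    curvature nabla X Y Z P = Rm (X P) (Y P) (Z P).

Definition lower g P (Rm : E -> E -> 'End(E)) : E -> E -> E -> E -> R :=
  fun x y z w => g P (Rm x y z) w.

Definition pseudo_metric (p q : nat) g : Prop :=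
  (forall P, inner_product p q (g P)) /\
  (forall X Y, smooth_field X -> smooth_field Y ->
    smooth_fun (fun P => g P (X P) (Y P))).

Definition one_form omega : Prop :=
  (forall P, scalar (omega P)) /\
  (forall X, smooth_field X -> smooth_fun (fun P => omega P (X P))).

(* (nabla_X g)(Y, Z) *)
Definition nabla_metric nabla g X Y Z : M -> R := fun P =>
  field_act X (fun Q => g Q (Y Q) (Z Q)) P
  - g P (nabla X Y P) (Z P) - g P (Y P) (nabla X Z P).

Definition levi_civita g nabla : Prop :=
  affine_structure nabla /\
  forall X Y Z, smooth_field X -> smooth_field Y -> smooth_field Z ->
    forall P, nabla_metric nabla g X Y Z P = 0.

Definition almost_cpx_structure (pc : bool) J : Prop :=
  (forall P, almost_cpx pc (J P)) /\
  (forall X, smooth_field X -> smooth_field (fun P => J P (X P))).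

Definition integrable (pc : bool) J : Prop :=
  exists2 k, m = k.*2 &
  forall P, exists c, [/\ smooth_chart c, dom c P
    & forall Q, dom c Q -> forall i j : 'I_m, j = (i + k)%N :> nat ->
        J Q (coordvec c Q i) = coordvec c Q j /\
        J Q (coordvec c Q j) = sgn pc *: coordvec c Q i].

(* (nabla_X J) Y = nabla_X (J Y) - J (nabla_X Y) vanishes. *)
Definition parallel nabla J : Prop :=
  forall X Y, smooth_field X -> smooth_field Y ->
    forall P, nabla X (fun Q => J Q (Y Q)) P = J P (nabla X Y P).

Definition almost_hermitian_structure pc p q g J : Prop :=
  [/\ pseudo_metric p q g, almost_cpx_structure pc J
    & forall P, J_compatible pc (g P) (J P)].

Definition hermitian_structure pc p q g J : Prop :=
  almost_hermitian_structure pc p q g J /\ integrable pc J.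

Definition weyl_structure p q g nabla : Prop :=
  [/\ pseudo_metric p q g, affine_structure nabla
    & exists omega, one_form omega /\
      forall X Y Z, smooth_field X -> smooth_field Y -> smooth_field Z ->
        forall P, nabla_metric nabla g X Y Z P =
          -2 * omega P (X P) * g P (Y P) (Z P)].

Definition kaehler_weyl_structure pc p q g J nabla : Prop :=
  [/\ hermitian_structure pc p q g J, weyl_structure p q g nabla
    & parallel nabla J].

End Manifold.

(* Main.v *)
(* Everything lives on the torus (R / 2 pi Z)^m, where tensor fields are periodic
   maps and the complex structures (except in the almost Hermitian case) are
   constant in an adapted basis.  At a point where the metric has vanishing
   gradient the curvature is a linear function of its Hessian H; for each type of
   model one finds H, linear in the curvature tensor A, whose curvature is A.  The
   Hessian is realized by adding to the constant metric terms
   (1 - cos (N l(x))) / N^2 h with l an integral linear form: they have the 2-jet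
   of l(x)^2 h / 2 at 0 and are uniformly small for N large, so that the signature
   is kept.
   - Almost Hermitian: the metric is the pullback of the constant one by an
     endomorphism field S A0^-1, and J is pulled back likewise.
   - Kaehler: h is the J-invariant part of l (x) l, which makes the fundamental
     form Omega closed.
   - Weyl: A splits into a Riemannian part and a part determined by the form psi;
     the Weyl form om is chosen with 2 D om = psi at the point.
   - Kaehler-Weyl: psi /\ Omega = 0 forces psi = 0 unless m = 2 or 4.  In these
     two dimensions one takes a Hermitian metric and solves
     d Omega = - 2 om /\ Omega for om, which gives nabla J = 0. *)
Require Import Defs.
From HB Require Import structures.
From mathcomp Require Import all_boot all_order all_algebra.
From mathcomp Require Import all_classical all_reals all_analysis.
From mathcomp Require Import ring lra zify.

Set Implicit Arguments.
Unset Strict Implicit.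
Unset Printing Implicit Defensive.

Import Order.TTheory GRing.Theory Num.Theory numFieldNormedType.Exports.

Local Open Scope classical_set_scope.
Local Open Scope ring_scope.

(** * Smooth functions *)

(** Compactness shapes the constructions. A polynomial metric with the right 2-jet lives only near
    the origin, and cutting it off would destroy the closedness of Omega. A periodic function of one
    linear form satisfies the closedness condition identically, so sums of such functions need no
    cutoff. The transition maps of the torus are translations by lattice vectors. Tangent vectors
    therefore have the same components in all charts, and the geometry becomes calculus of periodic
    maps on R^m. In the affine case there is no metric to choose: the Christoffel symbols are
    (A(x,y)z + A(x,z)y)/3, with the position x replaced by the vector of its sines. For Kaehler-Weyl
    models, d Omega = - 2 om /\ Omega is not a differential equation for om. The metric is given,
    and the equation is linear algebra at each point: in dimension 4 the wedge product with Omega is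
    an isomorphism from 1-forms to 3-forms, and in dimension 2 both sides vanish. *)

Section CkTheory.
Context {R : realType} {E F : normedModType R}.
Implicit Types (U W : set E) (f g : E -> F) (k : nat).

Lemma Ck_sub k U W f : U `<=` W -> Ck k W f -> Ck k U f.
Proof.
elim: k f => [|k IH] f UW /=; first by move=> fW x /UW /fW.
by move=> fW v; have [dv cv] := fW v; split; [move=> x /UW /dv|exact: IH].
Qed.

Lemma Ck_congr k U f g : open U -> (forall x, U x -> f x = g x) ->
  Ck k U f -> Ck k U g.
Proof.
elim: k f g => [|k IH] f g Uo fg /=.
  move=> cf x Ux; have := cf x Ux.
  have nfg : {near x, f =1 g}.
    by apply: filterS (open_nbhs_nbhs (conj Uo Ux)) => y; exact: fg.
  move=> cfx; rewrite /prop_for /continuous_at -(fg _ Ux).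
  by apply: cvg_trans cfx; apply: near_eq_cvg; apply: filterS nfg => y ->.
move=> cf v; have [dv cv] := cf v.
have nfg x : U x -> {near x, f =1 g}.
  by move=> Ux; apply: filterS (open_nbhs_nbhs (conj Uo Ux)) => y; exact: fg.
split=> [x Ux|]; first by apply: near_eq_derivable (dv x Ux); exact: nfg.
by apply: IH cv => // x Ux; apply: near_eq_derive; exact: nfg.
Qed.

Lemma Ck_local k U f :
  (forall x, U x -> exists W, [/\ open W, W x & Ck k W f]) -> Ck k U f.
Proof.
elim: k f => [|k IH] f loc /=.
  by move=> x Ux; have [W [_ Wx cf]] := loc x Ux; exact: cf.
move=> v; split=> [x Ux|].
  by have [W [_ Wx cf]] := loc x Ux; exact: (cf v).1.
by apply: IH => x Ux; have [W [Wo Wx cf]] := loc x Ux; exists W; split=> //;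
  exact: (cf v).2.
Qed.

Lemma derivable_translate f x v t :
  derivable (fun y => f (y + t)) x v <-> derivable f (x + t) v.
Proof. by rewrite /derivable /=; under eq_fun do rewrite -addrA. Qed.

Lemma derive_translate f x v t :
  'D_v (fun y => f (y + t)) x = 'D_v f (x + t).
Proof. by rewrite /derive /=; under eq_fun do rewrite -addrA. Qed.

Lemma Ck_translate k U f t :
  Ck k U f -> Ck k [set x | U (x + t)] (fun y => f (y + t)).
Proof.
elim: k f => [|k IH] f /= cf.
  move=> x Ux; have := cf _ Ux; rewrite /prop_for => cfx.
  apply: (@cvg_comp _ _ _ (fun y => y + t) f _ _ _ _ cfx).
  by apply: cvgD; [exact: cvg_id|exact: cvg_cst].
move=> v; have [dv cv] := cf v; split=> [x Ux|].
  by apply/derivable_translate; exact: dv.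
have -> : 'D_v (fun y => f (y + t)) = fun y => 'D_v f (y + t).
  by apply/funext => y; rewrite derive_translate.
exact: (IH _ cv).
Qed.

Lemma smooth_on_sub U W f : U `<=` W -> smooth_on W f -> smooth_on U f.
Proof. by move=> UW sf k; apply: Ck_sub (sf k). Qed.

Lemma smooth_on_congr U f g : open U -> (forall x, U x -> f x = g x) ->
  smooth_on U f -> smooth_on U g.
Proof. by move=> Uo fg sf k; apply: Ck_congr (sf k). Qed.

Lemma smooth_on_local U f :
  (forall x, U x -> exists W, [/\ open W, W x & smooth_on W f]) -> smooth_on U f.
Proof.
move=> loc k; apply: Ck_local => x Ux; have [W [Wo Wx sf]] := loc x Ux.
by exists W; split.
Qed.

Definition smooth f := smooth_on setT f.

Lemma smooth_cont f : smooth f -> continuous f.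
Proof. by move=> sf x; exact: (sf 0%N x I). Qed.

Lemma smooth_derivable f x v : smooth f -> derivable f x v.
Proof. by move=> sf; exact: (sf 1%N v).1. Qed.

Lemma smooth_derive f v : smooth f -> smooth ('D_v f).
Proof. by move=> sf k; exact: (sf k.+1 v).2. Qed.

Lemma Ck_ext k U f g : f =1 g -> Ck k U f -> Ck k U g.
Proof. by move=> /funext ->. Qed.

Lemma Ck_add k f g : Ck k setT f -> Ck k setT g -> Ck k setT (fun x => f x + g x).
Proof.
elim: k f g => [|k IH] f g /= cf cg.
  by move=> x Ux; apply: cvgD; [exact: cf|exact: cg].
move=> v; have [df Cf] := cf v; have [dg Cg] := cg v; split=> [x Ux|].
  by apply: derivableD; [exact: df|exact: dg].
rewrite [X in Ck k _ X](_ : _ = fun x => 'D_v f x + 'D_v g x); first exact: IH.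
by apply/funext => x; rewrite deriveD; [|exact: df|exact: dg].
Qed.

Lemma smoothD f g : smooth f -> smooth g -> smooth (fun x => f x + g x).
Proof. by move=> sf sg k; exact: Ck_add. Qed.

Lemma smooth_cst (a : F) : smooth (fun=> a).
Proof.
move=> k; elim: k a => [|k IH] a /=; first by move=> x _; exact: cvg_cst.
move=> v; split=> [x _|]; first exact: derivable_cst.
rewrite [X in Ck k _ X](_ : _ = fun=> 0); first exact: IH.
by apply/funext => x; rewrite derive_cst.
Qed.

Lemma smooth_ext f g : f =1 g -> smooth f -> smooth g.
Proof. by move=> /funext ->. Qed.

Lemma smooth_sum (I : Type) (r : seq I) (P : pred I) (h : I -> E -> F) :
  (forall i, smooth (h i)) -> smooth (fun x => \sum_(i <- r | P i) h i x).
Proof.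
move=> sh; elim: r => [|i r IH].
  by apply: (smooth_ext (f := fun=> 0)) => [x|]; [rewrite big_nil|exact: smooth_cst].
case Pi: (P i).
  apply: (smooth_ext (f := fun x => h i x + \sum_(j <- r | P j) h j x)) => [x|].
    by rewrite big_cons Pi.
  exact: smoothD.
by apply: smooth_ext IH => x; rewrite big_cons Pi.
Qed.

End CkTheory.

Section ScalarSmooth.
Context {R : realType} {E : normedModType R}.
Implicit Types (f g h : E -> R) (k : nat).

Lemma derive_mul f g x v : derivable f x v -> derivable g x v ->
  'D_v (fun y => f y * g y) x = 'D_v f x * g x + f x * 'D_v g x.
Proof.
move=> df dg; rewrite (_ : (fun y => f y * g y) = f * g) // deriveM //.
by rewrite addrC [g x *: _]mulrC.
Qed.

(** Both factors are assumed smooth and not merely of order k: the product rule leaves one factor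
    underived, and with directional derivatives order k+1 does not formally contain order k. *)
Lemma Ck_mul k f g : smooth f -> smooth g -> Ck k setT (fun x => f x * g x).
Proof.
elim: k f g => [|k IH] f g sf sg /=.
  by move=> x _; apply: cvgM; exact: smooth_cont.
move=> v; split=> [x _|]; first by apply: derivableM; exact: smooth_derivable.
rewrite [X in Ck k _ X](_ : _ = fun x => 'D_v f x * g x + f x * 'D_v g x).
  by apply: Ck_add; apply: IH => //; exact: smooth_derive.
by apply/funext => x; apply: derive_mul; exact: smooth_derivable.
Qed.

Lemma smoothM f g : smooth f -> smooth g -> smooth (fun x => f x * g x).
Proof. by move=> sf sg k; exact: Ck_mul. Qed.

Lemma smoothN f : smooth f -> smooth (fun x => - f x).
Proof.
move=> sf; apply: (smooth_ext (f := fun x => -1 * f x)) => [x|].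
  by rewrite mulN1r.
by apply: smoothM => //; exact: smooth_cst.
Qed.

Lemma smoothB f g : smooth f -> smooth g -> smooth (fun x => f x - g x).
Proof. by move=> sf sg; apply: smoothD => //; exact: smoothN. Qed.

Lemma smooth_prod (I : Type) (r : seq I) (P : pred I) (h : I -> E -> R) :
  (forall i, smooth (h i)) -> smooth (fun x => \prod_(i <- r | P i) h i x).
Proof.
move=> sh; elim: r => [|i r IH].
  by apply: smooth_ext (smooth_cst (1 : R)) => x; rewrite big_nil.
case Pi: (P i).
  apply: (smooth_ext (f := fun x => h i x * \prod_(j <- r | P j) h j x)) => [x|].
    by rewrite big_cons Pi.
  exact: smoothM.
by apply: smooth_ext IH => x; rewrite big_cons Pi.
Qed.

(* The shape [h / f ^+ n] is stable under derivation. *)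
Lemma smoothV f : smooth f -> (forall x, f x != 0) -> smooth (fun x => (f x)^-1).
Proof.
move=> sf f0 k; suff H : forall n h, smooth h ->
    Ck k setT (fun x => h x * (f x)^-1 ^+ n).
  by apply: Ck_ext (H 1%N _ (smooth_cst (1 : R))) => x; rewrite mul1r expr1.
have dV x v : is_derive x v (fun x => (f x)^-1) (- 'D_v f x * (f x)^-1 ^+ 2).
  apply: DeriveDef; first by apply: derivableV => //; exact: smooth_derivable.
  rewrite deriveV //; last exact: smooth_derivable.
  by rewrite /GRing.scale /= exprVn; field; exact: f0.
have dX n x v : is_derive x v (fun x => (f x)^-1 ^+ n)
    (- n%:R * 'D_v f x * (f x)^-1 ^+ n.+1).
  elim: n => [|n IHn].
    by rewrite oppr0 !mul0r; apply: is_derive_cst.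
  have -> : (fun x => (f x)^-1 ^+ n.+1) = (fun x => (f x)^-1 * (f x)^-1 ^+ n).
    by apply/funext => y; rewrite exprS.
  apply: DeriveDef; first by apply: derivableM; exact: ex_derive.
  rewrite derive_mul; [|exact: ex_derive|exact: ex_derive].
  by rewrite !derive_val !exprS -natr1; ring.
have cX n : continuous (fun x => (f x)^-1 ^+ n).
  elim: n => [|n IHn] x; first exact: cvg_cst.
  have -> : (fun x => (f x)^-1 ^+ n.+1) = (fun x => (f x)^-1 * (f x)^-1 ^+ n).
    by apply/funext => y; rewrite exprS.
  by apply: cvgM; [apply: cvgV => //; exact: smooth_cont|exact: IHn].
elim: k => [|k IH] n h sh /=.
  move=> x _; apply: cvgM; first exact: smooth_cont.
  exact: cX.
move=> v; split=> [x _|].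
  by apply: derivableM; [exact: smooth_derivable|exact: ex_derive].
have sd : smooth (fun x => 'D_v h x * f x - n%:R * (h x * 'D_v f x)).
  apply: smoothB; first by apply: smoothM => //; exact: smooth_derive.
  apply: smoothM; first exact: smooth_cst.
  by apply: smoothM => //; exact: smooth_derive.
apply: Ck_ext (IH n.+1 _ sd) => x.
rewrite derive_mul; [|exact: smooth_derivable|exact: ex_derive].
by rewrite derive_val exprS; field; exact: f0.
Qed.

End ScalarSmooth.

(** * Linearity in the direction and symmetry of second derivatives *)

Section DirectionalDerivatives.
Context {R : realType} {E : normedModType R}.
Implicit Types (f : E -> R) (x u v : E).

Lemma derive_line0 f x v : 'D_v f x = 'D_1 (fun t : R => f (t *: v + x)) 0.
Proof.
rewrite /derive; set g1 := fun h => h^-1 *: _; set g2 := fun h => h^-1 *: _.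
suff -> : g1 = g2 by [].
by rewrite funeqE /g1 /g2 => h /=; rewrite addr0 scale0r add0r [_%:A]mulr1.
Qed.

Lemma is_derive_line f x v (h : R) : derivable f (h *: v + x) v ->
  is_derive h 1 (fun t : R => f (t *: v + x)) ('D_v f (h *: v + x)).
Proof.
move=> df; pose phi (t : R) := f (t *: v + x).
have phiE : (fun t => phi (t + h)) = fun t => f (t *: v + (h *: v + x)).
  by apply/funext => t; rewrite /phi scalerDl addrA.
apply: DeriveDef.
  rewrite -[h in derivable _ h]add0r; apply/derivable_translate.
  by rewrite phiE; exact: (derivable1P _ _ _).1.
have := derive_translate phi 0 (1 : R) h; rewrite add0r phiE => <-.
by rewrite [RHS]derive_line0.
Qed.

Lemma derive_scale f x v (c : R) : (forall y, derivable f y v) ->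
  'D_(c *: v) f x = c * 'D_v f x.
Proof.
move=> df; have df0 := df x.
rewrite derive_line0.
have -> : (fun t : R => f (t *: (c *: v) + x)) =
    (fun t : R => f (t *: v + x)) \o (fun t : R => c * t).
  by apply/funext => t /=; rewrite scalerA [c * t]mulrC.
have dl : is_derive (0 : R) 1 (fun t : R => c * t) c.
  by have := is_deriveZ c (is_derive_id (0 : R) 1); rewrite /GRing.scale /= mulr1.
have dp : is_derive (c * 0) 1 (fun t : R => f (t *: v + x)) ('D_v f x).
  by have := @is_derive_line f x v (c * 0) (df _); rewrite mulr0 scale0r add0r.
have := @is_derive1_comp R _ _ 0 _ _ dp dl.
by move=> dc; rewrite derive_val mulrC.
Qed.

(** Passing to the direction [t *: v] puts the mean value theorem on the unit interval, which covers
    both signs of [t] at once. *)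
Lemma line_MVT f x v (t : R) : (forall y, derivable f y v) ->
  exists2 s, `|s| <= `|t| & f (t *: v + x) - f x = t * 'D_v f (s *: v + x).
Proof.
move=> df; pose w := t *: v.
have dw y : derivable f y w.
  apply/derivable1P.
  have -> : (fun h : R => f (h *: w + y)) =
      (fun h : R => f (h *: v + y)) \o (fun h : R => t * h).
    by apply/funext => h /=; rewrite scalerA [t * h]mulrC.
  have dl : is_derive (0 : R) 1 (fun h : R => t * h) t.
    by have := is_deriveZ t (is_derive_id (0 : R) 1); rewrite /GRing.scale /= mulr1.
  have := @is_derive1_comp R _ _ 0 _ _ (@is_derive_line f y v (t * 0) (df _)) dl.
  by case.
have /(@MVT_segment _ _ _ _ _ ler01)[] : forall h : R, h \in `]0, 1[ ->
    is_derive h 1 (fun h : R => f (h *: w + x)) ('D_w f (h *: w + x)).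
  by move=> h _; exact: is_derive_line.
  apply: derivable_within_continuous => h _.
  exact: (@ex_derive _ _ _ _ _ _ _ (@is_derive_line f x w h (dw _))).
move=> c /[!in_itv]/= /andP[c0 c1]; rewrite scale1r scale0r add0r subr0 mulr1 => E1.
exists (c * t); first by rewrite normrM ger0_norm// ler_piMl.
by rewrite E1 derive_scale// /w scalerA.
Qed.

Lemma near_line x u v (A : set E) : nbhs x A ->
  exists2 d : R, 0 < d & forall s t, `|s| <= d -> `|t| <= d -> A (s *: u + (t *: v + x)).
Proof.
(* The summand 1 keeps [K] positive when both directions vanish; the factor 2 in the radius makes
   the final bound strict. *)
move=> /nbhs_ballP[e /= e0 eA]; pose K := `|u| + `|v| + 1.
have K0 : 0 < K by rewrite /K ltr_wpDl// addr_ge0.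
exists (e / (2 * K)) => [|s t sd td]; first by rewrite divr_gt0// mulr_gt0.
apply: eA; rewrite -ball_normE /ball_ /=.
have -> : x - (s *: u + (t *: v + x)) = - (s *: u + t *: v).
  by rewrite addrA opprD addrCA subrr addr0.
rewrite normrN (le_lt_trans (ler_normD _ _))// !normrZ.
have le1 : `|s| * `|u| + `|t| * `|v| <= e / (2 * K) * K.
  have d0 : 0 < e / (2 * K) by rewrite divr_gt0// mulr_gt0.
  have := normr_ge0 u; have := normr_ge0 v; rewrite {2}/K; nra.
apply: le_lt_trans le1 _.
have -> : e / (2 * K) * K = e / 2 by field; rewrite gt_eqF.
by rewrite gtr_pMr// invf_lt1 ?ltr1n.
Qed.

(** Additivity in the direction is not automatic for directional derivatives. The difference
    quotient is split at [h *: v + x]; by the mean value theorem the [u]-part is a value of ['D_u f]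
    at a point tending to [x], where continuity applies. *)
Lemma derive_add f x u v : (forall y, derivable f y u) ->
  (forall y, derivable f y v) -> {for x, continuous ('D_u f)} ->
  'D_(u + v) f x = 'D_u f x + 'D_v f x.
Proof.
move=> du dv cu; apply: cvg_lim => //.
have -> : (fun h => h^-1 *: ((f \o shift x) (h *: (u + v)) - f x)) =
    (fun h => h^-1 * (f (h *: u + (h *: v + x)) - f (h *: v + x))) \+
    (fun h => h^-1 *: ((f \o shift x) (h *: v) - f x)).
  apply/funext => h /=; transitivity (h^-1 * (f (h *: u + (h *: v + x)) - f x)).
    by rewrite [h *: (u + v)]scalerDr -addrA.
  transitivity (h^-1 * (f (h *: u + (h *: v + x)) - f (h *: v + x)) +
    h^-1 * (f (h *: v + x) - f x)) => //.
  by rewrite -mulrDr; congr (_ * _); ring.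
apply: cvgD; last exact: (dv x).
apply/cvgrPdist_le => e e0.
have ne : nbhs x [set y | `|'D_u f x - 'D_u f y| <= e].
  by move/cvgrPdist_le : cu => /(_ e e0).
have [d d0 Hd] := near_line u v ne.
near=> h.
have hd : `|h| <= d by near: h; exact: dnbhs0_le.
have h0 : h != 0 by near: h; exact: nbhs_dnbhs_neq.
have [s sh ->] := @line_MVT f (h *: v + x) u h du.
by rewrite mulKf//; apply: Hd => //; exact: le_trans hd.
Unshelve. all: by end_near. Qed.

(** The two functions are compared at different points [p] and [q], because two separate mean value
    arguments yield two different intermediate points. *)
Lemma continuous_eq (A B : E -> R) x :
  {for x, continuous A} -> {for x, continuous B} ->
  (forall W, nbhs x W -> exists p q, [/\ W p, W q & A p = B q]) -> A x = B x.
Proof.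
move=> cA cB AB; apply/eqP; rewrite -subr_eq0 -normr_le0.
apply/ler_addgt0Pr => e e0; rewrite add0r.
have e2 : 0 < e / 2 by rewrite divr_gt0.
have nW : nbhs x [set y | `|A x - A y| <= e / 2 /\ `|B x - B y| <= e / 2].
  apply: filterI; first by have /cvgrPdist_le/(_ _ e2) := cA.
  by have /cvgrPdist_le/(_ _ e2) := cB.
have [p [q [[Ap _] [_ Bq] Epq]]] := AB _ nW.
have -> : A x - B x = (A x - A p) + (B q - B x) by rewrite Epq addrA addrNK.
by rewrite (splitr e) (le_trans (ler_normD _ _))// lerD// distrC.
Qed.

(** The second difference over the parallelogram spanned by [t *: u] and [t *: v] is symmetric in
    the two directions. Applying the mean value theorem twice, in either order, writes it as [t * t]
    times a mixed derivative at a nearby point. *)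
Theorem derive_comm f x u v : smooth f -> 'D_u ('D_v f) x = 'D_v ('D_u f) x.
Proof.
move=> sf.
have key (a b : E) (t : R) : exists s r, [/\ `|s| <= `|t|, `|r| <= `|t| &
    f (t *: a + (t *: b + x)) - f (t *: b + x) - f (t *: a + x) + f x
    = t * t * 'D_a ('D_b f) (r *: a + (s *: b + x))].
  pose F y := f (t *: a + y) - f y.
  have sFa : smooth (fun y => f (t *: a + y)).
    move=> k; apply: (Ck_ext (f := fun y => f (y + t *: a))) => [y|].
      by rewrite addrC.
    exact: Ck_sub (Ck_translate (t *: a) (sf k)).
  have sF : smooth F by exact: smoothB.
  have [s st Es] := @line_MVT F x b t (fun y => smooth_derivable sF).
  have [r rt Er] := @line_MVT ('D_b f) (s *: b + x) a t
    (fun y => smooth_derivable (smooth_derive b sf)).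
  exists s, r; split=> //; rewrite -mulrA -Er.
  have <- : 'D_b F (s *: b + x) =
      'D_b f (t *: a + (s *: b + x)) - 'D_b f (s *: b + x).
    rewrite /F (_ : (fun y => _) = (fun y => f (t *: a + y)) - f)//.
    rewrite deriveB; [|exact: smooth_derivable..].
    congr (_ - _); under eq_fun do rewrite addrC.
    by rewrite derive_translate addrC.
  by rewrite -Es /F opprB [RHS]addrA [RHS]addrAC.
have c2 (a b : E) : {for x, continuous ('D_a ('D_b f))}.
  exact: (smooth_cont (smooth_derive a (smooth_derive b sf))).
apply: (@continuous_eq ('D_u ('D_v f)) ('D_v ('D_u f)) x (c2 u v) (c2 v u)).
move=> W nW.
have [d1 d10 H1] := near_line u v nW.
have [d2 d20 H2] := near_line v u nW.
pose t := Num.min d1 d2.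
have t0 : 0 < t by rewrite lt_min d10.
have tn : `|t| = t by rewrite gtr0_norm.
have t1 : t <= d1 by rewrite ge_min lexx.
have t2 : t <= d2 by rewrite ge_min lexx orbT.
have [s [r [st rt E1]]] := key u v t.
have [s' [r' [st' rt' E2]]] := key v u t.
rewrite tn in st rt st' rt'.
exists (r *: u + (s *: v + x)), (r' *: v + (s' *: u + x)); split.
- by apply: H1; [exact: le_trans rt t1|exact: le_trans st t1].
- by apply: H2; [exact: le_trans rt' t2|exact: le_trans st' t2].
apply: (@mulfI _ (t * t)); first by rewrite mulf_neq0// gt_eqF.
apply: etrans (etrans (esym E1) _) E2; congr (_ + _).
by rewrite [t *: u + (_ + _)]addrCA addrAC.
Qed.

End DirectionalDerivatives.

Section VectorValued.
Context {R : realType} {E : normedModType R} {a b : nat}.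
Implicit Types (Y : E -> 'M[R]_(a, b)).

Lemma continuous_mx (T : topologicalType) (Z : T -> 'M[R]_(a, b)) (x : T) :
  (forall i j, {for x, continuous (fun y => Z y i j)}) -> {for x, continuous Z}.
Proof.
move=> cZ; apply/cvgrPdist_le => /= e e0; near=> y.
rewrite /Num.Def.normr/= mx_normrE (bigmax_le _ (ltW e0))//= => i _.
rewrite !mxE/=; move: i; near: y; apply: filter_forall => /= i.
exact: ((cvgrPdist_le _ _).1 (cZ i.1 i.2)).
Unshelve. all: by end_near. Qed.

Lemma Ck_mxP k (U : set E) Y : open U ->
  Ck k U Y <-> forall i j, Ck k U (fun x => Y x i j).
Proof.
move=> Uo; elim: k Y => [|k IH] Y /=.
  split=> [cY i j x Ux|cY x Ux].
    apply: (cvg_comp _ (fun M : 'M[R]_(a, b) => M i j) (cY x Ux)).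
    exact: coord_continuous.
  by apply: continuous_mx => i j; exact: cY.
have DE v : (forall x, U x -> derivable Y x v) -> forall i j x, U x ->
    'D_v Y x i j = 'D_v (fun x => Y x i j) x.
  by move=> dY i j x Ux; rewrite derive_mx ?mxE//; exact: dY.
split=> [cY i j v|cY v].
  have [dY CY] := cY v; split=> [x Ux|].
    exact: ((derivable_mxP _ _ _).1 (dY x Ux)).
  by apply: Ck_congr ((IH _).1 CY i j) => // x Ux; exact: DE.
have dY x : U x -> derivable Y x v.
  by move=> Ux; apply/derivable_mxP => i j; exact: (cY i j v).1.
split=> //; apply/IH => i j.
by apply: Ck_congr (cY i j v).2 => // x Ux; rewrite DE.
Qed.

Lemma smooth_mxP Y : smooth Y <-> forall i j, smooth (fun x => Y x i j).
Proof.
split=> [sY i j k|sY k]; first exact: ((Ck_mxP _ _ openT).1 (sY k)).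
by apply/(Ck_mxP _ _ openT) => i j; exact: sY.
Qed.

Lemma derive_mxE Y x v i j : smooth Y ->
  'D_v Y x i j = 'D_v (fun x => Y x i j) x.
Proof. by move=> sY; rewrite derive_mx ?mxE//; exact: smooth_derivable. Qed.

End VectorValued.

Local Opaque derive.

(** * Linear forms and trigonometric functions on R^m *)

Section RowSpace.
Context {R : realType} {m : nat}.
Local Notation E := 'rV[R]_m.
Implicit Types (f g : E -> R) (u v x l : E) (X Y : E -> E).

Definition dot l x : R := \sum_i l 0 i * x 0 i.

Lemma dotDr l x y : dot l (x + y) = dot l x + dot l y.
Proof. by rewrite /dot -big_split; apply: eq_bigr => i _; rewrite mxE mulrDr. Qed.

Lemma dotZr l c x : dot l (c *: x) = c * dot l x.
Proof. by rewrite /dot mulr_sumr; apply: eq_bigr => i _; rewrite mxE mulrCA. Qed.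

Lemma dot0r l : dot l 0 = 0.
Proof. by rewrite /dot big1// => i _; rewrite mxE mulr0. Qed.

Lemma dot_delta i x : dot (delta_mx 0 i) x = x 0 i.
Proof.
rewrite /dot (bigD1 i)//= mxE !eqxx mul1r big1 ?addr0// => j ji.
by rewrite mxE eqxx /= (negPf ji) mul0r.
Qed.

Lemma continuous_dot l : continuous (dot l).
Proof.
apply: (@continuous_big _ _ _ _ _ add_continuous) => i _ y.
apply: (@continuous_comp E R R (fun z : E => z 0 i) ( *%R (l 0 i))).
  exact: coord_continuous.
exact: mulrl_continuous.
Qed.

Lemma is_derive_comp_dot (phi : R -> R) (d : R) l x v :
  is_derive (dot l x) 1 phi d -> is_derive x v (phi \o dot l) (d * dot l v).
Proof.
move=> dphi; have dl : is_derive (0 : R) 1 (fun t : R => t * dot l v + dot l x) (dot l v).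
  have := is_deriveD (is_deriveM (is_derive_id (0 : R) 1)
    (is_derive_cst (dot l v) (0 : R) 1)) (is_derive_cst (dot l x) (0 : R) 1).
  by rewrite /GRing.scale /= mulr1 mul0r add0r addr0.
have dphi0 : is_derive (0 * dot l v + dot l x) 1 phi d by rewrite mul0r add0r.
have lineE : (fun t : R => (phi \o dot l) (t *: v + x)) =
    phi \o (fun t : R => t * dot l v + dot l x).
  by apply/funext => t /=; rewrite dotDr dotZr.
have D := @is_derive1_comp R _ _ 0 _ _ dphi0 dl.
apply: DeriveDef; first by apply/derivable1P; rewrite lineE; case: D.
by rewrite derive_line0 lineE; case: D.
Qed.

(** Cosine and sine are kept together so that the family is closed under derivation: ['D_v] maps the
    coefficients [(a, b)] to [(b l(v), - a l(v))]. *)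
Definition trigf (a b : R) l x := a * cos (dot l x) + b * sin (dot l x).

Lemma is_derive_trigf a b l x v :
  is_derive x v (trigf a b l) (trigf (b * dot l v) (- a * dot l v) l x).
Proof.
have D := is_deriveD (is_deriveZ a (is_derive_comp_dot v (is_derive_cos (dot l x))))
  (is_deriveZ b (is_derive_comp_dot v (is_derive_sin (dot l x)))).
rewrite (_ : trigf (b * _) _ _ _ =
    a *: (- sin (dot l x) * dot l v) + b *: (cos (dot l x) * dot l v)); first exact: D.
by rewrite /trigf /GRing.scale /=; ring.
Qed.

Lemma smooth_trigf a b l : smooth (trigf a b l).
Proof.
move=> k; elim: k a b => [|k IH] a b /=.
  move=> x _; apply: (@continuous_comp E R R (dot l) (fun t => a * cos t + b * sin t)).
    exact: continuous_dot.
  apply: cvgD; apply: cvgM; first exact: cvg_cst.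
  - exact: continuous_cos.
  - exact: cvg_cst.
  - exact: continuous_sin.
move=> v; split=> [x _|]; first by case: (is_derive_trigf a b l x v).
apply: Ck_ext (IH (b * dot l v) (- a * dot l v)) => x.
by case: (is_derive_trigf a b l x v).
Qed.

Lemma derive_trigf a b l x v :
  'D_v (trigf a b l) x = trigf (b * dot l v) (- a * dot l v) l x.
Proof. by case: (is_derive_trigf a b l x v). Qed.

Lemma smooth_dot l : smooth (dot l).
Proof.
have dd x v : is_derive x v (dot l) (dot l v).
  by have := is_derive_comp_dot v (is_derive_id (dot l x) 1); rewrite mul1r.
case=> [x _|k v] /=; first exact: continuous_dot.
split=> [x _|]; first by case: (dd x v).
by apply: Ck_ext (@smooth_cst _ _ _ (dot l v) k) => x; case: (dd x v).
Qed.

Lemma derive_sumE f x v : smooth f ->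
  'D_v f x = \sum_i v 0 i * 'D_(delta_mx 0 i) f x.
Proof.
move=> sf; rewrite {1}(row_sum_delta v).
elim/big_rec2: _ => [|i r w _ IH]; first exact: derive0.
rewrite derive_add; first by rewrite derive_scale ?IH// => y; exact: smooth_derivable.
- by move=> y; exact: smooth_derivable.
- by move=> y; exact: smooth_derivable.
- exact: (smooth_cont (smooth_derive _ sf)).
Qed.

Lemma derive_lin f x c u v : smooth f ->
  'D_(c *: u + v) f x = c * 'D_u f x + 'D_v f x.
Proof.
move=> sf; rewrite derive_add; [|move=> y; exact: smooth_derivable..|].
  by rewrite derive_scale// => y; exact: smooth_derivable.
exact: (smooth_cont (smooth_derive _ sf)).
Qed.

End RowSpace.

(** * The torus *)

Section Angles.
Context {R : realType}.
Implicit Types (s t d : R).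

Definition turn : R := pi *+ 2.

Lemma turn_gt0 : 0 < turn.
Proof. by rewrite pmulrn_lgt0 // pi_gt0. Qed.

Lemma periodicz (f : R -> R) : periodic f turn ->
  forall (k : int) t, f (t + turn * k%:~R) = f t.
Proof.
move=> pf; have pn n t : f (t + turn * n%:R) = f t by rewrite mulr_natr periodicn.
case=> n t; first by rewrite -pmulrn.
by rewrite -[in RHS](subrK (turn * n.+1%:R) t) pn NegzE mulrNz mulrN.
Qed.

Lemma cos_turn (k : int) t : cos (t + turn * k%:~R) = cos t.
Proof. exact/periodicz/cosD2pi. Qed.

Lemma sin_turn (k : int) t : sin (t + turn * k%:~R) = sin t.
Proof. exact/periodicz/sinD2pi. Qed.

Lemma cos_half d : cos d = cos (d / 2) ^+ 2 *+ 2 - 1.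
Proof. by rewrite -cos_mulr2n; congr cos; lra. Qed.

Lemma sin_half d : sin d = (cos (d / 2) * sin (d / 2)) *+ 2.
Proof. by rewrite -sin_mulr2n; congr sin; lra. Qed.

Lemma cos_eq1 d : - turn < d < turn -> cos d = 1 -> d = 0.
Proof.
move=> /andP[d1 d2]; rewrite cos_half cos2sin2 => cd1.
have s0 : sin (d / 2) = 0 by apply/eqP; rewrite -sqrf_eq0; apply/eqP; lra.
rewrite /turn in d1 d2; have [d0|d0|//] := ltgtP d 0.
  suff : 0 < sin (- (d / 2)) by rewrite sinN s0 oppr0 ltxx.
  by apply: sin_gt0_pi; apply/andP; split; lra.
suff : 0 < sin (d / 2) by rewrite s0 ltxx.
by apply: sin_gt0_pi; apply/andP; split; lra.
Qed.

Lemma cos_gtN1 d : - pi < d < pi -> cos d != - 1.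
Proof.
move=> /andP[d1 d2]; rewrite cos_half.
have c0 : 0 < cos (d / 2) by apply: cos_gt0_pihalf; apply/andP; split; lra.
by apply/eqP => c1; have := exprn_gt0 2 c0; lra.
Qed.

(* The determination in [-pi, pi] of an angle, from its sine and cosine. *)
Definition angle (c s : R) : R := 2 * atan (s / (1 + c)).

Lemma angleK d : - pi < d < pi -> angle (cos d) (sin d) = d.
Proof.
move=> /andP[d1 d2]; rewrite /angle.
have c0 : 0 < cos (d / 2) by apply: cos_gt0_pihalf; apply/andP; split; lra.
have -> : sin d / (1 + cos d) = tan (d / 2).
  rewrite /tan (sin_half d) (cos_half d); field; rewrite gt_eqF//=.
  by apply/eqP; nra.
rewrite tanK; first by field.
by rewrite in_itv/=; apply/andP; split; lra.
Qed.

Lemma angle_rep d : exists k : int, - pi <= d + turn * k%:~R < pi.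
Proof.
exists (- Num.floor ((d + pi) / turn)); have := turn_gt0 => t0.
have := real_floor_le (num_real ((d + pi) / turn)); have := real_floorD1_gt (num_real ((d +
  pi) / turn)).
rewrite ltr_pdivrMr// ler_pdivlMr// intrD rmorphN /= /turn => h1 h2.
by apply/andP; split; lra.
Qed.

End Angles.

Section AngleContinuity.
Context {R : realType} {T : topologicalType} {x : T}.
Implicit Types f g : T -> R.

Lemma continuous_lincomb f g (a b : R) : {for x, continuous f} ->
  {for x, continuous g} -> {for x, continuous (fun y => a * f y + b * g y)}.
Proof.
move=> cf cg; apply: (@cvgD _ R); apply: cvgM => //; exact: cvg_cst.
Qed.

Lemma continuous_angle f g (a : R) : f x != -1 -> {for x, continuous f} ->
  {for x, continuous g} -> {for x, continuous (fun y => a + angle (f y) (g y))}.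
Proof.
move=> fx cf cg; apply: cvgD; first exact: cvg_cst.
apply: cvgM; first exact: cvg_cst.
apply: (@continuous_comp T R R (fun y => g y / (1 + f y)) atan); last first.
  exact: continuous_atan.
apply: cvgM => //; apply: cvgV; first by rewrite addrC addr_eq0.
by apply: cvgD => //; exact: cvg_cst.
Qed.

End AngleContinuity.

(** * Topology of the torus *)

Section TorusTopology.
Context {R : realType} {m : nat}.
Local Notation E := 'rV[R]_m.

Definition in_cell (x : E) : bool :=
  [forall i, (0 <= x 0 i) && (x 0 i < turn)].

Lemma in_cell0 : in_cell 0.
Proof. by apply/forallP => i; rewrite mxE lexx turn_gt0. Qed.

Definition cell := {x : E | in_cell x}.
HB.instance Definition _ := Choice.on cell.


Definition circle_embed (x : cell) : 'M[R]_(2, m) :=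
  \matrix_(a, j) if a == 0 then cos (val x 0 j) else sin (val x 0 j).

(* The torus (R / 2 pi Z)^m, carried by the fundamental cell and embedded in
   (R^2)^m by cosines and sines. *)
Definition torus := initial_topology circle_embed.
HB.instance Definition _ := PseudoMetric.copy torus (initial_topology circle_embed).
HB.instance Definition _ := isPointed.Build torus (exist _ 0 in_cell0 : cell).

Implicit Types (P Q : torus) (x y : E).

Definition rep P : E := val (P : cell).

Definition lattice (k : 'I_m -> int) : E := \row_i (turn * (k i)%:~R).

Definition reduce x : E :=
  x - lattice (fun i => Num.floor (x 0 i / turn)).

Lemma in_cell_reduce x : in_cell (reduce x).
Proof.
apply/forallP => i; rewrite !mxE; have t0 := @turn_gt0 R.
have := real_floor_le (num_real (x 0 i / turn)).
have := real_floorD1_gt (num_real (x 0 i / turn)).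
rewrite ltr_pdivrMr// ler_pdivlMr// intrD => h1 h2.
by apply/andP; split; lra.
Qed.

Definition proj x : torus := exist _ (reduce x) (in_cell_reduce x).

Lemma rep_proj x : exists k, rep (proj x) = x + lattice k.
Proof.
exists (fun i => - Num.floor (x 0 i / turn)); apply/rowP => i.
by rewrite !mxE rmorphN mulrN.
Qed.

Lemma repK P : proj (rep P) = P.
Proof.
apply: val_inj => /=; apply/rowP => i; rewrite !mxE.
have /forallP/(_ i)/andP[x0 x1] := valP (P : cell).
suff -> : Num.floor (rep P 0 i / turn) = 0 by rewrite mulr0 subr0.
apply: floor_def; rewrite add0r divr_ge0// ?ltW ?turn_gt0//=.
by rewrite ltr_pdivrMr ?turn_gt0// mul1r.
Qed.

Lemma proj_lattice x k : proj (x + lattice k) = proj x.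
Proof.
apply: val_inj => /=; apply/rowP => i; rewrite !mxE.
have -> : (x 0 i + turn * (k i)%:~R) / turn = x 0 i / turn + (k i)%:~R.
  by rewrite mulrDl mulrAC divff ?mul1r// gt_eqF// turn_gt0.
rewrite real_floorDrz ?num_real// ?intr_int// intrKfloor intrD; ring.
Qed.

Lemma proj_eq x y : proj x = proj y -> exists k, y = x + lattice k.
Proof.
move=> xy; have [k kE] := rep_proj x; have [l lE] := rep_proj y.
exists (fun i => k i - l i); apply/rowP => i; rewrite !mxE intrB mulrBr.
have := congr1 (fun P => rep P 0 i) xy; rewrite kE lE !mxE => h.
by rewrite addrA h addrK.
Qed.

Lemma circle_embed_proj x :
  circle_embed (proj x) =
    \matrix_(a, j) if a == 0 then cos (x 0 j) else sin (x 0 j).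
Proof.
have [k kE] := rep_proj x; apply/matrixP => a j.
transitivity (if a == 0 then cos (rep (proj x) 0 j) else sin (rep (proj x) 0 j)).
  by rewrite mxE.
by rewrite kE !mxE cos_turn sin_turn.
Qed.

(** Equal cosines and sines give cos (p - q) = 1, and two points of the half-open cell differ by
    less than a turn in each coordinate. *)
Lemma circle_embed_inj : injective circle_embed.
Proof.
move=> P Q PQ; apply: val_inj => /=; apply/rowP => i.
have /forallP/(_ i)/andP[p0 p1] := valP P.
have /forallP/(_ i)/andP[q0 q1] := valP Q.
have := congr1 (fun M : 'M[R]_(2, m) => M 0 i) PQ.
have := congr1 (fun M : 'M[R]_(2, m) => M 1 i) PQ.
rewrite !mxE /= => Es Ec; apply/eqP; rewrite -subr_eq0; apply/eqP.
by apply: cos_eq1; [lra|rewrite cosB Es Ec -!expr2 cos2Dsin2].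
Qed.

Lemma circle_embed_continuous : continuous (circle_embed : torus -> 'M[R]_(2, m)).
Proof. exact: initial_continuous. Qed.

Lemma cos_rep_continuous i : continuous (fun P => cos (rep P 0 i)).
Proof.
move=> P; rewrite (_ : (fun P => _) = fun P : torus => circle_embed P 0 i).
  apply: (@continuous_comp torus _ _ circle_embed (fun M : 'M[R]_(2, m) => M 0 i)).
    exact: circle_embed_continuous.
  exact: coord_continuous.
by apply/funext => Q; rewrite mxE.
Qed.

Lemma sin_rep_continuous i : continuous (fun P => sin (rep P 0 i)).
Proof.
move=> P; rewrite (_ : (fun P => _) = fun P : torus => circle_embed P 1 i).
  apply: (@continuous_comp torus _ _ circle_embed (fun M : 'M[R]_(2, m) => M 1 i)).
    exact: circle_embed_continuous.
  exact: coord_continuous.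
by apply/funext => Q; rewrite mxE.
Qed.

Lemma proj_continuous : continuous proj.
Proof.
move=> x A /= [B [[C Co <-] /= Cx] CA].
have cM : {for x, continuous (fun y : E => \matrix_(a < 2, j < m)
    if a == 0 then cos (y 0 j) else sin (y 0 j))}.
  apply: continuous_mx => a j.
  have cj : continuous (fun y : E => y 0 j) by exact: coord_continuous.
  have [a0|a0] := boolP (a == 0).
    rewrite (_ : (fun y => _) = cos \o (fun y : E => y 0 j)).
      by apply: continuous_comp; [exact: cj|exact: continuous_cos].
    by apply/funext => y /=; rewrite mxE a0.
  rewrite (_ : (fun y => _) = sin \o (fun y : E => y 0 j)).
    by apply: continuous_comp; [exact: cj|exact: continuous_sin].
  by apply/funext => y /=; rewrite mxE (negPf a0).
rewrite circle_embed_proj in Cx.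
have nC := cM C (open_nbhs_nbhs (conj Co Cx)).
suff : nbhs (x : E) (proj @^-1` A) by [].
apply: (@filterS _ (nbhs (x : E)) _ _ _ _ nC) => y /= Cy; apply: CA.
by rewrite /= circle_embed_proj; exact: Cy.
Qed.

Lemma torus_hausdorff : hausdorff_space torus.
Proof.
move=> P Q PQ; apply: circle_embed_inj.
apply: (@norm_hausdorff R 'M[R]_(2, m)) => A B nA nB.
have [S [SA SB]] := PQ _ _ (circle_embed_continuous nA) (circle_embed_continuous nB).
by exists (circle_embed S).
Qed.

Lemma torus_compact : compact [set: torus].
Proof.
have -> : [set: torus] =
    proj @` [set x : E | forall i, `[0, turn]%classic (x ord0 i)].
  apply/seteqP; split=> // P _; exists (rep P); last exact: repK.
  move=> i; have /forallP/(_ i)/andP[x0 x1] := valP (P : cell).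
  by rewrite /= in_itv /= x0 ltW.
apply: continuous_compact; first exact: continuous_subspaceT proj_continuous.
by apply: (@rV_compact R m (fun=> `[0, turn]%classic)) => i; exact: segment_compact.
Qed.

Lemma torus_second_countable : @second_countable torus.
Proof. exact: compact_second_countable torus_compact. Qed.

Definition box P : set E := [set x | forall i, `|x 0 i - rep P 0 i| < pi].

(** The points none of whose coordinates is opposite to that of [P]. The cosine says this
    independently of the representative and through a continuous function, which makes the set
    open. *)
Definition box_dom P : set torus :=
  [set Q | forall i, cos (rep Q 0 i - rep P 0 i) != -1].

(** The inverse of [proj] from [box_dom P] onto the box centred at [rep P]. Computing with cosine
    and sine makes it continuous across the walls of the cell, where [rep] jumps. *)
Definition log_at P Q : E := \row_i (rep P 0 i +
  angle (cos (rep Q 0 i - rep P 0 i)) (sin (rep Q 0 i - rep P 0 i))).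

Lemma log_at_proj P x : box P x -> log_at P (proj x) = x.
Proof.
move=> bx; apply/rowP => i; rewrite mxE; have [k ->] := rep_proj x.
have -> : (x + lattice k) 0 i - rep P 0 i = (x 0 i - rep P 0 i) + turn * (k i)%:~R.
  by rewrite !mxE addrAC.
rewrite cos_turn sin_turn angleK; first by rewrite addrC subrK.
by rewrite -ltr_norml; exact: bx.
Qed.

Lemma box_dom_proj P x : box P x -> box_dom P (proj x).
Proof.
move=> bx i; have [k ->] := rep_proj x.
have -> : (x + lattice k) 0 i - rep P 0 i = (x 0 i - rep P 0 i) + turn * (k i)%:~R.
  by rewrite !mxE addrAC.
by rewrite cos_turn cos_gtN1// -ltr_norml; exact: bx.
Qed.

Lemma box_dom_lift P Q : box_dom P Q -> exists2 x, box P x & proj x = Q.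
Proof.
move=> dQ.
have hk i : {k : int | - pi < rep Q 0 i - rep P 0 i + turn * k%:~R < pi}.
  apply/cid; have [k /andP[k1 k2]] := angle_rep (rep Q 0 i - rep P 0 i).
  (* The lower bound from [angle_rep] is only weak; equality with - pi would give the cosine -1,
     which [box_dom] excludes. *)
  exists k; rewrite k2 andbT lt_neqAle k1 andbT; apply/eqP => kE.
  have := dQ i; rewrite -(cos_turn k) -kE cosN cospi eqxx //.
exists (rep Q + lattice (fun i => sval (hk i))); last by rewrite proj_lattice repK.
by move=> i; rewrite !mxE ltr_norml addrAC; exact: svalP (hk i).
Qed.

Lemma box_rep P : box P (rep P).
Proof. by move=> i; rewrite subrr normr0 pi_gt0. Qed.

Lemma box_open P : open (box P).
Proof.
rewrite openE => x bx.
have : forall i, nbhs (x : E) [set y : E | `|y 0 i - rep P 0 i| < pi].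
  move=> i; have cf : {for x, continuous (fun y : E => `|y 0 i - rep P 0 i|)}.
    apply: (@continuous_comp _ _ _ (fun y : E => y 0 i) (fun t => `|t - rep P 0 i|)).
      exact: coord_continuous.
    apply: (@continuous_comp _ _ _ (fun t => t - rep P 0 i) Num.norm).
      by apply: cvgB; [exact: cvg_id|exact: cvg_cst].
    exact: norm_continuous.
  apply: (cf [set t | t < pi]).
  by apply: open_nbhs_nbhs; split; [exact: open_lt|exact: bx].
exact: (@filter_forall _ _ (fun i => [set y : E | `|y 0 i - rep P 0 i| < pi]) _
  (nbhs_filter (x : E))).
Qed.

Lemma cosB_continuous (t : R) i : continuous (fun Q => cos (rep Q 0 i - t)).
Proof.
rewrite (_ : (fun Q => _) =
    fun Q => cos t * cos (rep Q 0 i) + sin t * sin (rep Q 0 i)).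
  move=> Q; apply: (@continuous_lincomb R torus).
    exact: cos_rep_continuous.
  exact: sin_rep_continuous.
by apply/funext => Q; rewrite cosB; congr (_ + _); rewrite mulrC.
Qed.

Lemma sinB_continuous (t : R) i : continuous (fun Q => sin (rep Q 0 i - t)).
Proof.
rewrite (_ : (fun Q => _) =
    fun Q => cos t * sin (rep Q 0 i) + - sin t * cos (rep Q 0 i)).
  move=> Q; apply: (@continuous_lincomb R torus).
    exact: sin_rep_continuous.
  exact: cos_rep_continuous.
by apply/funext => Q; rewrite sinB mulNr; congr (_ - _); rewrite mulrC.
Qed.

Lemma box_dom_open P : open (box_dom P).
Proof.
rewrite openE => Q dQ.
have : forall i, nbhs Q [set S | cos (rep S 0 i - rep P 0 i) != -1].
  move=> i; apply: (@cosB_continuous (rep P 0 i) i Q [set t | t != -1]).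
  by apply: open_nbhs_nbhs; split; [exact: open_neq|exact: dQ].
exact: (@filter_forall _ _ (fun i => [set S | cos (rep S 0 i - rep P 0 i) != -1]) _
  (nbhs_filter Q)).
Qed.

Lemma log_at_continuous P Q : box_dom P Q -> {for Q, continuous (log_at P)}.
Proof.
move=> dQ; apply: continuous_mx => a i.
rewrite (_ : (fun y : torus => _) = fun S => rep P 0 i +
  angle (cos (rep S 0 i - rep P 0 i)) (sin (rep S 0 i - rep P 0 i))); last first.
  by apply/funext => S; rewrite mxE.
apply: (@continuous_angle R torus); first exact: dQ.
  exact: cosB_continuous.
exact: sinB_continuous.
Qed.

End TorusTopology.

(** * Charts of the torus, and fields as periodic maps *)

Section TorusManifold.
Context {R : realType} {m : nat}.
Local Notation E := 'rV[R]_m.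
Local Notation T := (@torus R m).
Implicit Types (P Q : T) (x y v : E).

Lemma log_atK P Q : box_dom P Q -> proj (log_at P Q) = Q.
Proof. by move=> /box_dom_lift[x bx <-]; rewrite log_at_proj. Qed.

Lemma log_at_image P : log_at P @` box_dom P = box P.
Proof.
apply/seteqP; split=> [_ [Q /box_dom_lift[x bx <-] <-]|x bx].
  by rewrite log_at_proj.
by exists (proj x); [exact: box_dom_proj|exact: log_at_proj].
Qed.

Lemma log_at_image_open P : open (log_at P @` box_dom P).
Proof. by rewrite log_at_image; exact: box_open. Qed.

Definition torus_chart P : chart R m T :=
  @Chart R m T (box_dom P) (log_at P) proj (@box_dom_open R m P)
    (@log_at_image_open P) (@log_atK P) (@log_at_continuous R m P)
    (fun x _ => @proj_continuous R m x).

Lemma smooth_id : smooth (id : E -> E).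
Proof.
apply/smooth_mxP => i j; rewrite ord1.
by apply: smooth_ext (smooth_dot (delta_mx 0 j)) => x; exact: dot_delta.
Qed.

Lemma smooth_shift (a : E) : smooth (fun y : E => y + a).
Proof. by apply: smoothD; [exact: smooth_id|exact: smooth_cst]. Qed.

(** Every change of chart is locally a translation by a lattice vector. Its differential is the
    identity, so the components of a tangent vector do not depend on the chart. *)
Lemma log_at_local Q x : box_dom Q (proj x) ->
  exists k, \forall y \near x, log_at Q (proj y) = y + lattice k.
Proof.
move=> /box_dom_lift[z bz /esym/proj_eq[k zE]]; exists k.
have nb : nbhs (x + lattice k) (box Q).
  by rewrite -zE; apply: open_nbhs_nbhs; split=> //; exact: box_open.
have ct : {for x, continuous (fun y : E => y + lattice k)}.
  exact: (smooth_cont (smooth_shift _)).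
have nx : nbhs x [set y | box Q (y + lattice k)] := ct _ nb.
apply: (@filterS _ (nbhs x) _ _ _ _ nx) => y /= bQy.
by rewrite -(proj_lattice y k) log_at_proj.
Qed.

Lemma torus_chart_smooth P Q : smooth_transition (torus_chart P) (torus_chart Q).
Proof.
rewrite /smooth_transition /=; apply: smooth_on_local => _ [S [dPS dQS] <-] /=.
have dQ : box_dom Q (proj (log_at P S)) by rewrite log_atK.
have [k] := log_at_local dQ; rewrite /prop_near1 nbhsE => -[W [Wo Wx] HW].
exists W; split=> //; apply: (smooth_on_congr (f := fun y => y + lattice k)) => //.
  by move=> y /HW /= ->.
apply: (@smooth_on_sub _ _ _ _ setT) => //.
exact: smooth_shift.
Qed.

Lemma torus_chart_dom P : dom (torus_chart P) P.
Proof. by move=> i; rewrite subrr cos0; apply/eqP => h; have := @ltr01 R; lra. Qed.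

Definition torus_manifold : manifold R m :=
  @Manifold R m T (@torus_hausdorff R m) (@torus_second_countable R m)
    torus_chart torus_chart_dom torus_chart_smooth.

Local Notation M := torus_manifold.
Implicit Types (X Y : M -> E) (f : M -> R).

Lemma fwd_chart_at (P : M) : fwd (chart_at P) P = rep P.
Proof.
by rewrite /= -[X in log_at P X](repK P) log_at_proj//; exact: box_rep.
Qed.

Lemma transition_local (Q : M) x : dom (chart_at Q) (proj x) ->
  exists k, \forall y \near x, (fwd (chart_at Q) \o proj) y = y + lattice k.
Proof. exact: log_at_local. Qed.

Lemma derive_add_cst (a x v : E) : 'D_v (fun y : E => y + a) x = v.
Proof.
rewrite (_ : (fun y : E => y + a) = id + cst a)//.
rewrite deriveD; [|exact: derivable_id|exact: derivable_cst].
by rewrite derive_id derive_cst addr0.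
Qed.

Lemma tcoordE (Q P : M) v : dom (chart_at Q) P -> tcoord (chart_at Q) P v = v.
Proof.
move=> dP; rewrite /tcoord fwd_chart_at.
have [|k Hk] := @transition_local Q (rep P); first by rewrite repK.
by rewrite (near_eq_derive _ Hk) derive_add_cst.
Qed.

Lemma coordvecE (Q P : M) i : dom (chart_at Q) P ->
  coordvec (chart_at Q) P i = delta_mx 0 i.
Proof.
move=> dP; rewrite /coordvec.
have [|k Hk] := @transition_local P (fwd (chart_at Q) P).
  by rewrite /= log_atK//; exact: torus_chart_dom.
by rewrite (near_eq_derive _ Hk) derive_add_cst.
Qed.

Lemma cod_chart_at (P : M) : cod (chart_at P) = box P.
Proof. exact: log_at_image. Qed.

Lemma local_fieldE (P : M) X x : box P x ->
  local_field (chart_at P) X x = X (proj x).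
Proof. by move=> bx; rewrite /local_field tcoordE//; exact: box_dom_proj. Qed.

Definition periodic_map (F : Type) (Y : E -> F) :=
  forall x k, Y (x + lattice k) = Y x.

Lemma periodic_proj (F : Type) (Y : M -> F) : periodic_map (Y \o proj).
Proof. by move=> x k; rewrite /= proj_lattice. Qed.

(** Every point has a lattice translate at the centre of some box, and periodicity carries
    smoothness back. *)
Lemma smooth_periodic (F : normedModType R) (Y : E -> F) : periodic_map Y ->
  (forall P, smooth_on (box P) Y) -> smooth Y.
Proof.
move=> pY sY; apply: smooth_on_local => x _.
have [k kE] := rep_proj x; have sP := sY (proj x).
exists [set y | box (proj x) (y + lattice k)]; split.
- apply: open_comp; last exact: box_open.
  by move=> y _; exact: (smooth_cont (smooth_shift _)).
- by rewrite /= -kE; exact: box_rep.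
move=> j; apply: Ck_ext (Ck_translate (lattice k) (sP j)) => y.
exact: pY.
Qed.

Lemma smooth_fieldP X : smooth_field X <-> smooth (X \o proj).
Proof.
split=> [sX|sX P]; last first.
  rewrite cod_chart_at.
  apply: (smooth_on_congr (f := X \o proj)); first exact: box_open.
    by move=> x bx; rewrite local_fieldE.
  exact: smooth_on_sub sX.
apply: smooth_periodic; first exact: periodic_proj.
move=> P; have := sX P; rewrite cod_chart_at; apply: smooth_on_congr.
  exact: box_open.
by move=> x bx; rewrite local_fieldE.
Qed.

Lemma smooth_funP f : smooth_fun f <-> smooth (f \o proj).
Proof.
split=> [sf|sf P]; last exact: smooth_on_sub sf.
apply: smooth_periodic; first exact: periodic_proj.
by move=> P; have := sf P; rewrite cod_chart_at.
Qed.

Lemma field_actE X f P : field_act X f P = 'D_(X P) (f \o proj) (rep P).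
Proof. by rewrite /field_act fwd_chart_at. Qed.

Lemma lie_bracketE X Y P : lie_bracket X Y P =
  'D_(X P) (Y \o proj) (rep P) - 'D_(Y P) (X \o proj) (rep P).
Proof.
have loc (Z : M -> E) : {near rep P, local_field (chart_at (P : M)) Z =1 Z \o proj}.
  apply: filterS (open_nbhs_nbhs (conj (@box_open R m P) (@box_rep R m P))) => y.
  exact: local_fieldE.
by rewrite /lie_bracket fwd_chart_at; congr (_ - _); apply: near_eq_derive; exact: loc.
Qed.

Lemma smooth_chart_at (P : M) : smooth_chart (chart_at P).
Proof. by move=> Q; split; exact: torus_chart_smooth. Qed.

End TorusManifold.

(** * Calculus of directional derivatives of functions and vector fields *)

HB.lock Definition dd (R : realType) (m : nat) (v : 'rV[R]_m) (f : 'rV[R]_m -> R)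
  (x : 'rV[R]_m) : R := 'D_v f x.
Canonical dd_unlockable := Unlockable dd.unlock.

Definition vsmooth (R : realType) (m : nat) (X : 'rV[R]_m -> 'rV[R]_m) : Prop :=
  forall j, smooth (fun x => X x 0 j).

Definition dv (R : realType) (m : nat) (v : 'rV[R]_m) (X : 'rV[R]_m -> 'rV[R]_m)
  (x : 'rV[R]_m) : 'rV[R]_m := \row_j dd v (fun y => X y 0 j) x.

Section SealedDerivatives.
Context {R : realType} {m : nat}.
Local Notation E := 'rV[R]_m.
Implicit Types (f g : E -> R) (X Y : E -> E) (x u v : E).

Lemma ddE v f x : dd v f x = 'D_v f x.
Proof. by rewrite unlock. Qed.

Lemma smooth_dd v f : smooth f -> smooth (dd v f).
Proof. by rewrite unlock; exact: smooth_derive. Qed.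

Lemma dd_cst v (c : R) x : dd v (fun=> c) x = 0.
Proof. by rewrite unlock derive_cst. Qed.

Lemma ddD v f g x : smooth f -> smooth g ->
  dd v (fun y => f y + g y) x = dd v f x + dd v g x.
Proof.
move=> sf sg; rewrite !ddE; apply: etrans (deriveD _ _) _ => //;
  exact: smooth_derivable.
Qed.

Lemma ddM v f g x : smooth f -> smooth g ->
  dd v (fun y => f y * g y) x = dd v f x * g x + f x * dd v g x.
Proof. by move=> sf sg; rewrite !ddE derive_mul//; exact: smooth_derivable. Qed.

Lemma ddZ v (c : R) f x : smooth f -> dd v (fun y => c * f y) x = c * dd v f x.
Proof.
by move=> sf; rewrite ddM//; [rewrite dd_cst mul0r add0r|exact: smooth_cst].
Qed.

Lemma ddB v f g x : smooth f -> smooth g ->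
  dd v (fun y => f y - g y) x = dd v f x - dd v g x.
Proof.
move=> sf sg; rewrite -[in RHS]mulN1r -ddZ// -ddD//.
  by congr (dd v _ x); apply/funext => y; rewrite mulN1r.
by apply: smoothM => //; exact: smooth_cst.
Qed.

Lemma dd_sum v (I : Type) (r : seq I) (P : pred I) (h : I -> E -> R) x :
  (forall i, smooth (h i)) ->
  dd v (fun y => \sum_(i <- r | P i) h i y) x = \sum_(i <- r | P i) dd v (h i) x.
Proof.
move=> sh; elim: r => [|i r IH].
  rewrite big_nil -[RHS](dd_cst v 0 x); congr (dd v _ x).
  by apply/funext => y; rewrite big_nil.
rewrite big_cons -IH; case Pi: (P i).
  rewrite -ddD//; last exact: smooth_sum.
  by congr (dd v _ x); apply/funext => y; rewrite big_cons Pi.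
by congr (dd v _ x); apply/funext => y; rewrite big_cons Pi.
Qed.

Lemma dd_lin f x (c : R) u v : smooth f ->
  dd (c *: u + v) f x = c * dd u f x + dd v f x.
Proof. by move=> sf; rewrite !ddE derive_lin. Qed.

Lemma dd_comm f x u v : smooth f -> dd u (dd v f) x = dd v (dd u f) x.
Proof. by move=> sf; rewrite unlock; exact: derive_comm. Qed.

Lemma dd_trigf a b (l : E) x v :
  dd v (trigf a b l) x = trigf (b * dot l v) (- a * dot l v) l x.
Proof. by rewrite ddE derive_trigf. Qed.

Lemma dd_sumE f x v : smooth f ->
  dd v f x = \sum_i v 0 i * dd (delta_mx 0 i) f x.
Proof.
by move=> sf; rewrite ddE derive_sumE//; apply: eq_bigr => i _; rewrite ddE.
Qed.

Lemma dd_periodic f v : periodic_map f -> periodic_map (dd v f).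
Proof.
move=> pf x k; rewrite !ddE -derive_translate; congr ('D_v _ x).
by apply/funext => y; exact: pf.
Qed.

Lemma vsmoothP X : smooth X <-> vsmooth X.
Proof.
rewrite smooth_mxP; split=> [sX j|sX i j]; first exact: sX.
by rewrite ord1; exact: sX.
Qed.

Lemma dvE X v x : vsmooth X -> 'D_v X x = dv v X x.
Proof.
move=> /vsmoothP sX; apply/rowP => j; rewrite mxE ddE.
exact: (derive_mxE x v 0 j sX).
Qed.

Lemma smooth_dd_field f X : smooth f -> vsmooth X -> smooth (fun x => dd (X x) f x).
Proof.
move=> sf sX; apply: (smooth_ext (f := fun x =>
    \sum_i X x 0 i * dd (delta_mx 0 i) f x)) => [x|].
  by rewrite -dd_sumE.
by apply: smooth_sum => i; apply: smoothM => //; exact: smooth_dd.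
Qed.

(** The product rule in coordinates: one term derives the components of [X], and the other takes its
    final form by the symmetry of second derivatives. *)
Lemma dd_dd_field f X x u : smooth f -> vsmooth X ->
  dd u (fun y => dd (X y) f y) x = dd (dv u X x) f x + dd (X x) (dd u f) x.
Proof.
move=> sf sX; have sd i : smooth (dd (delta_mx 0 i) f) by exact: smooth_dd.
have -> : (fun y => dd (X y) f y) = fun y => \sum_i X y 0 i * dd (delta_mx 0 i) f y.
  by apply/funext => y; rewrite -dd_sumE.
rewrite dd_sum; last by move=> i; exact: smoothM.
rewrite (dd_sumE _ (dv u X x))// (dd_sumE _ (X x)); last exact: smooth_dd.
rewrite -big_split; apply: eq_bigr => i _ /=.
by rewrite ddM// mxE [dd u (dd _ f) x]dd_comm.
Qed.

Lemma vsmooth_dv_field X Y : vsmooth Y -> vsmooth X -> vsmooth (fun x => dv (X x) Y x).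
Proof.
move=> sY sX j; apply: smooth_ext (smooth_dd_field (sY j) sX) => x.
by rewrite mxE.
Qed.

Lemma vsmoothD X Y : vsmooth X -> vsmooth Y -> vsmooth (fun x => X x + Y x).
Proof.
by move=> sX sY j; apply: smooth_ext (smoothD (sX j) (sY j)) => x; rewrite mxE.
Qed.

Lemma dvD X Y v x : vsmooth X -> vsmooth Y ->
  dv v (fun y => X y + Y y) x = dv v X x + dv v Y x.
Proof.
move=> sX sY; apply/rowP => j; rewrite !mxE -ddD//.
by congr (dd v _ x); apply/funext => y; rewrite mxE.
Qed.

Lemma dvZ f Y v x : smooth f -> vsmooth Y ->
  dv v (fun y => f y *: Y y) x = dd v f x *: Y x + f x *: dv v Y x.
Proof.
move=> sf sY; apply/rowP => j; rewrite !mxE -ddM//.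
by congr (dd v _ x); apply/funext => y; rewrite mxE.
Qed.

Lemma dv_lin X x (c : R) u v : vsmooth X ->
  dv (c *: u + v) X x = c *: dv u X x + dv v X x.
Proof. by move=> sX; apply/rowP => j; rewrite !mxE dd_lin. Qed.

Lemma dv_dv_field Y X x u : vsmooth Y -> vsmooth X ->
  dv u (fun y => dv (X y) Y y) x = dv (dv u X x) Y x + dv (X x) (dv u Y) x.
Proof.
move=> sY sX; apply/rowP => j; rewrite !mxE.
transitivity (dd u (fun y => dd (X y) (fun z => Y z 0 j) y) x).
  by congr (dd u _ x); apply/funext => y; rewrite mxE.
rewrite dd_dd_field//; congr (_ + dd _ _ x).
by apply/funext => y; rewrite mxE.
Qed.

Lemma dv_comm X x u v : vsmooth X -> dv u (dv v X) x = dv v (dv u X) x.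
Proof.
move=> sX; apply/rowP => j; rewrite !mxE.
transitivity (dd u (dd v (fun z => X z 0 j)) x).
  by congr (dd u _ x); apply/funext => y; rewrite mxE.
rewrite dd_comm//; congr (dd v _ x).
by apply/funext => y; rewrite mxE.
Qed.

Lemma dv_periodic X v : periodic_map X -> periodic_map (dv v X).
Proof.
move=> pX x k; apply/rowP => j; rewrite !mxE.
by apply: dd_periodic => y l; rewrite pX.
Qed.

Lemma linfunP (V W : vectType R) (f : V -> W) : linear f ->
  exists F : 'Hom(V, W), forall a, F a = f a.
Proof.
move=> lf; pose L : {linear V -> W} := HB.pack f (GRing.isLinear.Build R V W _ f lf).
by exists (linfun L) => x; rewrite lfunE.
Qed.

End SealedDerivatives.

(** * Connections on the torus *)

Section Christoffel.
Context {R : realType} {m : nat}.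
Local Notation E := 'rV[R]_m.
Local Notation M := (@torus_manifold R m).
Implicit Types (x u v w : E) (X Y Z : M -> E).

Lemma rep_proj0 : rep (proj (0 : E)) = 0.
Proof. by apply/rowP => i; rewrite !mxE mul0r floor0 mulr0 subr0. Qed.

Lemma smooth_fieldE X : smooth_field X <-> vsmooth (X \o proj).
Proof. by rewrite smooth_fieldP vsmoothP. Qed.

Record christoffel (Gam : E -> E -> E -> E) : Prop := {
  christoffel_linear : forall x u, linear (Gam x u);
  christoffel_sym : forall x u v, Gam x u v = Gam x v u;
  christoffel_smooth : forall u v, vsmooth (fun x => Gam x u v);
  christoffel_periodic : forall u v, periodic_map (fun x => Gam x u v) }.

Definition nabla_of (Gam : E -> E -> E -> E) X Y : M -> E := fun P =>
  dv (X P) (Y \o proj) (rep P) + Gam (rep P) (X P) (Y P).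

Variable Gam : E -> E -> E -> E.
Hypothesis cG : christoffel Gam.

Lemma christoffel_lin2 x u v w (c : R) :
  Gam x u (c *: v + w) = c *: Gam x u v + Gam x u w.
Proof. exact: christoffel_linear. Qed.

Lemma christoffel_lin1 x u v w (c : R) :
  Gam x (c *: u + v) w = c *: Gam x u w + Gam x v w.
Proof.
by rewrite (christoffel_sym cG) christoffel_lin2 !(christoffel_sym cG x w).
Qed.

Lemma christoffelE x u v :
  Gam x u v = \sum_i \sum_j (u 0 i * v 0 j) *: Gam x (delta_mx 0 i) (delta_mx 0 j).
Proof.
have G0r y : Gam x y 0 = 0.
  by have := christoffel_lin2 x y 0 0 1; rewrite scaler0 addr0 scale1r => /esym/eqP;
    rewrite -subr_eq0 addrK => /eqP.
have exp2 y z : Gam x y z = \sum_j z 0 j *: Gam x y (delta_mx 0 j).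
  rewrite {1}(row_sum_delta z); elim/big_rec2: _ => [|j a b _ IH]; first exact: G0r.
  by rewrite christoffel_lin2 IH.
rewrite (christoffel_sym cG) exp2; apply: eq_bigr => i _.
rewrite (christoffel_sym cG) exp2 scaler_sumr; apply: eq_bigr => j _.
by rewrite scalerA.
Qed.

Lemma christoffel_coord x (A B : E -> E) k : Gam x (A x) (B x) 0 k =
  \sum_i \sum_j (A x 0 i * B x 0 j) * Gam x (delta_mx 0 i) (delta_mx 0 j) 0 k.
Proof.
rewrite christoffelE summxE; apply: eq_bigr => i _.
by rewrite summxE; apply: eq_bigr => j _; rewrite mxE.
Qed.

Lemma vsmooth_christoffel (A B : E -> E) : vsmooth A -> vsmooth B ->
  vsmooth (fun x => Gam x (A x) (B x)).
Proof.
move=> sA sB k; apply: (smooth_ext (f := fun x => \sum_i \sum_j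
    (A x 0 i * B x 0 j) * Gam x (delta_mx 0 i) (delta_mx 0 j) 0 k)) => [x|].
  by rewrite [RHS]christoffel_coord.
apply: smooth_sum => i; apply: smooth_sum => j; apply: smoothM.
  exact: smoothM.
exact: (christoffel_smooth cG).
Qed.

(** Where [Gam] vanishes, the product rule loses the terms that derive the arguments, which may
    therefore be frozen. *)
Lemma dv_christoffel0 (A B : E -> E) u : (forall v w, Gam 0 v w = 0) ->
  vsmooth A -> vsmooth B ->
  dv u (fun x => Gam x (A x) (B x)) 0 = dv u (fun x => Gam x (A 0) (B 0)) 0.
Proof.
move=> G0 sA sB; apply/rowP => k; rewrite 2!mxE.
have sG i j : smooth (fun x => Gam x (delta_mx 0 i) (delta_mx 0 j) 0 k).
  exact: (christoffel_smooth cG).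
have D (C F : E -> E) : vsmooth C -> vsmooth F -> dd u (fun x => Gam x (C x) (F x) 0 k) 0 =
    \sum_i \sum_j C 0 0 i * F 0 0 j *
      dd u (fun x => Gam x (delta_mx 0 i) (delta_mx 0 j) 0 k) 0.
  move=> sC sF.
  have sCF i j : smooth (fun x => C x 0 i * F x 0 j) by exact: smoothM.
  have -> : (fun x => Gam x (C x) (F x) 0 k) = fun x => \sum_i \sum_j
      (C x 0 i * F x 0 j) * Gam x (delta_mx 0 i) (delta_mx 0 j) 0 k.
    by apply/funext => x; rewrite christoffel_coord.
  rewrite dd_sum; last by move=> i; apply: smooth_sum => j; exact: smoothM.
  apply: eq_bigr => i _; rewrite dd_sum; last by move=> j; exact: smoothM.
  apply: eq_bigr => j _; rewrite ddM//.
  by rewrite G0 mxE mulr0 add0r.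
rewrite (D A B)// (D (fun=> A 0) (fun=> B 0))// => j; exact: smooth_cst.
Qed.

Lemma nabla_of_proj X Y x : nabla_of Gam X Y (proj x) =
  dv (X (proj x)) (Y \o proj) x + Gam x (X (proj x)) (Y (proj x)).
Proof.
rewrite /nabla_of; have [k ->] := rep_proj x.
rewrite dv_periodic; last exact: periodic_proj.
by congr (_ + _); exact: (christoffel_periodic cG).
Qed.

Lemma vsmooth_nabla_of X Y : vsmooth (X \o proj) -> vsmooth (Y \o proj) ->
  vsmooth (nabla_of Gam X Y \o proj).
Proof.
move=> sX sY; have -> : nabla_of Gam X Y \o proj = fun x =>
    dv (X (proj x)) (Y \o proj) x + Gam x (X (proj x)) (Y (proj x)).
  by apply/funext => x; rewrite /= nabla_of_proj.
apply: vsmoothD; first exact: (vsmooth_dv_field sY sX).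
exact: (vsmooth_christoffel sX sY).
Qed.

Lemma lie_bracket_dv X Y P : vsmooth (X \o proj) -> vsmooth (Y \o proj) ->
  lie_bracket X Y P = dv (X P) (Y \o proj) (rep P) - dv (Y P) (X \o proj) (rep P).
Proof. by move=> sX sY; rewrite lie_bracketE !dvE. Qed.

Theorem affine_structure_nabla_of : affine_structure (nabla_of Gam).
Proof.
split; first split.
- by move=> X Y /smooth_fieldE sX /smooth_fieldE sY; apply/smooth_fieldE/vsmooth_nabla_of.
- move=> f X X' Y _ _ _ /smooth_fieldE sY P.
  by rewrite /nabla_of dv_lin// christoffel_lin1 scalerDr addrACA.
- move=> X Y Y' _ /smooth_fieldE sY /smooth_fieldE sY' P; rewrite /nabla_of.
  have -> : (fun Q => Y Q + Y' Q) \o proj =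
      (fun x : E => (Y \o proj) x + (Y' \o proj) x) by [].
  rewrite dvD// -[Y P]scale1r christoffel_lin2 !scale1r.
  by rewrite addrACA.
- move=> f X Y /smooth_funP sf _ /smooth_fieldE sY P; rewrite /nabla_of field_actE.
  have -> : (fun Q => f Q *: Y Q) \o proj =
      (fun x : E => (f \o proj) x *: (Y \o proj) x) by [].
  have G0 : Gam (rep P) (X P) 0 = 0.
    by rewrite christoffelE big1// => i _; rewrite big1// => j _;
      rewrite mxE mulr0 scale0r.
  rewrite dvZ//= !repK -addrA ddE scalerDr.
  by have := christoffel_lin2 (rep P) (X P) (Y P) 0 (f P); rewrite G0 !addr0 => ->.
move=> X Y /smooth_fieldE sX /smooth_fieldE sY P; rewrite lie_bracket_dv// /nabla_of.
by rewrite (christoffel_sym cG _ (Y P)) opprD addrACA subrr addr0.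
Qed.

(** At a zero of the Christoffel symbols the terms of the curvature quadratic in [Gam] disappear. Of
    the remaining ones, the second derivatives of [Z] commute and the first derivatives of [Z]
    cancel against the Lie bracket. *)
Theorem curvature_nabla_of0 : (forall u v, Gam 0 u v = 0) ->
  exists Rm, curvature_at (nabla_of Gam) (proj 0 : M) Rm /\
    forall u v w, Rm u v w =
      dv u (fun x => Gam x v w) 0 - dv v (fun x => Gam x u w) 0.
Proof.
move=> G0.
have lin u v : linear (fun w => dv u (fun x => Gam x v w) 0 - dv v (fun x => Gam x u w) 0).
  move=> c w w'.
  have H a b : dv a (fun x => Gam x b (c *: w + w')) 0 =
      c *: dv a (fun x => Gam x b w) 0 + dv a (fun x => Gam x b w') 0.
    have -> : (fun x => Gam x b (c *: w + w')) = fun x => c *: Gam x b w + Gam x b w'.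
      by apply/funext => x; exact: christoffel_lin2.
    have sG z := christoffel_smooth cG b z.
    have sc : smooth (fun _ : E => c) by exact: smooth_cst.
    rewrite dvD// ?dvZ// ?dd_cst ?scale0r ?add0r//.
    by move=> j; apply: smooth_ext (smoothM sc (sG w j)) => x; rewrite mxE.
  by rewrite !H scalerBr addrACA opprD.
pose Rm u v : 'End(E) := sval (cid (linfunP (lin u v))).
have RmE u v w : Rm u v w = dv u (fun x => Gam x v w) 0 - dv v (fun x => Gam x u w) 0.
  exact: (svalP (cid (linfunP (lin u v)))).
exists Rm; split=> // X Y Z /smooth_fieldE sX /smooth_fieldE sY /smooth_fieldE sZ.
rewrite RmE /curvature.
set P : M := proj 0.
have N0 A B : nabla_of Gam A B P = dv (A P) (B \o proj) 0.
  by rewrite nabla_of_proj G0 addr0.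
(* A second covariant derivative at [P] has three parts: a derivative of [Z] along the derivative of
   [B], a second derivative of [Z], and the derivative of [Gam] with frozen arguments. *)
have NN A B : vsmooth (A \o proj) -> vsmooth (B \o proj) ->
    nabla_of Gam A (nabla_of Gam B Z) P =
    dv (dv (A P) (B \o proj) 0) (Z \o proj) 0 + dv (B P) (dv (A P) (Z \o proj)) 0 +
    dv (A P) (fun x => Gam x (B P) (Z P)) 0.
  move=> sA sB; rewrite N0.
  have -> : nabla_of Gam B Z \o proj = fun x =>
      dv ((B \o proj) x) (Z \o proj) x + Gam x ((B \o proj) x) ((Z \o proj) x).
    by apply/funext => x; rewrite /= nabla_of_proj.
  rewrite dvD; [|exact: vsmooth_dv_field|exact: vsmooth_christoffel].
  by rewrite dv_dv_field// dv_christoffel0.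
have bE : lie_bracket X Y P = dv (X P) (Y \o proj) 0 - dv (Y P) (X \o proj) 0.
  by rewrite lie_bracket_dv// rep_proj0.
rewrite !NN// N0 bE.
have -> : dv (X P) (Y \o proj) 0 - dv (Y P) (X \o proj) 0 =
    (-1) *: dv (Y P) (X \o proj) 0 + dv (X P) (Y \o proj) 0.
  by rewrite scaleN1r addrC.
rewrite dv_lin// scaleN1r (dv_comm _ (X P))//.
set a := dv (dv _ (Y \o _) _) _ _; set b := dv (dv _ (X \o _) _) _ _.
set c := dv _ (dv _ _) _; set d := dv _ _ _; set e := dv _ _ _.
by apply/rowP => j; rewrite !mxE; ring.
Qed.

End Christoffel.

(** * Bilinear forms given by matrices *)

Section Forms.
Context {R : realType} {m : nat}.
Local Notation E := 'rV[R]_m.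
Implicit Types (A B : 'M[R]_m) (u v w : E).

Definition gform A u v : R := (u *m A *m v^T) 0 0.

Lemma gformE A u v : gform A u v = \sum_i \sum_j u 0 i * v 0 j * A i j.
Proof.
rewrite /gform mxE exchange_big; apply: eq_bigr => j _ /=.
rewrite !mxE mulr_suml; apply: eq_bigr => i _; ring.
Qed.

Lemma gform_lin1 A (c : R) u v w :
  gform A (c *: u + v) w = c * gform A u w + gform A v w.
Proof. by rewrite /gform !mulmxDl -!scalemxAl !mxE. Qed.

Lemma gform_lin2 A (c : R) u v w :
  gform A w (c *: u + v) = c * gform A w u + gform A w v.
Proof. by rewrite /gform linearP /= mulmxDr -scalemxAr !mxE. Qed.

Lemma gform_bilinear A : bilinear_form (gform A).
Proof.
by split=> [x c y z|y c x z]; rewrite /= ?gform_lin1 ?gform_lin2.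
Qed.

Lemma gform_sym A u v : A^T = A -> gform A u v = gform A v u.
Proof.
by move=> sA; rewrite /gform -[RHS]trace_mx11 -mxtrace_tr trace_mx11 !trmx_mul
  trmxK sA mulmxA.
Qed.

Lemma gform0l A u : gform A 0 u = 0.
Proof. by rewrite /gform !mul0mx mxE. Qed.

Lemma gform0r A u : gform A u 0 = 0.
Proof. by rewrite /gform trmx0 mulmx0 mxE. Qed.

Lemma gform_delta A i j : gform A (delta_mx 0 i) (delta_mx 0 j) = A i j.
Proof.
by rewrite /gform -rowE trmx_delta -colE !mxE.
Qed.

Lemma gform_inj A B : (forall u v, gform A u v = gform B u v) -> A = B.
Proof. by move=> AB; apply/matrixP => i j; rewrite -!gform_delta AB. Qed.

Lemma gform_invmx A (f : E) w : A \in unitmx -> gform A (f *m invmx A) w = dot f w.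
Proof.
move=> uA; rewrite /gform mulmxKV// mxE /dot; apply: eq_bigr => i _.
by rewrite mxE.
Qed.

Lemma gform_nondeg A u v : A \in unitmx -> (forall w, gform A u w = gform A v w) -> u = v.
Proof.
move=> uA uv; rewrite -[u](mulmxK uA) -[v](mulmxK uA); congr (_ *m _).
apply/rowP => j; have := uv (delta_mx 0 j).
by rewrite /gform trmx_delta -!colE !mxE.
Qed.

(** A vector in the kernel pairs to zero with every vector of a pseudo-orthonormal basis, so all its
    coordinates vanish. *)
Lemma inner_product_unitmx p q A : inner_product p q (gform A) -> A \in unitmx.
Proof.
case=> _ sA [b [bb bG]]; rewrite -row_free_unit -kermx_eq0.
apply/eqP/row_matrixP => k; rewrite row0; set u := row k _.
have uA : u *m A = 0.
  by apply: sub_kermxP; exact: row_sub.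
have /andP[/eqP sb _] := bb.
have ub : u \in <<b>>%VS by rewrite sb memvf.
rewrite (coord_span ub) big1// => i _.
suff -> : coord b i u = 0 by rewrite scale0r.
have : gform A (\sum_(i < p + q) coord b i u *: b`_i) b`_i = 0.
  by rewrite -(coord_span ub) /gform uA mul0mx mxE.
have -> : gform A (\sum_(i < p + q) coord b i u *: b`_i) b`_i =
    \sum_(j < p + q) coord b j u * gform A b`_j b`_i.
  elim/big_rec2: _ => [|j x y _ <-]; first exact: gform0l.
  exact: gform_lin1.
rewrite (bigD1 i)//= bG eqxx big1 ?addr0 => [|j ji]; last first.
  by rewrite bG (negPf ji) mulr0.
by case: ifP => _ /eqP; rewrite ?mulrN ?mulr1 ?oppr_eq0 => /eqP.
Qed.

End Forms.

Section SmoothMatrices.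
Context {R : realType} {m : nat}.
Local Notation E := 'rV[R]_m.
Implicit Types (G : E -> 'M[R]_m) (u v w x : E).

Definition msmooth (a b : nat) (G : E -> 'M[R]_(a, b)) : Prop :=
  forall i j, smooth (fun x => G x i j).

Definition dm u G x : 'M[R]_m := \matrix_(i, j) dd u (fun y => G y i j) x.

Lemma smooth_det n (G : E -> 'M[R]_n) : msmooth G -> smooth (fun x => \det (G x)).
Proof.
move=> sG; apply: smooth_sum => s; apply: smoothM; first exact: smooth_cst.
by apply: smooth_prod => i; exact: sG.
Qed.

(** By the cofactor formula the entries of the inverse are polynomials in those of [G], divided by a
    determinant without zeros. *)
Lemma msmooth_invmx G : msmooth G -> (forall x, G x \in unitmx) ->
  msmooth (fun x => invmx (G x)).
Proof.
move=> sG uG i j.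
apply: (smooth_ext (f := fun x => (\det (G x))^-1 * (cofactor (G x) j i))) => [x|].
  by rewrite /invmx uG !mxE.
apply: smoothM.
  apply: smoothV; first exact: smooth_det.
  by move=> x; have := uG x; rewrite unitmxE unitfE.
apply: smoothM; first exact: smooth_cst.
apply: smooth_det => k l; apply: smooth_ext (sG (lift j k) (lift i l)) => x.
by rewrite !mxE.
Qed.

Lemma smooth_gform G (A B : E -> E) : msmooth G -> vsmooth A -> vsmooth B ->
  smooth (fun x => gform (G x) (A x) (B x)).
Proof.
move=> sG sA sB; apply: (smooth_ext (f := fun x =>
    \sum_i \sum_j A x 0 i * B x 0 j * G x i j)) => [x|]; first by rewrite gformE.
apply: smooth_sum => i; apply: smooth_sum => j; apply: smoothM; last exact: sG.
exact: smoothM.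
Qed.

Lemma msmooth_dm u G : msmooth G -> msmooth (dm u G).
Proof.
move=> sG i j; apply: smooth_ext (smooth_dd u (sG i j)) => x.
by rewrite mxE.
Qed.

Lemma vsmooth_cst (u : E) : vsmooth (fun _ : E => u).
Proof. by move=> j; exact: smooth_cst. Qed.

Lemma dv_cst u (v x : E) : dv u (fun=> v) x = 0.
Proof. by apply/rowP => j; rewrite !mxE dd_cst. Qed.

Lemma dd_gform u G (A B : E -> E) x : msmooth G -> vsmooth A -> vsmooth B ->
  dd u (fun x => gform (G x) (A x) (B x)) x =
  gform (dm u G x) (A x) (B x) + gform (G x) (dv u A x) (B x)
  + gform (G x) (A x) (dv u B x).
Proof.
move=> sG sA sB; rewrite (_ : (fun x => gform _ _ _) = fun x =>
    \sum_i \sum_j A x 0 i * B x 0 j * G x i j); last first.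
  by apply/funext => y; rewrite gformE.
have sAB i j : smooth (fun x => A x 0 i * B x 0 j) by exact: smoothM.
rewrite dd_sum; last by move=> i; apply: smooth_sum => j; apply: smoothM => //; exact: sG.
rewrite !gformE -!big_split; apply: eq_bigr => i _ /=.
rewrite dd_sum; last by move=> j; apply: smoothM => //; exact: sG.
rewrite -!big_split; apply: eq_bigr => j _ /=.
by rewrite ddM// ddM// !mxE; ring.
Qed.

Lemma dd_gform_cst u G v w x : msmooth G ->
  dd u (fun x => gform (G x) v w) x = gform (dm u G x) v w.
Proof.
move=> sG; have := dd_gform u x sG (vsmooth_cst v) (vsmooth_cst w).
by rewrite !dv_cst gform0l gform0r !addr0.
Qed.

Lemma dm_lin (c : R) u v G x : msmooth G ->
  dm (c *: u + v) G x = c *: dm u G x + dm v G x.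
Proof. by move=> sG; apply/matrixP => i j; rewrite !mxE dd_lin. Qed.

End SmoothMatrices.

(** * The Weyl connection of a periodic metric and a periodic 1-form *)

Section WeylConnection.
Context {R : realType} {m p q : nat}.
Local Notation E := 'rV[R]_m.
Local Notation M := (@torus_manifold R m).
Implicit Types (u v w x : E) (X Y Z : M -> E).

Variables (G : E -> 'M[R]_m) (om : E -> E).
Hypotheses (sG : msmooth G) (pG : periodic_map G)
  (iG : forall x, inner_product p q (gform (G x)))
  (so : vsmooth om) (po : periodic_map om).

Let uG x : G x \in unitmx. Proof. exact: inner_product_unitmx (iG x). Qed.

(* (nabla_u g)(v, w) for the flat connection, twisted by the Weyl form. *)
Definition weyl_dform x u v w : R :=
  gform (dm u G x) v w + 2 * dot (om x) u * gform (G x) v w.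

Local Notation T := weyl_dform.

Lemma metric_sym x : (G x)^T = G x.
Proof.
apply: gform_inj => u v; have [_ <- _] := iG x.
by rewrite /gform -[LHS]trace_mx11 -mxtrace_tr trace_mx11 !trmx_mul !trmxK mulmxA.
Qed.

Lemma dm_sym u x : (dm u G x)^T = dm u G x.
Proof.
apply/matrixP => i j; rewrite !mxE; congr (dd u _ x); apply/funext => y.
by rewrite -[in LHS]metric_sym mxE.
Qed.

Lemma weyl_dform_sym x u v w : T x u v w = T x u w v.
Proof. by rewrite /T !(gform_sym v w) ?metric_sym ?dm_sym. Qed.

Lemma weyl_dform_lin1 x (c : R) u u' v w :
  T x (c *: u + u') v w = c * T x u v w + T x u' v w.
Proof. by rewrite /T dm_lin// {1}/gform mulmxDr mulmxDl -scalemxAr -scalemxAl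
  2!mxE -!/(gform _ _ _) dotDr dotZr; ring. Qed.

Lemma weyl_dform_lin2 x (c : R) u v v' w :
  T x u (c *: v + v') w = c * T x u v w + T x u v' w.
Proof. by rewrite /T !gform_lin1; ring. Qed.

Lemma weyl_dform_lin3 x (c : R) u v w w' :
  T x u v (c *: w + w') = c * T x u v w + T x u v w'.
Proof. by rewrite /T !gform_lin2; ring. Qed.

Lemma smooth_weyl_dform u v w : smooth (fun x => T x u v w).
Proof.
apply: smoothD.
  by apply: smooth_gform; [exact: msmooth_dm|exact: vsmooth_cst..].
apply: smoothM; last by apply: smooth_gform => //; exact: vsmooth_cst.
apply: smoothM; first exact: smooth_cst.
apply: smooth_sum => i; apply: smoothM; [exact: so|exact: smooth_cst].
Qed.

(** The Koszul formula. It is the solution, symmetric in [u] and [v], of [weyl_low x u v w +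
    weyl_low x u w v = T x u v w], which says that the covariant derivative of the metric is -2 om
    times the metric. *)
Definition weyl_low x u v w : R := 2^-1 * (T x u v w + T x v u w - T x w u v).

Definition weyl_gamma x u v : E :=
  (\row_k weyl_low x u v (delta_mx 0 k)) *m invmx (G x).

Lemma weyl_gammaE x u v w : gform (G x) (weyl_gamma x u v) w = weyl_low x u v w.
Proof.
rewrite gform_invmx// {2}(row_sum_delta w) /dot.
elim/big_rec2: _ => [|k y z _ IH].
  have T0 a b : T x a b 0 = 0.
    have := weyl_dform_lin3 x 1 a b 0 0; rewrite scaler0 addr0 mul1r => h.
    by apply: (addrI (T x a b 0)); rewrite addr0 -h.
  have T0' a b : T x 0 a b = 0.
    have := weyl_dform_lin1 x 1 0 0 a b; rewrite scaler0 addr0 mul1r => h.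
    by apply: (addrI (T x 0 a b)); rewrite addr0 -h.
  by rewrite /weyl_low !T0 T0' subr0 addr0 mulr0.
rewrite IH mxE /weyl_low !weyl_dform_lin3 weyl_dform_lin1; ring.
Qed.

Lemma dm_periodic u : periodic_map (dm u G).
Proof.
move=> x k; apply/matrixP => i j; rewrite !mxE; apply: dd_periodic => y l.
by rewrite pG.
Qed.

Lemma christoffel_weyl_gamma : christoffel weyl_gamma.
Proof.
split.
- move=> x u c v w; apply: (gform_nondeg (uG x)) => z.
  rewrite gform_lin1 !weyl_gammaE /weyl_low.
  by rewrite weyl_dform_lin1 weyl_dform_lin2 weyl_dform_lin3; ring.
- move=> x u v; apply: (gform_nondeg (uG x)) => z.
  by rewrite !weyl_gammaE /weyl_low (weyl_dform_sym _ _ u v); ring.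
- move=> u v j.
  apply: (smooth_ext (f := fun x => \sum_k weyl_low x u v (delta_mx 0 k) *
      invmx (G x) k j)) => [x|].
    by rewrite mxE; apply: eq_bigr => k _; rewrite mxE.
  apply: smooth_sum => k; apply: smoothM; last exact: msmooth_invmx.
  apply: smoothM; first exact: smooth_cst.
  by apply: smoothB; [apply: smoothD|]; exact: smooth_weyl_dform.
move=> u v x k; rewrite /weyl_gamma /weyl_low /T.
by rewrite pG po; congr (_ *m _); apply/rowP => l; rewrite !mxE !dm_periodic.
Qed.

Definition torus_metric (P : M) : E -> E -> R := gform (G (rep P)).

Lemma smooth_torus_metric X Y : vsmooth (X \o proj) -> vsmooth (Y \o proj) ->
  smooth ((fun P => torus_metric P (X P) (Y P)) \o proj).
Proof.
move=> sX sY; apply: smooth_ext (smooth_gform sG sX sY) => x.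
by rewrite /= /torus_metric; have [k ->] := rep_proj x; rewrite pG.
Qed.

Lemma torus_pseudo_metric : pseudo_metric p q torus_metric.
Proof.
split=> [P|X Y /smooth_fieldE sX /smooth_fieldE sY]; first exact: iG.
exact/smooth_funP/smooth_torus_metric.
Qed.

Lemma nabla_torus_metric X Y Z P :
  smooth_field X -> smooth_field Y -> smooth_field Z ->
  nabla_metric (nabla_of weyl_gamma) torus_metric X Y Z P =
  -2 * dot (om (rep P)) (X P) * torus_metric P (Y P) (Z P).
Proof.
move=> /smooth_fieldE sX /smooth_fieldE sY /smooth_fieldE sZ.
rewrite /nabla_metric field_actE -ddE.
have -> : (fun Q => torus_metric Q (Y Q) (Z Q)) \o proj =
    fun x => gform (G x) ((Y \o proj) x) ((Z \o proj) x).
  apply/funext => x; rewrite /= /torus_metric.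
  by have [k ->] := rep_proj x; rewrite pG.
rewrite dd_gform//= !repK /nabla_of /torus_metric.
rewrite -[dv _ (Y \o _) _]scale1r -[dv _ (Z \o _) _]scale1r gform_lin1 gform_lin2.
rewrite !scale1r !mul1r weyl_gammaE (gform_sym (Y P) (weyl_gamma _ _ _)) ?metric_sym//.
rewrite weyl_gammaE /weyl_low (weyl_dform_sym _ _ (Z P)) /T.
by field.
Qed.

Theorem weyl_structure_torus :
  weyl_structure p q torus_metric (nabla_of weyl_gamma).
Proof.
split; first exact: torus_pseudo_metric.
  exact: affine_structure_nabla_of christoffel_weyl_gamma.
exists (fun P => dot (om (rep P))); split; last by move=> *; exact: nabla_torus_metric.
split=> [P c u v|X /smooth_fieldE sX]; first by rewrite /= dotDr dotZr.
apply/smooth_funP; apply: (smooth_ext (f := fun x =>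
    \sum_i om x 0 i * (X \o proj) x 0 i)) => [x|].
  by rewrite /= /dot; have [k ->] := rep_proj x; rewrite po.
by apply: smooth_sum => i; apply: smoothM; [exact: so|exact: sX].
Qed.

Theorem levi_civita_torus : (forall x, om x = 0) ->
  levi_civita torus_metric (nabla_of weyl_gamma).
Proof.
move=> o0; split; first exact: affine_structure_nabla_of christoffel_weyl_gamma.
move=> X Y Z sX sY sZ P; rewrite nabla_torus_metric// o0.
by rewrite (_ : dot 0 _ = 0) ?mulr0 ?mul0r// /dot big1// => i _; rewrite mxE mul0r.
Qed.

Definition weyl_hess u v w z : R := dd u (fun x => weyl_dform x v w z) 0.

Theorem curvature_torus : (forall u, dm u G 0 = 0) -> om 0 = 0 ->
  exists Rm, curvature_at (nabla_of weyl_gamma) (proj 0 : M) Rm /\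
    forall u v w z, lower torus_metric (proj 0) Rm u v w z =
      2^-1 * (weyl_hess u v w z + weyl_hess u w v z - weyl_hess u z v w)
      - 2^-1 * (weyl_hess v u w z + weyl_hess v w u z - weyl_hess v z u w).
Proof.
move=> dG0 o0.
have T0 u v w : T 0 u v w = 0.
  by rewrite /T dG0 o0 /gform mulmx0 mul0mx mxE /dot big1 ?mulr0 ?mul0r ?addr0// => i _;
    rewrite mxE mul0r.
have g0 u v : weyl_gamma 0 u v = 0.
  apply: (gform_nondeg (uG 0)) => w.
  by rewrite weyl_gammaE gform0l /weyl_low !T0 subr0 addr0 mulr0.
have [Rm [cRm RmE]] := curvature_nabla_of0 christoffel_weyl_gamma g0.
exists Rm; split=> // u v w z.
have key a b c : gform (G 0) (dv a (fun x => weyl_gamma x b c) 0) z =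
    2^-1 * (weyl_hess a b c z + weyl_hess a c b z - weyl_hess a z b c).
  have sT b' c' z' := smooth_weyl_dform b' c' z'.
  transitivity (dd a (fun x => gform (G x) (weyl_gamma x b c) z) 0).
    rewrite dd_gform//; last exact: vsmooth_cst.
      by rewrite g0 dv_cst gform0l gform0r add0r addr0.
    exact: (christoffel_smooth christoffel_weyl_gamma).
  have -> : (fun x => gform (G x) (weyl_gamma x b c) z) =
      fun x => 2^-1 * (T x b c z + T x c b z - T x z b c).
    by apply/funext => x; rewrite weyl_gammaE.
  have sD := smoothD (sT b c z) (sT c b z).
  rewrite ddZ; last exact: (smoothB sD (sT z b c)).
  by rewrite (ddB _ _ sD (sT z b c)) (ddD _ _ (sT b c z) (sT c b z)).
rewrite /lower RmE /torus_metric rep_proj0 -scaleN1r addrC gform_lin1 !key.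
by rewrite mulN1r addrC.
Qed.

End WeylConnection.

(** * Complex structures that are constant on the torus *)

Section ConstantComplexStructure.
Context {R : realType} {m : nat}.
Local Notation E := 'rV[R]_m.
Local Notation M := (@torus_manifold R m).
Implicit Types (u v w x : E) (X Y : M -> E).
Variables (pc : bool) (J : 'End(E)).
Hypothesis JJ : forall v, J (J v) = sgn pc *: v.

Lemma sgn_sq : @sgn R pc * sgn pc = 1.
Proof. by case: pc; rewrite /sgn ?mulrNN mulr1. Qed.

Lemma compatible_skew (f : E -> E -> R) :
  (forall c u v, f (c *: u) v = c * f u v) -> (forall c u v, f u (c *: v) = c * f u v) ->
  J_compatible pc f J -> forall u v, f (J u) v = - f u (J v).
Proof.
move=> f1 f2 Jf u v; have := Jf u (J v); rewrite JJ f2 => h.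
by have := congr1 ( *%R (sgn pc)) h; rewrite !mulrA mulrN sgn_sq mul1r mulN1r.
Qed.

Lemma linear_coord v j : J v 0 j = \sum_i v 0 i * J (delta_mx 0 i) 0 j.
Proof.
by rewrite {1}(row_sum_delta v) linear_sum summxE; apply: eq_bigr => i _;
  rewrite linearZ mxE.
Qed.

Lemma vsmooth_linear (A : E -> E) : vsmooth A -> vsmooth (fun x => J (A x)).
Proof.
move=> sA j; apply: (smooth_ext (f := fun x =>
    \sum_i A x 0 i * J (delta_mx 0 i) 0 j)) => [x|]; first by rewrite [RHS]linear_coord.
by apply: smooth_sum => i; apply: smoothM; [exact: sA|exact: smooth_cst].
Qed.

Lemma dv_linear (A : E -> E) u x : vsmooth A ->
  dv u (fun x => J (A x)) x = J (dv u A x).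
Proof.
move=> sA; apply/rowP => j; rewrite mxE [RHS]linear_coord.
transitivity (dd u (fun x => \sum_i A x 0 i * J (delta_mx 0 i) 0 j) x).
  by congr (dd u _ x); apply/funext => y; exact: linear_coord.
rewrite dd_sum => [|i]; last by apply: smoothM; [exact: sA|exact: smooth_cst].
apply: eq_bigr => i _; rewrite ddM; [|exact: sA|exact: smooth_cst].
by rewrite dd_cst mulr0 addr0 mxE.
Qed.

Lemma parallel_cst Gam : (forall x u v, Gam x u (J v) = J (Gam x u v)) ->
  parallel (nabla_of Gam : _ -> _ -> M -> E) (fun=> J).
Proof.
move=> GJ X Y _ /smooth_fieldE sY P; rewrite /nabla_of GJ linearD.
by congr (_ + _); exact: (dv_linear _ _ sY).
Qed.

Lemma smooth_field_cst X : smooth_field X -> smooth_field (fun P => J (X P)).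
Proof. by move=> /smooth_fieldE sX; apply/smooth_fieldE; exact: vsmooth_linear sX. Qed.

Lemma dm_compatible (G : E -> 'M[R]_m) u x : msmooth G ->
  (forall x, J_compatible pc (gform (G x)) J) -> J_compatible pc (gform (dm u G x)) J.
Proof.
move=> sG JG a b; rewrite -!dd_gform_cst// -ddZ; last first.
  by apply: smooth_gform => //; exact: vsmooth_cst.
by congr (dd u _ x); apply/funext => z; rewrite JG.
Qed.

(* The twisted fundamental form is closed: with J integrable, this is what makes
   the connection preserve J. *)
Lemma weyl_gamma_J p q (G : E -> 'M[R]_m) om : msmooth G ->
  (forall x, inner_product p q (gform (G x))) ->
  (forall x, J_compatible pc (gform (G x)) J) ->
  (forall x u v w, weyl_dform G om x u v (J w) + weyl_dform G om x v w (J u)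
    + weyl_dform G om x w u (J v) = 0) ->
  forall x u v, weyl_gamma G om x u (J v) = J (weyl_gamma G om x u v).
Proof.
move=> sG iG JG cyc x u v.
have uG := inner_product_unitmx (iG x).
have gZ1 A c (a b : E) : gform A (c *: a) b = c * gform A a b.
  by have := gform_lin1 A c a 0 b; rewrite addr0 gform0l addr0.
have gZ2 A c (a b : E) : gform A a (c *: b) = c * gform A a b.
  by have := gform_lin2 A c b 0 a; rewrite addr0 gform0r addr0.
have dJ y : J_compatible pc (gform (dm y G x)) J by exact: dm_compatible.
set T := weyl_dform G om x.
have TJ y a b : T y (J a) b = - T y a (J b).
  rewrite /T /weyl_dform (compatible_skew _ _ (dJ y))//.
  by rewrite (compatible_skew _ _ (JG x))//; ring.
have Ts y a b : T y a b = T y b a by exact: weyl_dform_sym om iG _ _ _ _.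
have TZ3 c y a b : T y a (c *: b) = c * T y a b.
  by rewrite /T /weyl_dform !gZ2; ring.
apply: (gform_nondeg uG) => w.
rewrite (compatible_skew _ _ (JG x))// !(weyl_gammaE om sG iG) /weyl_low -/T.
(* The cyclic identity is used at (v, u, w) and at (J v, u, J w). Half the sum of [C1] and [C2] is
   the difference of the two sides of the goal. *)
have C1 : T v u (J w) - T u v (J w) - T w u (J v) = 0.
  rewrite -(cyc x v u w) -/T (Ts u w) (TJ u v) (Ts w v) (TJ w u).
  by rewrite addrAC.
have C2 : T (J v) u w + T u v (J w) - T (J w) u v = 0.
  have := cyc x (J v) u (J w); rewrite -/T !JJ !TZ3 (TJ (J w)) JJ TZ3.
  rewrite (Ts u (J w)) (Ts (J w) v) => /(congr1 ( *%R (sgn pc))).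
  by rewrite mulr0 -mulrN -!mulrDr mulrA sgn_sq mul1r.
by rewrite (TJ u v); lra.
Qed.

End ConstantComplexStructure.

(** * Metrics with a prescribed Hessian *)

Section Bumps.
Context {R : realType} {m : nat}.
Local Notation E := 'rV[R]_m.
Implicit Types (u v w x : E) (c : 'I_m -> int) (N : nat).

Definition intform c : E := \row_i (c i)%:~R.

Lemma dot_intform_lattice c N (k : 'I_m -> int) :
  exists z : int, dot (N%:R *: intform c) (lattice k) = turn * z%:~R.
Proof.
exists (\sum_i N%:Z * c i * k i); rewrite /dot rmorph_sum mulr_sumr.
by apply: eq_bigr => i _; rewrite !mxE 2!rmorphM /= -pmulrn; ring.
Qed.

Lemma trigf_periodic (a b : R) c N : periodic_map (trigf a b (N%:R *: intform c)).
Proof.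
move=> x k; have [z zE] := dot_intform_lattice c N k.
by rewrite /trigf dotDr zE cos_turn sin_turn.
Qed.

Lemma trigf0 (a b : R) l : trigf a b l (0 : E) = a.
Proof. by rewrite /trigf dot0r cos0 sin0 mulr0 addr0 mulr1. Qed.

Lemma dotZl (a : R) u v : dot (a *: u) v = a * dot u v.
Proof. by rewrite /dot mulr_sumr; apply: eq_bigr => i _; rewrite mxE mulrA. Qed.

(* A periodic function of size O(1/N^2) with the 2-jet of (l x)^2 / 2 at 0. *)
Definition bump N c x : R := N%:R^-2 + trigf (- N%:R^-2) 0 (N%:R *: intform c) x.

Lemma smooth_bump N c : smooth (bump N c).
Proof. by apply: smoothD; [exact: smooth_cst|exact: smooth_trigf]. Qed.

Lemma bump_periodic N c : periodic_map (bump N c).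
Proof. by move=> x k; rewrite /bump trigf_periodic. Qed.

Lemma bump0 N c : bump N c 0 = 0.
Proof. by rewrite /bump trigf0 addrN. Qed.

Lemma dd_bump N c v : dd v (bump N c) =
  trigf 0 (N%:R^-2 * (N%:R * dot (intform c) v)) (N%:R *: intform c).
Proof.
apply/funext => x; rewrite /bump ddD; [|exact: smooth_cst|exact: smooth_trigf].
by rewrite dd_cst add0r dd_trigf dotZl mul0r opprK.
Qed.

Lemma dd_bump0 N c v : dd v (bump N c) 0 = 0.
Proof. by rewrite dd_bump trigf0. Qed.

Lemma dd2_bump0 N c u v : (0 < N)%N ->
  dd u (dd v (bump N c)) 0 = dot (intform c) u * dot (intform c) v.
Proof.
move=> N0; rewrite dd_bump dd_trigf trigf0 dotZl.
by field; rewrite pnatr_eq0 -lt0n.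
Qed.

Lemma bump_le N c x : (0 < N)%N -> `|bump N c x| <= 2 / N%:R.
Proof.
move=> N0; have N1 : (1 : R) <= N%:R by rewrite ler1n.
rewrite /bump /trigf mul0r addr0 mulNr -[X in X - _]mulr1 -mulrBr normrM.
have h : `|1 - cos (dot (N%:R *: intform c) x)| <= 2.
  by rewrite ler_norml; have := cos_le1 (dot (N%:R *: intform c) x);
    have := cos_geN1 (dot (N%:R *: intform c) x); lra.
rewrite mulrC; apply: ler_pM => //; rewrite ger0_norm ?invr_ge0 ?exprn_ge0//.
by rewrite lef_pV2 ?posrE ?exprn_gt0 ?ltr0n// expr2 ler_peMl.
Qed.

(** A periodic substitute for the position vector: it vanishes at the origin and its differential
    there is the identity. *)
Definition sines x : E := \row_i trigf 0 1 (1%:R *: intform (fun j => (j == i)%:Z)) x.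

Lemma sines_periodic : periodic_map sines.
Proof. by move=> x k; apply/rowP => i; rewrite !mxE trigf_periodic. Qed.

Lemma vsmooth_sines : vsmooth sines.
Proof.
move=> j; apply: (smooth_ext (f := trigf 0 1 (1%:R *: intform (fun i => (i == j)%:Z)))).
  by move=> x; rewrite mxE.
exact: smooth_trigf.
Qed.

Lemma sines0 : sines 0 = 0.
Proof. by apply/rowP => i; rewrite !mxE trigf0. Qed.

Lemma dv_sines0 u : dv u sines 0 = u.
Proof.
apply/rowP => i; rewrite mxE.
transitivity (dd u (trigf 0 1 (1%:R *: intform (fun j => (j == i)%:Z))) 0).
  by congr (dd u _ 0); apply/funext => x; rewrite mxE.
rewrite dd_trigf trigf0 mul1r scale1r -[RHS]dot_delta.
by congr dot; apply/rowP => j; rewrite !mxE eqxx; case: (j == i).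
Qed.

End Bumps.

Section BumpMetric.
Context {R : realType} {m : nat} {I : finType}.
Local Notation E := 'rV[R]_m.
Variables (A0 : 'M[R]_m) (N : nat) (c : I -> 'I_m -> int) (h : I -> 'M[R]_m).
Hypothesis N0 : (0 < N)%N.
Implicit Types (u v w x : E).

Definition bump_sum x : 'M[R]_m := \sum_a bump N (c a) x *: h a.

Definition bump_metric x : 'M[R]_m := A0 + bump_sum x.

Lemma bump_sumE x i j : bump_sum x i j = \sum_a bump N (c a) x * h a i j.
Proof. by rewrite summxE; apply: eq_bigr => a _; rewrite mxE. Qed.

Lemma msmooth_bump_sum : msmooth bump_sum.
Proof.
move=> i j; apply: (smooth_ext (f := fun x => \sum_a bump N (c a) x * h a i j)) => [x|].
  by rewrite bump_sumE.
by apply: smooth_sum => a; apply: smoothM; [exact: smooth_bump|exact: smooth_cst].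
Qed.

Lemma dm_bump_sum u x : dm u bump_sum x = \sum_a dd u (bump N (c a)) x *: h a.
Proof.
apply/matrixP => i j; rewrite mxE summxE.
transitivity (dd u (fun x => \sum_a bump N (c a) x * h a i j) x).
  by congr (dd u _ x); apply/funext => y; rewrite bump_sumE.
rewrite dd_sum => [|a]; last first.
  by apply: smoothM; [exact: smooth_bump|exact: smooth_cst].
apply: eq_bigr => a _; rewrite ddM; [|exact: smooth_bump|exact: smooth_cst].
by rewrite dd_cst mulr0 addr0 mxE.
Qed.

Lemma dm2_bump_sum u v : dm u (dm v bump_sum) 0 =
  \sum_a (dot (intform (c a)) u * dot (intform (c a)) v) *: h a.
Proof.
apply/matrixP => i j; rewrite mxE summxE.
transitivity (dd u (fun x => \sum_a dd v (bump N (c a)) x * h a i j) 0).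
  congr (dd u _ 0); apply/funext => y; rewrite dm_bump_sum summxE.
  by apply: eq_bigr => a _; rewrite mxE.
rewrite dd_sum => [|a]; last first.
  by apply: smoothM; [exact: smooth_dd (smooth_bump _ _)|exact: smooth_cst].
apply: eq_bigr => a _; rewrite ddM; [|exact: smooth_dd (smooth_bump _ _)|exact: smooth_cst].
by rewrite dd_cst mulr0 addr0 mxE dd2_bump0.
Qed.

Lemma bump_sum_periodic : periodic_map bump_sum.
Proof. by move=> x k; apply: eq_bigr => a _; rewrite bump_periodic. Qed.

Lemma bump_sum0 : bump_sum 0 = 0.
Proof. by rewrite /bump_sum big1// => a _; rewrite bump0 scale0r. Qed.

Lemma dm_bump_sum0 u : dm u bump_sum 0 = 0.
Proof. by rewrite dm_bump_sum big1// => a _; rewrite dd_bump0 scale0r. Qed.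

Lemma msmooth_bump_metric : msmooth bump_metric.
Proof.
move=> i j; apply: smooth_ext (smoothD (smooth_cst (A0 i j)) (msmooth_bump_sum i j)) => x.
by rewrite mxE.
Qed.

Lemma dm_bump_metric u : dm u bump_metric = dm u bump_sum.
Proof.
apply/funext => x; apply/matrixP => i j; rewrite !mxE.
have -> : (fun y => bump_metric y i j) = fun y => A0 i j + bump_sum y i j.
  by apply/funext => y; rewrite mxE.
rewrite ddD; [|exact: smooth_cst|exact: msmooth_bump_sum].
by rewrite dd_cst add0r.
Qed.

Lemma bump_metric_periodic : periodic_map bump_metric.
Proof. by move=> x k; rewrite /bump_metric bump_sum_periodic. Qed.

Lemma bump_metric0 : bump_metric 0 = A0.
Proof. by rewrite /bump_metric bump_sum0 addr0. Qed.

Lemma bump_sum_le x i j : `|bump_sum x i j| <= 2 / N%:R * \sum_a `|h a i j|.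
Proof.
rewrite bump_sumE mulr_sumr (le_trans (ler_norm_sum _ _ _))// ler_sum// => a _.
by rewrite normrM ler_wpM2r// bump_le.
Qed.

End BumpMetric.

Lemma bump_sum_small (R : realType) m (I : finType) (c : I -> 'I_m -> int)
    (h : I -> 'M[R]_m) (e : R) : 0 < e ->
  exists2 N, (0 < N)%N & forall x i j, `|bump_sum N c h x i j| <= e.
Proof.
move=> e0; pose K : R := \sum_i \sum_j \sum_a `|h a i j|.
have hK i j : \sum_a `|h a i j| <= K.
  rewrite /K (bigD1 i)//= (bigD1 j)//= -addrA ler_wpDr// addr_ge0//.
    by apply: sumr_ge0 => l _; apply: sumr_ge0.
  by apply: sumr_ge0 => k _; apply: sumr_ge0 => l _; apply: sumr_ge0.
have K0 : 0 <= K by do 3 (apply: sumr_ge0 => ? _).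
pose N := (Num.truncn (2 * K / e)).+1.
have HN : 2 * K / e < N%:R by apply: truncnS_gt.
exists N => // x i j; apply: le_trans (bump_sum_le c h _ _ _ _) _ => //.
have Np : (0 : R) < N%:R by rewrite ltr0n.
apply: le_trans (_ : 2 / N%:R * K <= e).
  by rewrite ler_wpM2l// divr_ge0.
by rewrite mulrAC ler_pdivrMr// [e * _]mulrC -ler_pdivrMr// ltW.
Qed.

(** * Openness of the signature *)

Section Signature.
Context {R : realType}.

Definition signs (d : nat -> bool) (i j : nat) : R :=
  if i == j then (if d i then -1 else 1) else 0.

(* Gram-Schmidt on a family whose Gram matrix is almost diagonal. *)
Lemma almost_orthonormal (V : vectType R) n (d : nat -> bool) :
  exists2 e : R, 0 < e & forall (f : V -> V -> R) (v : nat -> V),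
    bilinear_form f -> (forall x y, f x y = f y x) ->
    (forall i j, (i < n)%N -> (j < n)%N -> `|f (v i) (v j) - signs d i j| <= e) ->
  exists w : nat -> V,
    (forall i j, (i < n)%N -> (j < n)%N -> f (w i) (w j) = signs d i j) /\
    (forall x, (forall i, (i < n)%N -> f x (v i) = 0) ->
      forall i, (i < n)%N -> f x (w i) = 0).
Proof.
elim: n d => [|n IH] d.
  by exists 1 => // f v _ _ _; exists v; split=> // x _ i.
have [e e0 He] := IH (fun i => d i.+1).
(* The bound 1/4 keeps the pivot [a] at distance at least 3/4 from 0 and of the right sign.
   Eliminating with this pivot then adds at most 2 e' to the error, and 3 e' <= e by the second
   bound. *)
pose e' := Num.min (4^-1) (e / 4).
have e'0 : 0 < e' by rewrite lt_min invr_gt0 ltr0n divr_gt0.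
have e'1 : e' <= 4^-1 by rewrite ge_min lexx.
have e'2 : e' <= e / 4 by rewrite ge_min lexx orbT.
exists e' => // f v fb fs fv.
have [fl fr] := fb.
have fD1 c x y z : f (c *: x + y) z = c * f x z + f y z by have := fr z c x y.
have fD2 c x y z : f z (c *: x + y) = c * f z x + f z y by have := fl z c x y.
have f02 z : f z 0 = 0.
  have := fD2 1 0 0 z; rewrite scaler0 addr0 mul1r => h.
  by apply: (addrI (f z 0)); rewrite addr0 -h.
have fZ1 c x z : f (c *: x) z = c * f x z.
  by have := fD1 c x 0 z; rewrite addr0 (fs 0) f02 addr0.
have fZ2 c x z : f z (c *: x) = c * f z x by rewrite fs fZ1 fs.
pose a := f (v 0%N) (v 0%N).
have ha : `|a - signs d 0 0| <= e' by apply: fv.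
have ha' : `|a - (if d 0%N then -1 else 1)| <= e' by rewrite /signs eqxx in ha.
have a34 : 3 / 4 <= `|a|.
  move: ha'; case: (d 0%N); rewrite ler_norml => /andP[h1 h2].
    by rewrite ler0_norm; lra.
  by rewrite ger0_norm; lra.
have a0 : a != 0 by apply/eqP => az; rewrite az normr0 in a34; lra.
pose v' i := (- (f (v i.+1) (v 0%N) / a)) *: v 0%N + v i.+1.
have f0v' i : f (v 0%N) (v' i) = 0.
  by rewrite /v' fD2 -/a (fs (v 0%N)); field.
have fv'E i j : f (v' i) (v' j) =
    f (v i.+1) (v j.+1) - f (v i.+1) (v 0%N) * f (v j.+1) (v 0%N) / a.
  by rewrite {1}/v' fD1 f0v' mulr0 add0r /v' fD2; ring.
have [//|//||w [wd wv]] := He f v'.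
  move=> i j i1 j1; rewrite fv'E.
  have h1 := fv i.+1 j.+1 i1 j1; have h2 := fv i.+1 0%N i1 isT.
  have h3 := fv j.+1 0%N j1 isT; rewrite /signs /= subr0 in h2.
  rewrite /signs /= subr0 in h3.
  have hs : signs (fun i => d i.+1) i j = signs d i.+1 j.+1 by rewrite /signs eqSS.
  rewrite hs addrAC (le_trans (ler_normB _ _))// normrM normfV normrM.
  have h4 : `|f (v i.+1) (v 0%N)| * `|f (v j.+1) (v 0%N)| / `|a| <= 2 * e'.
    rewrite ler_pdivrMr ?normr_gt0//.
    have := normr_ge0 (f (v i.+1) (v 0%N)); have := normr_ge0 (f (v j.+1) (v 0%N)).
    move=> p1 p2; nra.
  by have := lerD h1 h4; lra.
pose w0 := (Num.sqrt `|a|)^-1 *: v 0%N.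
have sa : Num.sqrt `|a| ^+ 2 = `|a| by rewrite sqr_sqrtr.
have sa0 : Num.sqrt `|a| != 0 by rewrite sqrtr_eq0 -ltNge normr_gt0.
exists (fun i => if i is k.+1 then w k else w0); split.
  (* [v 0] is orthogonal to every [v' i], hence to every [w k]: this is the purpose of the second
     conclusion, which replaces the statement that the [w k] lie in the span of the [v' i]. *)
  have w0w k : (k < n)%N -> f w0 (w k) = 0.
    by move=> kn; rewrite /w0 fZ1 wv ?mulr0.
  case=> [|i] [|j] i1 j1.
  - rewrite /w0 fZ1 fZ2 -/a mulrA -invfM -expr2 sa /signs eqxx.
    move: ha'; case: (d 0%N); rewrite ler_norml => /andP[h1 h2].
      have an : a < 0 by lra.
      by rewrite ltr0_norm// invrN mulNr mulVf.
    have an : 0 < a by lra.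
    by rewrite gtr0_norm// mulVf.
  - by rewrite w0w.
  - by rewrite fs w0w.
  - by rewrite wd// /signs eqSS.
move=> x xv [|i] i1; first by rewrite /w0 fZ2 xv ?mulr0.
by apply: wv => // k k1; rewrite /v' fD2 !xv// mulr0 addr0.
Qed.

(** A pseudo-orthonormal basis of [A0] is almost orthonormal for a nearby [A], so Gram-Schmidt
    applies with the same signs. Here [K] bounds the products of coordinates of the basis vectors,
    so a change of the entries by e / (1 + K) changes the Gram matrix by at most e. *)
Lemma has_signature_near (m p q : nat) (A0 : 'M[R]_m) :
  inner_product p q (gform A0) ->
  exists2 e : R, 0 < e & forall A : 'M[R]_m, A^T = A ->
    (forall i j, `|A i j - A0 i j| <= e) -> inner_product p q (gform A).
Proof.
case=> _ _ [b [bb bG]].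
have [e e0 He] := @almost_orthonormal 'rV[R]_m (p + q) (fun i => i < p)%N.
pose K : R := \sum_(k < p + q) \sum_(l < p + q) \sum_i \sum_j `|b`_k 0 i * b`_l 0 j|.
have K0 : 0 <= K by do 4 (apply: sumr_ge0 => ? _).
have hK (k l : 'I_(p + q)) : \sum_i \sum_j `|b`_k 0 i * b`_l 0 j| <= K.
  rewrite /K (bigD1 k)//= (bigD1 l)//= -addrA ler_wpDr// addr_ge0//.
    by apply: sumr_ge0 => ? _; do 2 (apply: sumr_ge0 => ? _).
  by do 4 (apply: sumr_ge0 => ? _).
exists (e / (1 + K)) => [|A sA hA]; first by rewrite divr_gt0// ltr_pwDl.
have gs x y : gform A x y = gform A y x by exact: gform_sym.
split=> //; first exact: gform_bilinear.
have [|w [wd _]] := He (gform A) (fun i => b`_i) (gform_bilinear A) gs.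
  move=> k l k1 l1; have := bG (Ordinal k1) (Ordinal l1); rewrite /= => bkl.
  have -> : signs (fun i => (i < p)%N) k l = gform A0 b`_k b`_l.
    by rewrite bkl /signs -val_eqE.
  rewrite !gformE -sumrB (le_trans (ler_norm_sum _ _ _))//.
  apply: le_trans (_ : \sum_i \sum_j `|b`_k 0 i * b`_l 0 j| * (e / (1 + K)) <= _).
    apply: ler_sum => i _; rewrite -sumrB (le_trans (ler_norm_sum _ _ _))//.
    by apply: ler_sum => j _; rewrite -mulrBr normrM ler_wpM2l.
  under eq_bigr do rewrite -mulr_suml; rewrite -mulr_suml.
  apply: le_trans (_ : K * (e / (1 + K)) <= _).
    apply: ler_wpM2r; last exact: (hK (Ordinal k1) (Ordinal l1)).
    by rewrite divr_ge0 ?addr_ge0// ltW.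
  rewrite mulrCA ger_pMr// ler_pdivrMr ?ltr_pwDl// mul1r lerDr//.
have [wt wtE] : exists wt : (p + q).-tuple 'rV[R]_m,
    forall i : 'I_(p + q), wt`_i = w i.
  by exists [tuple w i | i < p + q] => i; rewrite -tnth_nth tnth_mktuple.
exists wt; split; last first.
  by move=> i j; rewrite !wtE wd// /signs -val_eqE.
rewrite basisEfree subvf size_tuple /=.
have dimE : \dim {:'rV[R]_m} = (p + q)%N.
  by have := size_basis bb.
rewrite dimE leqnn andbT; apply/freeP => k k0 i.
have : gform A (\sum_(j < p + q) k j *: wt`_j) wt`_i = 0 by rewrite k0 gform0l.
have -> : gform A (\sum_(j < p + q) k j *: wt`_j) wt`_i =
    \sum_(j < p + q) k j * gform A wt`_j wt`_i.
  elim/big_rec2: _ => [|j x y _ <-]; first exact: gform0l.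
  exact: gform_lin1.
rewrite (bigD1 i)//= !wtE wd// /signs eqxx big1 ?addr0 => [|j ji]; last first.
  by rewrite !wtE wd// /signs val_eqE (negPf ji) mulr0.
by case: ifP => _ /eqP; rewrite ?mulrN ?mulr1 ?oppr_eq0 => /eqP.
Qed.

End Signature.

Section FormMatrix.
Context {R : realType} {m : nat}.
Local Notation E := 'rV[R]_m.
Implicit Types (u v w z x : E).

Definition form_mx (f : E -> E -> R) : 'M[R]_m :=
  \matrix_(i, j) f (delta_mx 0 i) (delta_mx 0 j).

Lemma form_sum1 (f : E -> E -> R) u v : bilinear_form f ->
  f u v = \sum_i u 0 i * f (delta_mx 0 i) v.
Proof.
case=> _ fl; have f1 c x y : f (c *: x + y) v = c * f x v + f y v by have := fl v c x y.
have f0 : f 0 v = 0.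
  have := f1 1 0 0; rewrite scaler0 addr0 mul1r => h.
  by apply: (addrI (f 0 v)); rewrite addr0 -h.
rewrite {1}(row_sum_delta u); elim/big_rec2: _ => // i a b _ IH.
by rewrite f1 IH.
Qed.

Lemma bilinear_flip (f : E -> E -> R) : bilinear_form f -> bilinear_form (fun u v => f v u).
Proof. by case. Qed.

Lemma gform_mx (f : E -> E -> R) u v : bilinear_form f -> gform (form_mx f) u v = f u v.
Proof.
move=> bf; rewrite gformE (form_sum1 u v bf); apply: eq_bigr => i _.
rewrite (form_sum1 v (delta_mx 0 i) (bilinear_flip bf)) mulr_sumr.
by apply: eq_bigr => j _; rewrite mxE mulrA.
Qed.

Lemma form_mx_sym (f : E -> E -> R) : (forall u v, f u v = f v u) ->
  (form_mx f)^T = form_mx f.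
Proof. by move=> fs; apply/matrixP => i j; rewrite !mxE fs. Qed.

Lemma gform_sumZ (I : finType) (a : I -> R) (h : I -> 'M[R]_m) u v :
  gform (\sum_i a i *: h i) u v = \sum_i a i * gform (h i) u v.
Proof.
rewrite /gform mulmx_sumr mulmx_suml summxE; apply: eq_bigr => i _.
by rewrite -scalemxAr -scalemxAl mxE.
Qed.

Lemma gformD (A B : 'M[R]_m) u v : gform (A + B) u v = gform A u v + gform B u v.
Proof. by rewrite /gform mulmxDr mulmxDl mxE. Qed.

Lemma tensor4_bilinear (H : E -> E -> E -> E -> R) : tensor4 H ->
  (forall u v, bilinear_form (H u v)) /\
  (forall w z, bilinear_form (fun u v => H u v w z)).
Proof. by case=> h1 h2 h3 h4; split=> a b; split. Qed.

Lemma bump_metric_signature p q (I : finType) (A0 : 'M[R]_m)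
    (c : I -> 'I_m -> int) (h : I -> 'M[R]_m) :
  inner_product p q (gform A0) -> (forall a, (h a)^T = h a) ->
  exists2 N, (0 < N)%N & forall x, inner_product p q (gform (bump_metric A0 N c h x)).
Proof.
move=> iA hs; have [e e0 He] := has_signature_near iA.
have [N N0 HN] := bump_sum_small c h e0; exists N => // x.
have A0s : A0^T = A0.
  apply: gform_inj => u v; have [_ <- _] := iA.
  by rewrite /gform -[LHS]trace_mx11 -mxtrace_tr trace_mx11 !trmx_mul !trmxK mulmxA.
apply: He => [|i j]; last by rewrite mxE addrAC subrr add0r.
rewrite /bump_metric linearD /= A0s; congr (_ + _).
by rewrite /bump_sum linear_sum; apply: eq_bigr => a _; rewrite linearZ /= hs.
Qed.

Lemma bump_metric_compatible (pc : bool) (J : 'End(E)) N (I : finType) (A0 : 'M[R]_m)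
    (c : I -> 'I_m -> int) (h : I -> 'M[R]_m) :
  J_compatible pc (gform A0) J -> (forall a, J_compatible pc (gform (h a)) J) ->
  forall x, J_compatible pc (gform (bump_metric A0 N c h x)) J.
Proof.
move=> JA Jh x u v; rewrite /bump_metric !gformD JA mulrDr; congr (_ + _).
rewrite /bump_sum !gform_sumZ mulr_sumr; apply: eq_bigr => a _.
by rewrite Jh; ring.
Qed.

End FormMatrix.

Section HessianMetric.
Context {R : realType} {m p q : nat}.
Local Notation E := 'rV[R]_m.
Implicit Types (u v w z x : E).

Definition sgb (b : bool) : int := if b then -1 else 1.

Definition quad_coef (a : 'I_m * 'I_m * bool) : 'I_m -> int :=
  fun k => (k == a.1.1)%:Z + sgb a.2 * (k == a.1.2)%:Z.

Lemma dot_delta_coef (c : 'I_m -> int) i (b : int) u :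
  (forall k, c k = b * (k == i)%:Z) -> dot (intform c) u = b%:~R * u 0 i.
Proof.
move=> cE; rewrite /dot (bigD1 i)//= mxE cE eqxx mulr1 big1 ?addr0// => k ki.
by rewrite mxE cE (negPf ki) mulr0 mul0r.
Qed.

Lemma dot_intformD (c d : 'I_m -> int) u :
  dot (intform (fun k => c k + d k) : E) u = dot (intform c) u + dot (intform d) u.
Proof.
by rewrite /dot -big_split; apply: eq_bigr => i _; rewrite !mxE intrD mulrDl.
Qed.

Lemma dot_quad_coef a u :
  dot (intform (quad_coef a)) u = u 0 a.1.1 + (sgb a.2)%:~R * u 0 a.1.2.
Proof.
rewrite dot_intformD (@dot_delta_coef _ a.1.1 1) => [|k]; last by rewrite mul1r.
by rewrite mul1r (@dot_delta_coef _ a.1.2 (sgb a.2)).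
Qed.

(* x_i y_j + x_j y_i is a combination of squares of integral linear forms. *)
Lemma hess_metric (ip : E -> E -> R) (H : E -> E -> E -> E -> R) :
  inner_product p q ip -> tensor4 H ->
  (forall u v w z, H u v w z = H v u w z) ->
  (forall u v w z, H u v w z = H u v z w) ->
  exists G : E -> 'M[R]_m,
  [/\ msmooth G /\ periodic_map G,
      forall x, inner_product p q (gform (G x)),
      forall u v, gform (G 0) u v = ip u v,
      (forall u, dm u G 0 = 0) /\
      (forall u v w z, gform (dm u (dm v G) 0) w z = H u v w z)
    & forall pc (J : 'End(E)), J_compatible pc ip J ->
        (forall u v, J_compatible pc (H u v) J) ->
        forall x, J_compatible pc (gform (G x)) J].
Proof.
move=> iip tH Hs1 Hs2; have [bip _ _] := iip.
have [bH1 bH2] := tensor4_bilinear tH.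
have iA : inner_product p q (gform (form_mx ip)).
  by rewrite (_ : gform _ = ip)//; apply/funext => u; apply/funext => v; exact: gform_mx.
(* For l = x_i + x_j and l' = x_i - x_j, l(u) l(v) - l'(u) l'(v) = 2 (u_i v_j + u_j v_i). The 1/4
   leaves half of it, and the two halves agree after summation because [H] is symmetric in its first
   two arguments. *)
pose h (a : 'I_m * 'I_m * bool) : 'M[R]_m :=
  ((sgb a.2)%:~R / 4) *: form_mx (H (delta_mx 0 a.1.1) (delta_mx 0 a.1.2)).
have hE a u v : gform (h a) u v =
    (sgb a.2)%:~R / 4 * H (delta_mx 0 a.1.1) (delta_mx 0 a.1.2) u v.
  by rewrite /h /gform -scalemxAr -scalemxAl mxE -/(gform _ _ _) gform_mx.
have hs a : (h a)^T = h a.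
  by rewrite /h linearZ /= form_mx_sym// => u v; exact: Hs2.
have [N N0 HN] := bump_metric_signature quad_coef iA hs.
exists (bump_metric (form_mx ip) N quad_coef h); split=> //.
- split; first exact: msmooth_bump_metric.
  exact: bump_metric_periodic.
- by move=> u v; rewrite bump_metric0 gform_mx.
- split=> [u|u v w z]; first by rewrite dm_bump_metric dm_bump_sum0.
  rewrite dm_bump_metric dm2_bump_sum// gform_sumZ.
  rewrite -(pair_bigA _ (fun ij b => dot (intform (quad_coef (ij, b))) u *
    dot (intform (quad_coef (ij, b))) v * gform (h (ij, b)) w z)) /=.
  rewrite -(pair_bigA _ (fun i j => \sum_b dot (intform (quad_coef (i, j, b))) u *
    dot (intform (quad_coef (i, j, b))) v * gform (h (i, j, b)) w z)) /=.
  pose K i j := H (delta_mx 0 i) (delta_mx 0 j) w z.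
  have Ks i j : K i j = K j i by rewrite /K Hs1.
  have HE a b : H a b w z = \sum_i \sum_j a 0 i * b 0 j * K i j.
    rewrite (form_sum1 a b (bH2 w z)); apply: eq_bigr => i _.
    rewrite (form_sum1 b (delta_mx 0 i) (bilinear_flip (bH2 w z))) mulr_sumr.
    by apply: eq_bigr => j _; rewrite mulrA.
  transitivity (\sum_i \sum_j (2^-1 * (u 0 i * v 0 j * K i j) +
      2^-1 * (v 0 i * u 0 j * K i j))).
    apply: eq_bigr => i _; apply: eq_bigr => j _.
    rewrite big_bool /= !dot_quad_coef !hE /= -/(K i j) /sgb.
    by rewrite rmorphN1 rmorph1; field.
  transitivity (2^-1 * H u v w z + 2^-1 * H v u w z); last by rewrite (Hs1 v u); field.
  rewrite !HE !mulr_sumr -big_split; apply: eq_bigr => i _ /=.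
  by rewrite !mulr_sumr -big_split.
move=> pc J Jip JH; apply: bump_metric_compatible.
  by move=> u v; rewrite !gform_mx.
by move=> a u v; rewrite !hE JH; ring.
Qed.

Lemma weyl_hessE (G : E -> 'M[R]_m) om u v w z : msmooth G -> vsmooth om -> om 0 = 0 ->
  weyl_hess G om u v w z = gform (dm u (dm v G) 0) w z +
    2 * dot (dv u om 0) v * gform (G 0) w z.
Proof.
move=> sG so o0; rewrite /weyl_hess /weyl_dform.
have sdG := msmooth_dm v sG; have sc a := @vsmooth_cst R m a.
have sd : smooth (fun x => dot (om x) v).
  by apply: smooth_sum => i; apply: smoothM; [exact: so|exact: smooth_cst].
have s2d : smooth (fun x => 2 * dot (om x) v) by apply: smoothM => //; exact: smooth_cst.
have sg := smooth_gform sG (sc w) (sc z).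
rewrite ddD; [|exact: (smooth_gform sdG (sc w) (sc z))|exact: smoothM].
rewrite dd_gform_cst// ddM// ddZ// o0.
have -> : dot 0 v = 0 :> R by rewrite /dot big1// => i _; rewrite mxE mul0r.
rewrite mulr0 mul0r addr0; congr (_ + 2 * _ * _).
rewrite [LHS]dd_sum => [|i]; last by apply: smoothM; [exact: so|exact: smooth_cst].
apply: eq_bigr => i _; rewrite ddM; [|exact: so|exact: smooth_cst].
by rewrite dd_cst mulr0 addr0 mxE.
Qed.

End HessianMetric.

Definition sym4 (R : realType) (T : Type) (f : T -> T -> T -> T -> R) u v w z : R :=
    f u v w z + f u v z w + f u w v z + f u z v w + f u w z v + f u z w v + f v
    u w z + f v u z w + f w u v z + f z u v w + f w u z v + f z u w v + f v w u
    z + f v z u w + f w v u z + f z v u w + f w z u v + f z w u v + f v w z u +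
    f v z w u + f w v z u + f z v w u + f w z v u + f z w v u.

(** * Polarization of quartic forms, and Kaehler metrics *)

Section Polarization.
Context {R : realType} {m p q : nat}.
Local Notation E := 'rV[R]_m.
Implicit Types (u v w z x : E) (f : E -> E -> E -> E -> R).

Definition mon4 (i j k l : 'I_m) u v w z : R := u 0 i * v 0 j * w 0 k * z 0 l.

Lemma tensor4E f u v w z : tensor4 f -> f u v w z =
  \sum_i \sum_j \sum_k \sum_l
    f (delta_mx 0 i) (delta_mx 0 j) (delta_mx 0 k) (delta_mx 0 l) * mon4 i j k l u v w z.
Proof.
case=> f1 f2 f3 f4.
have b1 x y : bilinear_form (fun a b => f a b x y) by split.
have b2 x y : bilinear_form (fun a b => f x y a b) by split.
rewrite (form_sum1 u v (b1 w z)); apply: eq_bigr => i _.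
rewrite (form_sum1 v (delta_mx 0 i) (bilinear_flip (b1 w z))) mulr_sumr.
apply: eq_bigr => j _; rewrite (form_sum1 w z (b2 _ _)) !mulr_sumr.
apply: eq_bigr => k _; rewrite (form_sum1 z _ (bilinear_flip (b2 _ _))) !mulr_sumr.
by apply: eq_bigr => l _; rewrite /mon4; ring.
Qed.

Lemma sym4E f u v w z : tensor4 f -> sym4 f u v w z =
  \sum_i \sum_j \sum_k \sum_l
    f (delta_mx 0 i) (delta_mx 0 j) (delta_mx 0 k) (delta_mx 0 l) *
      sym4 (mon4 i j k l) u v w z.
Proof.
move=> tf; rewrite /sym4 !(fun a b c d => tensor4E a b c d tf) -!big_split.
apply: eq_bigr => i _ /=; rewrite -!big_split; apply: eq_bigr => j _ /=.
rewrite -!big_split; apply: eq_bigr => k _ /=.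
rewrite -!big_split; apply: eq_bigr => l _ /=.
by rewrite !mulrDr.
Qed.

Local Notation idx := ('I_m * 'I_m * 'I_m * 'I_m * bool * bool * bool)%type.

Definition quart_coef (a : idx) : 'I_m -> int := let: (i, j, k, l, b, c, d) := a in
  fun n => (n == i)%:Z + sgb b * (n == j)%:Z + sgb c * (n == k)%:Z + sgb d * (n == l)%:Z.

Lemma dot_quart_coef i j k l b c d u : dot (intform (quart_coef (i, j, k, l, b, c, d))) u =
  u 0 i + (sgb b)%:~R * u 0 j + (sgb c)%:~R * u 0 k + (sgb d)%:~R * u 0 l.
Proof.
rewrite !dot_intformD (@dot_delta_coef _ _ _ i 1) => [|n]; last by rewrite mul1r.
by rewrite mul1r (@dot_delta_coef _ _ _ j (sgb b))// (@dot_delta_coef _ _ _ k (sgb c))//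
  (@dot_delta_coef _ _ _ l (sgb d)).
Qed.

(** Polarization: in the product of the four values of x_i ± x_j ± x_k ± x_l, weighting by the
    product of the three signs kills every monomial in which one of the four slots i, j, k, l is
    missing. Each of the 24 remaining ones is counted 8 times. *)
Lemma sum_quart f u v w z : tensor4 f ->
  \sum_(a : idx) (let: (i, j, k, l, b, c, d) := a in
     (sgb b)%:~R * (sgb c)%:~R * (sgb d)%:~R / 8 *
       f (delta_mx 0 i) (delta_mx 0 j) (delta_mx 0 k) (delta_mx 0 l)) *
    (dot (intform (quart_coef a)) u * dot (intform (quart_coef a)) v *
     dot (intform (quart_coef a)) w * dot (intform (quart_coef a)) z) =
  sym4 f u v w z.
Proof.
move=> tf; rewrite (sym4E _ _ _ _ tf).
pose t i j k l b c d : R := ((sgb b)%:~R * (sgb c)%:~R * (sgb d)%:~R / 8 *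
    f (delta_mx 0 i) (delta_mx 0 j) (delta_mx 0 k) (delta_mx 0 l)) *
  (dot (intform (quart_coef (i, j, k, l, b, c, d))) u *
   dot (intform (quart_coef (i, j, k, l, b, c, d))) v *
   dot (intform (quart_coef (i, j, k, l, b, c, d))) w *
   dot (intform (quart_coef (i, j, k, l, b, c, d))) z).
transitivity (\sum_i \sum_j \sum_k \sum_l \sum_b \sum_c \sum_d t i j k l b c d).
  rewrite !pair_bigA /=; apply: eq_bigr.
  by case=> [[[[[[i j] k] l] b] c] d] _.
do 4 (apply: eq_bigr => ? _).
rewrite !big_bool /t !dot_quart_coef /sgb !rmorphN1 !rmorph1.
by rewrite /sym4 /mon4 /=; field.
Qed.

(* The Hessian of a sum of functions of linear forms l is a sum of multiples of
   l (x) l, so that its J-invariant part has the symmetries of a Kaehler metric. *)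
Lemma kaehler_metric (pc : bool) (J : 'End(E)) (ip : E -> E -> R) f :
  (forall v, J (J v) = sgn pc *: v) -> inner_product p q ip -> J_compatible pc ip J ->
  tensor4 f ->
  exists G : E -> 'M[R]_m,
  [/\ msmooth G /\ periodic_map G,
      forall x, inner_product p q (gform (G x)) /\ J_compatible pc (gform (G x)) J,
      forall u v, gform (G 0) u v = ip u v,
      (forall u, dm u G 0 = 0) /\
      (forall u v w z, gform (dm u (dm v G) 0) w z =
        sym4 f u v w z - sgn pc * sym4 f u v (J w) (J z))
    & forall x u v w, gform (dm u G x) v (J w) + gform (dm v G x) w (J u)
        + gform (dm w G x) u (J v) = 0].
Proof.
move=> JJ iip Jip tf; have [bip _ _] := iip.
have iA : inner_product p q (gform (form_mx ip)).
  by rewrite (_ : gform _ = ip)//; apply/funext => u; apply/funext => v; exact: gform_mx.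
pose coef (a : idx) : R := let: (i, j, k, l, b, c, d) := a in
  (sgb b)%:~R * (sgb c)%:~R * (sgb d)%:~R / 8 *
    f (delta_mx 0 i) (delta_mx 0 j) (delta_mx 0 k) (delta_mx 0 l).
pose L (a : idx) : E := intform (quart_coef a).
pose hf a w z : R := coef a * (dot (L a) w * dot (L a) z -
  sgn pc * (dot (L a) (J w) * dot (L a) (J z))).
have bh a : bilinear_form (hf a).
  by split=> [y c w z|y c w z]; rewrite /hf /= linearP !dotDr !dotZr; ring.
pose h a := form_mx (hf a).
have hE a w z : gform (h a) w z = hf a w z by exact: gform_mx.
have hs a : (h a)^T = h a.
  by apply: form_mx_sym => u v; rewrite /hf; ring.
have [N N0 HN] := bump_metric_signature quart_coef iA hs.
have ss : @sgn R pc * sgn pc = 1 by exact: sgn_sq.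
exists (bump_metric (form_mx ip) N quart_coef h); split=> //.
- split; first exact: msmooth_bump_metric.
  exact: bump_metric_periodic.
- move=> x; split=> //; apply: bump_metric_compatible.
    by move=> u v; rewrite !gform_mx.
  by move=> a u v; rewrite !hE /hf !JJ !dotZr; move: ss; move: (sgn pc) => s ss; ring: ss.
- by move=> u v; rewrite bump_metric0 gform_mx.
- split=> [u|u v w z]; first by rewrite dm_bump_metric dm_bump_sum0.
  rewrite dm_bump_metric dm2_bump_sum// gform_sumZ.
  rewrite -!(sum_quart _ _ _ _ tf) mulr_sumr -sumrB; apply: eq_bigr => a _.
  rewrite hE /hf -/(L a).
  by case: a => [[[[[[i j] k] l] b] c] d] /=; ring.
(* Each bump contributes a multiple of l(u) (l(v) l(J w) - l(J v) l(w)), whose cyclic sum vanishes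
   at every point of the torus. *)
move=> x u v w; rewrite !dm_bump_metric !dm_bump_sum !gform_sumZ -!big_split.
apply: big1 => a _ /=; rewrite !hE /hf !dd_bump /trigf -/(L a) !JJ !dotZr.
by move: ss; move: (sgn pc) => s ss; ring: ss.
Qed.

End Polarization.

(** * Curvature from the Hessian *)

Section CurvatureAlgebra.
Context {R : realType} {V : vectType R}.
Variables (pc : bool) (J : 'End(V)).
Hypothesis JJ : forall v, J (J v) = sgn pc *: v.
Implicit Types (A H B : V -> V -> V -> V -> R) (ip psi : V -> V -> R).

Lemma scalarZ (f : V -> R) c x : scalar f -> f (c *: x) = c * f x.
Proof.
move=> fl; have f0 : f 0 = 0.
  have := fl 1 0 0; rewrite scaler0 addr0 mul1r => h.
  by apply: (addrI (f 0)); rewrite addr0 -h.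
by have := fl c x 0; rewrite addr0 f0 addr0.
Qed.

Lemma tensor4Z A : tensor4 A -> forall c x y z w,
  (A (c *: x) y z w = c * A x y z w) * (A x (c *: y) z w = c * A x y z w) *
  (A x y (c *: z) w = c * A x y z w) * (A x y z (c *: w) = c * A x y z w).
Proof.
case=> f1 f2 f3 f4 c x y z w.
by rewrite (scalarZ _ _ (f1 y z w)) (scalarZ _ _ (f2 x z w)) (scalarZ _ _ (f3 x y w))
  (scalarZ _ _ (f4 x y z)).
Qed.

(** The classical octahedron argument: a combination of the four cyclic instances of the Bianchi
    identity. *)
Lemma riemann_pair_sym A : riemann_tensor A -> forall x y z w, A x y z w = A z w x y.
Proof.
case=> _ a12 b a34 x y z w.
have m12 a c d e : A a c d e = - A c a d e by have := a12 a c d e; lra.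
have m34 a c d e : A a c d e = - A a c e d by have := a34 a c d e; lra.
have := b x y z w; have := b y z w x; have := b z w x y; have := b w x y z.
rewrite !(m12 y x z w, m12 y x w z, m34 x y w z, m12 z x y w, m12 z x w y, m34 x z w y, m12
  w x y z, m12 w x z y, m34 x w z y, m12 z y x w, m12 z y w x, m34 y z w x, m12 w y x z, m12
  w y z x, m34 y w z x, m12 w z x y, m12 w z y x, m34 z w y x).
lra.
Qed.

(* Every permutation of the arguments is expressed by two of them, so that the
   curvature identities below become linear; the instances of the Hermitian and
   Kaehler identities that imply them were found by linear algebra. *)
Lemma riemann_perm A : riemann_tensor A -> forall X Y Z W,
  ((A Y X Z W = - A X Y Z W) *
   (A X Y W Z = - A X Y Z W) *
   (A Y X W Z = A X Y Z W) *
   (A Z W X Y = A X Y Z W) *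
   (A W Z X Y = - A X Y Z W) *
   (A Z W Y X = - A X Y Z W) *
   (A W Z Y X = A X Y Z W) *
   (A Z X Y W = - A X Z Y W) *
   (A X Z W Y = - A X Z Y W) *
   (A Z X W Y = A X Z Y W) *
   (A Y W X Z = A X Z Y W) *
   (A W Y X Z = - A X Z Y W) *
   (A Y W Z X = - A X Z Y W) *
   (A W Y Z X = A X Z Y W) *
   (A X W Y Z = A X Z Y W - A X Y Z W) *
   (A W X Y Z = A X Y Z W - A X Z Y W) *
   (A X W Z Y = A X Y Z W - A X Z Y W) *
   (A W X Z Y = A X Z Y W - A X Y Z W) *
   (A Y Z X W = A X Z Y W - A X Y Z W) *
   (A Z Y X W = A X Y Z W - A X Z Y W) *
   (A Y Z W X = A X Y Z W - A X Z Y W) *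
   (A Z Y W X = A X Z Y W - A X Y Z W))%type.
Proof.
move=> rA X Y Z W; have ps := riemann_pair_sym rA; case: rA => _ a12 b a34.
have m12 a c d e : A a c d e = - A c a d e by have := a12 a c d e; lra.
have m34 a c d e : A a c d e = - A a c e d by have := a34 a c d e; lra.
have h1 a c d e : A c a e d = A a c d e by rewrite m12 m34 opprK.
have h2 a c d e : A a d c e = A c e a d by rewrite ps.
have c0 : A X W Y Z = A X Z Y W - A X Y Z W.
  by have := b X Y Z W; rewrite (ps X W) (m12 Z X Y W); lra.
repeat split; first [rewrite (h1 X W Y Z) c0 ?opprB; exact: erefl | rewrite (h1 X Y Z W)
  ?opprB; exact: erefl | rewrite (h1 X Z Y W) ?opprB; exact: erefl | rewrite (h1 Y W X Z)
  (ps Y W X Z) ?opprB; exact: erefl | rewrite (h1 Y Z X W) (ps Y Z X W) c0 ?opprB; exact: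
  erefl | rewrite (h1 Z W X Y) (ps Z W X Y) ?opprB; exact: erefl | rewrite (m12 W X Y Z) c0
  ?opprB; exact: erefl | rewrite (m12 W Y X Z) (ps Y W X Z) ?opprB; exact: erefl | rewrite
  (m12 W Z X Y) (ps Z W X Y) ?opprB; exact: erefl | rewrite (m12 Y X Z W) ?opprB; exact:
  erefl | rewrite (m12 Z X Y W) ?opprB; exact: erefl | rewrite (m12 Z Y X W) (ps Y Z X W) c0
  ?opprB; exact: erefl | rewrite (m34 X W Z Y) c0 ?opprB; exact: erefl | rewrite (m34 X Y W
  Z) ?opprB; exact: erefl | rewrite (m34 X Z W Y) ?opprB; exact: erefl | rewrite (m34 Y W Z
  X) (ps Y W X Z) ?opprB; exact: erefl | rewrite (m34 Y Z W X) (ps Y Z X W) c0 ?opprB;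
  exact: erefl | rewrite (m34 Z W Y X) (ps Z W X Y) ?opprB; exact: erefl | rewrite (ps Y W X
  Z) ?opprB; exact: erefl | rewrite (ps Y Z X W) c0 ?opprB; exact: erefl | rewrite (ps Z W X
  Y) ?opprB; exact: erefl | rewrite c0 ?opprB; exact: erefl].
Qed.

(* The lowered curvature at a critical point of a metric with Hessian H. *)
Definition hess_curv H x y z w : R :=
  2^-1 * (H x z y w + H y w x z - H x w y z - H y z x w).

(** The Hessian at the origin of a metric with curvature [A] in geodesic normal coordinates. *)
Definition riemann_hess A x y z w : R := 3^-1 * (A x z y w + A x w y z).

(** Symmetrization in each pair of arguments, followed by the projection, up to a factor, onto forms
    in the last pair that are compatible with [J]. *)
Definition sym_hess B x y z w : R :=
  let f z w := B x y z w + B y x z w + B x y w z + B y x w z in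
  f z w - sgn pc * f (J z) (J w).

(* The coefficients of the three Hessians below solve the linear system
   [hess_curv (_ A) = A] modulo the identities satisfied by [A]. *)
Definition hermitian_hess A := sym_hess (fun x y z w => 7 / 48 * A x z y w
  - sgn pc / 16 * A x (J y) z (J w) + sgn pc / 48 * A (J x) z (J y) w).

(** Its symmetrization is the fourth derivative of a Kaehler potential at the point; the J-invariant
    part in the last two arguments is then the Hessian of the metric. *)
Definition kaehler_quartic A x y z w : R := - sgn pc / 32 * A x (J y) z (J w).

Definition kaehler_hess A x y z w : R := sym4 (kaehler_quartic A) x y z w
  - sgn pc * sym4 (kaehler_quartic A) x y (J z) (J w).

Definition kaehler_weyl_hess A := sym_hess (fun x y z w =>
  12^-1 * A x z y w - sgn pc / 12 * A x (J y) z (J w)).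

(* The contribution to the curvature of a Weyl form [om] vanishing at the point,
   with [psi u v = 2 (D_u om) v]. *)
Definition weyl_part ip psi x y z w : R := psi x y * ip z w
  + 2^-1 * (psi x z * ip y w - psi y z * ip x w - psi x w * ip y z + psi y w * ip x z).

Lemma riemann_hess_curv A x y z w : riemann_tensor A ->
  hess_curv (riemann_hess A) x y z w = A x y z w.
Proof.
move=> rA; rewrite /hess_curv /riemann_hess !(riemann_perm rA x y z w).
by field.
Qed.

Lemma hermitian_hess_curv A x y z w : riemann_tensor A -> hermitian_identity pc J A ->
  hess_curv (hermitian_hess A) x y z w = A x y z w.
Proof.
move=> rA hA; have [tA _ _ _] := rA; have Z := tensor4Z tA.
have rP := riemann_perm rA.
have h1 := hA x y z w; have h2 := hA x z y w.
rewrite /hess_curv /hermitian_hess /sym_hess !JJ !Z.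
move: h1 h2; rewrite !(rP x y z w, rP x y (J z) (J w), rP x (J y) z (J w), rP x (J y) (J z)
  w, rP (J x) y z (J w), rP (J x) y (J z) w, rP (J x) (J y) z w, rP (J x) (J y) (J z) (J
  w)).
case: pc; rewrite /sgn => h1 h2; lra.
Qed.

Lemma kaehler_hess_curv A x y z w : riemann_tensor A -> kaehler_identity pc J A ->
  hess_curv (kaehler_hess A) x y z w = A x y z w.
Proof.
move=> rA kA; have [tA _ _ _] := rA; have Z := tensor4Z tA.
have rP := riemann_perm rA.
rewrite /hess_curv /kaehler_hess /sym4 /kaehler_quartic !JJ !Z.
have := kA x z (J y) (J w); have := kA z (J w) (J y) x; have := kA (J y) (J x) (J z) (J w);
  have := kA (J w) (J z) y x; have := kA (J y) (J z) w x; have := kA (J z) (J x) (J w) (J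
  y); have := kA z y (J x) (J w); have := kA w z (J y) (J x); have := kA w (J z) (J y) x.
rewrite !JJ !Z.
rewrite !(rP x y z w, rP x y (J z) (J w), rP x (J y) z (J w), rP x (J y) (J z) w, rP (J x) y
  z (J w), rP (J x) y (J z) w, rP (J x) (J y) z w, rP (J x) (J y) (J z) (J w)).
case: pc; rewrite /sgn => *; lra.
Qed.

Section KaehlerWeyl.
Variables (ip psi : V -> V -> R).
Hypotheses (bip : bilinear_form ip) (ips : forall x y, ip x y = ip y x)
  (Jip : J_compatible pc ip J) (bpsi : bilinear_form psi) (psi0 : forall x, psi x x = 0).

Lemma bilinearZ (f : V -> V -> R) : bilinear_form f -> forall c x y,
  (f (c *: x) y = c * f x y) * (f x (c *: y) = c * f x y).
Proof. by case=> f1 f2 c x y; rewrite (scalarZ _ _ (f1 x)) (scalarZ _ _ (f2 y)). Qed.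

Lemma psi_anti x y : psi x y = - psi y x.
Proof.
have [f1 f2] := bpsi; have := psi0 (x + y).
have D1 a b c : psi (a + b) c = psi a c + psi b c.
  by have := f2 c 1 a b; rewrite scale1r mul1r.
have D2 a b c : psi c (a + b) = psi c a + psi c b.
  by have := f1 c 1 a b; rewrite scale1r mul1r.
by rewrite D1 !D2 !psi0; lra.
Qed.

Lemma ip_rules a b : (ip b a = ip a b) * (ip (J a) b = - ip a (J b)) *
  (ip b (J a) = - ip a (J b)) * (ip (J b) a = ip a (J b)) *
  (ip (J a) (J b) = - (sgn pc * ip a b)) * (ip (J b) (J a) = - (sgn pc * ip a b)).
Proof.
have sk x y : ip (J x) y = - ip x (J y).
  have := Jip x (J y); rewrite JJ (bilinearZ bip).
  by case: pc; rewrite /sgn => h; lra.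
by rewrite (ips b a) (ips b (J a)) (ips (J b) a) (ips (J b)) !Jip sk mulNr.
Qed.

Lemma psi_rules a b : (psi b a = - psi a b) * (psi (J b) (J a) = - psi (J a) (J b)) *
  (psi b (J a) = - psi (J a) b) * (psi (J b) a = - psi a (J b)).
Proof. by rewrite (psi_anti b a) (psi_anti (J b) a) (psi_anti b) (psi_anti (J b)). Qed.

(** [weyl_part] satisfies the first two curvature identities and has the same symmetric part in the
    last two arguments as [A], so the difference has the symmetries of a Riemannian curvature
    tensor. *)
Lemma weyl_split A : tensor4 A -> antisym12 A -> bianchi A ->
  (forall x y z w, A x y z w + A x y w z = 2 * psi x y * ip z w) ->
  exists2 Rg, riemann_tensor Rg & forall x y z w,
    A x y z w = Rg x y z w + weyl_part ip psi x y z w.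
Proof.
move=> tA a12 b a34; exists (fun x y z w => A x y z w - weyl_part ip psi x y z w).
  split.
  - have [p1 p2] := bpsi; have [i1 i2] := bip; have [A1 A2 A3 A4] := tA.
    split=> a c d e x y /=; rewrite /weyl_part.
    + rewrite (A1 a c d) !(fun z => p2 z e x y) !(fun z => i2 z e x y).
      by rewrite /=; ring.
    + rewrite (A2 a c d) !(fun z => p1 z e x y) !(fun z => p2 z e x y).
      by rewrite !(fun z => i2 z e x y) /=; ring.
    + rewrite (A3 a c d) !(fun z => p1 z e x y) !(fun z => i2 z e x y).
      by rewrite !(fun z => i1 z e x y) /=; ring.
    + rewrite (A4 a c d) !(fun z => p1 z e x y) !(fun z => i1 z e x y).
      by rewrite /=; ring.
  - move=> x y z w; have := a12 x y z w.
    by rewrite /weyl_part (psi_anti y x); lra.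
  - move=> x y z w; have := b x y z w; rewrite /weyl_part.
    by rewrite (psi_anti z x) (psi_anti y x) (psi_anti z y) (ips z) (ips y x) (ips z y)
      (ips x z) (ips y z); lra.
  move=> x y z w; have := a34 x y z w; rewrite /weyl_part.
  by rewrite (ips w z); lra.
by move=> x y z w; rewrite subrK.
Qed.

Variable A : V -> V -> V -> V -> R.
Hypotheses (wA : tensor4 A) (wa12 : antisym12 A) (wb : bianchi A)
  (wa34 : forall x y z w, A x y z w + A x y w z = 2 * psi x y * ip z w)
  (kA : kaehler_identity pc J A).

Let Zp := bilinearZ bpsi.
Let Zi := bilinearZ bip.

(** This is psi /\ Omega = 0, the algebraic counterpart of d (d Omega) = 0 for d Omega = - 2 om /\
    Omega and d om = psi. Six instances of the Kaehler identity imply it linearly. *)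
Lemma psi_wedge x y z w : psi x y * ip z (J w) - psi x z * ip y (J w)
  + psi x w * ip y (J z) + psi y z * ip x (J w) - psi y w * ip x (J z)
  + psi z w * ip x (J y) = 0.
Proof.
have [Rg rR AE] := weyl_split wA wa12 wb wa34; have [tR _ _ _] := rR.
have Z := tensor4Z tR; have rP := riemann_perm rR.
have := kA x z w (J y); have := kA x w y (J z); have := kA y w x (J z); have := kA z w y (J
  x); have := kA z y x (J w); have := kA x y w (J z).
rewrite !AE /weyl_part !JJ !Z !Zp !Zi.
rewrite !(ip_rules x y, ip_rules x z, ip_rules x w, ip_rules y z, ip_rules y w, ip_rules z
  w) !(psi_rules x y, psi_rules x z, psi_rules x w, psi_rules y z, psi_rules y w, psi_rules
  z w).
rewrite !(rP x y z (J w), rP x y (J z) w, rP x (J y) z w, rP x (J y) (J z) (J w), rP (J x) y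
  z w, rP (J x) y (J z) (J w), rP (J x) (J y) z (J w), rP (J x) (J y) (J z) w).
case: pc; rewrite /sgn => *; lra.
Qed.

Lemma kaehler_weyl_hess_curv x y z w :
  hess_curv (kaehler_weyl_hess A) x y z w + weyl_part ip psi x y z w = A x y z w.
Proof.
have [Rg rR AE] := weyl_split wA wa12 wb wa34; have [tR _ _ _] := rR.
have Z := tensor4Z tR; have rP := riemann_perm rR.
have := kA z w x y; have := kA y w (J z) (J x); have := kA x w y z; have := kA y z (J w) (J
  x); have := kA x z (J w) (J y); have := kA x y z w.
rewrite /hess_curv /kaehler_weyl_hess /sym_hess.
rewrite !AE /weyl_part !JJ !Z !Zp !Zi.
rewrite !(ip_rules x y, ip_rules x z, ip_rules x w, ip_rules y z, ip_rules y w, ip_rules z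
  w) !(psi_rules x y, psi_rules x z, psi_rules x w, psi_rules y z, psi_rules y w, psi_rules
  z w).
rewrite !(rP x y z w, rP x y (J z) (J w), rP x (J y) z (J w), rP x (J y) (J z) w, rP (J x) y
  z (J w), rP (J x) y (J z) w, rP (J x) (J y) z w, rP (J x) (J y) (J z) (J w)).
case: pc; rewrite /sgn => *; lra.
Qed.

(* The derivative at the base point of [d Omega = - 2 om /\ Omega]. *)
Lemma kaehler_weyl_hess_cyc x y z w :
  let H u v a b := kaehler_weyl_hess A u v a b + psi u v * ip a b in
  H x y z (J w) + H x z w (J y) + H x w y (J z) = 0.
Proof.
have [Rg rR AE] := weyl_split wA wa12 wb wa34; have [tR _ _ _] := rR.
have Z := tensor4Z tR; have rP := riemann_perm rR.
have := kA (J y) x z w; have := kA w x z (J y); have := kA z x (J y) w; have := kA z (J x) y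
  w; have := kA w y z (J x); have := kA y x (J w) z; have := kA (J z) x y w; have := kA x (J
  w) z y; have := kA y (J x) z w; have := kA z y (J x) w; have := kA (J x) w y z; have := kA
  w z x (J y).
rewrite /= /kaehler_weyl_hess /sym_hess.
have JZ v : J (sgn pc *: v) = sgn pc *: J v by rewrite linearZ.
rewrite !AE /weyl_part !(JJ, JZ) !Z !Zp !Zi.
rewrite !(ip_rules x y, ip_rules x z, ip_rules x w, ip_rules y z, ip_rules y w, ip_rules z
  w) !(psi_rules x y, psi_rules x z, psi_rules x w, psi_rules y z, psi_rules y w, psi_rules
  z w).
rewrite !(rP x y z (J w), rP x y (J z) w, rP x (J y) z w, rP x (J y) (J z) (J w), rP (J x) y
  z w, rP (J x) y (J z) (J w), rP (J x) (J y) z (J w), rP (J x) (J y) (J z) w).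
case: pc; rewrite /sgn => *; lra.
Qed.

End KaehlerWeyl.

End CurvatureAlgebra.

Section HessianTensors.
Context {R : realType} {V : vectType R}.
Variables (pc : bool) (J : 'End(V)).
Implicit Types (A H B : V -> V -> V -> V -> R).

Lemma tensor4P A : tensor4 A -> forall c x x' y z w,
  (A (c *: x + x') y z w = c * A x y z w + A x' y z w) *
  (A y (c *: x + x') z w = c * A y x z w + A y x' z w) *
  (A y z (c *: x + x') w = c * A y z x w + A y z x' w) *
  (A y z w (c *: x + x') = c * A y z w x + A y z w x').
Proof.
by case=> A1 A2 A3 A4 c x x' y z w; split; [split; [split|]|];
  [exact: A1|exact: A2|exact: A3|exact: A4].
Qed.

Lemma riemann_hess_tensor A : tensor4 A -> tensor4 (riemann_hess A).
Proof.
by move=> /tensor4P T; split=> a c d e x y /=; rewrite /riemann_hess !T /=; ring.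
Qed.

Lemma riemann_hess_sym A : riemann_tensor A -> forall x y z w,
  riemann_hess A x y z w = riemann_hess A y x z w /\
  riemann_hess A x y z w = riemann_hess A x y w z.
Proof.
move=> rA x y z w; rewrite /riemann_hess !(riemann_perm rA x y z w).
by split; ring.
Qed.

Lemma sym_hess_tensor B : tensor4 B -> tensor4 (sym_hess pc J B).
Proof.
by move=> /tensor4P T; split=> a c d e x y /=;
  rewrite /sym_hess /= ?linearP !T /=; ring.
Qed.

Lemma sym_hess_sym B x y z w :
  sym_hess pc J B x y z w = sym_hess pc J B y x z w /\
  sym_hess pc J B x y z w = sym_hess pc J B x y w z.
Proof. by rewrite /sym_hess; split; ring. Qed.

Lemma hermitian_hess_tensor A : tensor4 A -> tensor4 (hermitian_hess pc J A).
Proof.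
move=> /tensor4P T; apply: sym_hess_tensor.
by split=> a c d e x y /=; rewrite ?linearP !T /=; ring.
Qed.

Lemma kaehler_weyl_hess_tensor A : tensor4 A -> tensor4 (kaehler_weyl_hess pc J A).
Proof.
move=> /tensor4P T; apply: sym_hess_tensor.
by split=> a c d e x y /=; rewrite ?linearP !T /=; ring.
Qed.

Lemma kaehler_quartic_tensor A : tensor4 A -> tensor4 (kaehler_quartic pc J A).
Proof.
move=> /tensor4P T; split=> a c d e x y /=; rewrite /kaehler_quartic ?linearP !T /=; ring.
Qed.

Lemma sym_hess_compatible B x y : (forall v, J (J v) = sgn pc *: v) -> tensor4 B ->
  J_compatible pc (sym_hess pc J B x y) J.
Proof.
move=> JJ /tensor4Z Z u v; rewrite /sym_hess !JJ !Z.
have ss : @sgn R pc * sgn pc = 1 by exact: sgn_sq.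
by move: ss; move: (sgn pc) => s ss; ring: ss.
Qed.

End HessianTensors.

(** * Realizations on the torus *)

Section Realizations.
Context {R : realType} {m : nat}.
Local Notation E := 'rV[R]_m.
Local Notation M := (@torus_manifold R m).
Implicit Types (u v w z x : E).

(** The symbols (A(x,y)z + A(x,z)y)/3 are symmetric in y and z and linear in x. In the difference of
    their derivatives [A] occurs twice directly and a third time through the Bianchi identity, hence
    the factor 1/3. *)
Lemma affine_realization (A : E -> E -> 'End(E)) : affine_model A ->
  exists (nabla : (M -> E) -> (M -> E) -> M -> E) Rm,
  [/\ affine_structure nabla, curvature_at nabla (proj 0 : M) Rm
    & forall x y z, Rm x y z = A x y z].
Proof.
case=> -[A1 A2] Aa Ab.
have lin1 c a b y z : A (c *: a + b) y z = c *: A a y z + A b y z.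
  by rewrite (A2 y c a b) add_lfunE scale_lfunE.
have lin2 c a b y z : A z (c *: a + b) y = c *: A z a y + A z b y.
  by rewrite (A1 z c a b) add_lfunE scale_lfunE.
pose f y z a : E := 3^-1 *: (A a y z + A a z y).
have fl y z : linear (f y z).
  by move=> c a b; rewrite /f !lin1 addrACA -scalerDr !scalerDr !scalerA mulrC.
pose F y z : 'End(E) := sval (cid (linfunP (fl y z))).
have FE y z a : F y z a = f y z a by exact: (svalP (cid (linfunP (fl y z)))).
pose Gam x y z := F y z (sines x).
have cG : christoffel Gam.
  split.
  - move=> x u c v w; rewrite /Gam !FE /f linearP lin2 addrACA -scalerDr.
    by rewrite !scalerDr !scalerA mulrC.
  - by move=> x u v; rewrite /Gam !FE /f addrC.
  - by move=> u v; apply: vsmooth_linear; exact: vsmooth_sines.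
  by move=> u v x k; rewrite /Gam sines_periodic.
have G0 u v : Gam 0 u v = 0 by rewrite /Gam sines0 linear0.
have [Rm [cRm RmE]] := curvature_nabla_of0 cG G0.
exists (nabla_of Gam), Rm.
split; [exact: affine_structure_nabla_of|exact: cRm|].
move=> x y z; rewrite RmE /Gam !(dv_linear _ _ _ (@vsmooth_sines R m)) !dv_sines0 !FE.
have a12 a b c j : A a b c 0 j = - A b a c 0 j by rewrite (Aa a b) opp_lfunE mxE.
apply/rowP => j; have := congr1 (fun r : E => r 0 j) (Ab x y z).
by rewrite /f !mxE (a12 y x z) (a12 z x y) (a12 y z x); lra.
Qed.

Record metric_jet (p q : nat) (ip : E -> E -> R) (H : E -> E -> E -> E -> R)
    (G : E -> 'M[R]_m) : Prop := {
  jet_smooth : msmooth G;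
  jet_periodic : periodic_map G;
  jet_signature : forall x, inner_product p q (gform (G x));
  jet_value : forall u v, gform (G 0) u v = ip u v;
  jet_gradient : forall u, dm u G 0 = 0;
  jet_hessian : forall u v w z, gform (dm u (dm v G) 0) w z = H u v w z }.

Lemma torus_metric0 p q ip H G : metric_jet p q ip H G ->
  forall u v, torus_metric G (proj 0) u v = ip u v.
Proof. by move=> jG u v; rewrite /torus_metric rep_proj0 (jet_value jG). Qed.

(** The curvature at the point is linear in the derivative of the twisted form, which is [H] plus
    psi times the metric: the first summand yields [hess_curv] and the second yields [weyl_part]. *)
Lemma jet_curvature p q ip H G om psi : metric_jet p q ip H G ->
  vsmooth om -> periodic_map om -> om 0 = 0 ->
  (forall u v, 2 * dot (dv u om 0) v = psi u v) -> (forall u v, psi u v = - psi v u) ->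
  (forall u v w z, H u v w z = H v u w z) ->
  exists Rm, curvature_at (nabla_of (weyl_gamma G om)) (proj 0 : M) Rm /\
    forall u v w z, lower (torus_metric G) (proj 0) Rm u v w z =
      hess_curv H u v w z + weyl_part ip psi u v w z.
Proof.
move=> jG so po o0 dom psia Hs.
have [Rm [cRm RmE]] := curvature_torus (jet_smooth jG) (jet_periodic jG)
  (jet_signature jG) so po (jet_gradient jG) o0.
exists Rm; split=> // u v w z; rewrite RmE.
have hE a b c d : weyl_hess G om a b c d = H a b c d + psi a b * ip c d.
  by rewrite (weyl_hessE _ _ _ _ (jet_smooth jG) so o0) (jet_hessian jG) (jet_value jG) dom.
rewrite !hE /hess_curv /weyl_part (psia v u) (Hs v u).
by field.
Qed.

Lemma cst0_smooth : vsmooth (fun _ : E => 0 : E).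
Proof. exact: vsmooth_cst. Qed.

Lemma cst0_periodic : periodic_map (fun _ : E => 0 : E).
Proof. by []. Qed.

Lemma jet_levi_civita p q ip H G : metric_jet p q ip H G ->
  (forall u v w z, H u v w z = H v u w z) ->
  exists nabla Rm,
  [/\ nabla = nabla_of (weyl_gamma G (fun=> 0)), pseudo_metric p q (torus_metric G),
      levi_civita (torus_metric G) (nabla : _ -> _ -> M -> E),
      curvature_at nabla (proj 0 : M) Rm
    & forall u v w z, lower (torus_metric G) (proj 0) Rm u v w z = hess_curv H u v w z].
Proof.
move=> jG Hs; have s0 := cst0_smooth; have p0 := cst0_periodic.
have [|||Rm [cRm RmE]] := @jet_curvature p q ip H G (fun=> 0) (fun _ _ => 0) jG s0 p0 erefl.
- by move=> u v; rewrite dv_cst /dot big1 ?mulr0// => i _; rewrite mxE mul0r.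
- by move=> u v; rewrite oppr0.
- exact: Hs.
exists (nabla_of (weyl_gamma G (fun=> 0))), Rm; split; first by [].
- exact: torus_pseudo_metric (jet_smooth jG) (jet_periodic jG) (jet_signature jG).
- exact: (levi_civita_torus (jet_smooth jG) (jet_periodic jG) (jet_signature jG) s0 p0).
- exact: cRm.
by move=> u v w z; rewrite RmE /weyl_part !mul0r !(subr0, addr0, mulr0).
Qed.

Lemma hess_metric_jet p q ip H : inner_product p q ip -> tensor4 H ->
  (forall u v w z, H u v w z = H v u w z) -> (forall u v w z, H u v w z = H u v z w) ->
  exists2 G, metric_jet p q ip H G
    & forall pc (J : 'End(E)), J_compatible pc ip J ->
        (forall u v, J_compatible pc (H u v) J) ->
        forall x, J_compatible pc (gform (G x)) J.
Proof.
move=> ii tH s1 s2; have [G [[sG pG] iG v0 [g0 h0] cG]] := hess_metric ii tH s1 s2.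
by exists G.
Qed.

Lemma riemannian_realization p q ip A : riemannian_model p q ip A ->
  exists (g : M -> E -> E -> R) (nabla : (M -> E) -> (M -> E) -> M -> E) Rm,
  [/\ pseudo_metric p q g, levi_civita g nabla, curvature_at nabla (proj 0 : M) Rm,
      forall x y, g (proj 0) x y = ip x y
    & forall x y z w, lower g (proj 0) Rm x y z w = A x y z w].
Proof.
case=> iip rA; have [tA _ _ _] := rA.
have [G jG _] := hess_metric_jet iip (riemann_hess_tensor tA)
  (fun x y z w => (riemann_hess_sym rA x y z w).1)
  (fun x y z w => (riemann_hess_sym rA x y z w).2).
have [nabla [Rm [_ pm lc cR RE]]] := jet_levi_civita jG
  (fun x y z w => (riemann_hess_sym rA x y z w).1).
exists (torus_metric G), nabla, Rm.
split; [exact: pm|exact: lc|exact: cR|exact: torus_metric0 jG|].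
by move=> x y z w; rewrite RE riemann_hess_curv.
Qed.

Lemma weyl_form psi : bilinear_form psi -> exists om : E -> E,
  [/\ vsmooth om, periodic_map om, om 0 = 0
    & forall u v, 2 * dot (dv u om 0) v = psi u v].
Proof.
move=> bpsi; have [p1 p2] := bpsi.
(* The 1-form is psi(x, .)/2 with [sines x] in place of the position x. *)
pose f a : E := \row_j (2^-1 * psi a (delta_mx 0 j)).
have fl : linear f.
  move=> c a b; apply/rowP => j; rewrite !mxE.
  by rewrite (p2 (delta_mx 0 j) c a b) /=; ring.
have [F FE] := linfunP fl.
exists (fun x => F (sines x)); split.
- by apply: vsmooth_linear; exact: vsmooth_sines.
- by move=> x k; rewrite sines_periodic.
- by rewrite sines0 linear0.
move=> u v; rewrite (dv_linear _ _ _ (@vsmooth_sines R m)) dv_sines0 FE.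
rewrite (form_sum1 v u (bilinear_flip bpsi)) /dot mulr_sumr.
by apply: eq_bigr => j _; rewrite mxE; field.
Qed.

Lemma weyl_realization p q ip A : weyl_model p q ip A ->
  exists (g : M -> E -> E -> R) (nabla : (M -> E) -> (M -> E) -> M -> E) Rm,
  [/\ weyl_structure p q g nabla, curvature_at nabla (proj 0 : M) Rm,
      forall x y, g (proj 0) x y = ip x y
    & forall x y z w, lower g (proj 0) Rm x y z w = A x y z w].
Proof.
case=> iip [tA a12 b [psi [bpsi psi0 a34]]]; have [bip ips _] := iip.
have [Rg rR AE] := weyl_split bip ips bpsi psi0 tA a12 b a34.
have [tR _ _ _] := rR.
have hs1 x y z w := (riemann_hess_sym rR x y z w).1.
have [G jG _] := hess_metric_jet iip (riemann_hess_tensor tR) hs1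
  (fun x y z w => (riemann_hess_sym rR x y z w).2).
have [om [so po o0 dom]] := weyl_form bpsi.
have [Rm [cR RE]] := jet_curvature jG so po o0 dom (psi_anti bpsi psi0) hs1.
exists (torus_metric G), (nabla_of (weyl_gamma G om)), Rm; split.
- exact: weyl_structure_torus (jet_smooth jG) (jet_periodic jG) (jet_signature jG) so po.
- exact: cR.
- exact: torus_metric0 jG.
by move=> x y z w; rewrite RE riemann_hess_curv// AE.
Qed.

End Realizations.

(** * Invariance of trace and signature under isomorphisms *)

Section Transport.
Context {R : realType} {V W : vectType R}.
Implicit Types (F : 'Hom(V, W)) (J : 'End(V)).

Lemma basis_image n (b : n.-tuple V) F : bijective F -> basis_of {:V} b ->
  basis_of {:W} (map_tuple F b).
Proof.
move=> bF bb; have iF : injective F by exact: bij_inj bF.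
have kF : lker F == 0%VS by apply/lker0P.
have sF : (F @: {:V})%VS = {:W}%VS.
  apply/eqP; rewrite eqEsubv subvf; apply/subvP => y _.
  by have [G FG GF] := bF; rewrite -[y]GF memv_img// memvf.
by rewrite -sF; apply: limg_basis_of => //; rewrite (eqP kF) capv0.
Qed.

Lemma coord_image n (b : n.-tuple V) F i x : bijective F -> basis_of {:V} b ->
  coord (map_tuple F b) i (F x) = coord b i x.
Proof.
move=> bF bb; have /andP[_ fFb] := basis_image bF bb.
rewrite {1}(coord_basis bb (memvf x)) linear_sum.
rewrite (eq_bigr (fun j => coord b j x *: (map_tuple F b)`_j)) => [|j _]; last first.
  by rewrite linearZ /= (nth_map 0)// size_tuple.
by rewrite coord_sum_free.
Qed.

End Transport.

Section Trace.
Context {R : realType}.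

(** Independence of the basis: vectors are expanded in [b] on one side and in [vbasis] on the other,
    and both sides become the same triple sum. *)
Lemma endo_trace_basis (V : vectType R) n (b : n.-tuple V) (f : 'End(V)) :
  basis_of {:V} b -> endo_trace f = \sum_(i < n) coord b i (f b`_i).
Proof.
move=> bb; have be := vbasisP {:V}; set e := vbasis {:V} in be *.
have eE x : x = \sum_k coord e k x *: e`_k by exact: coord_basis be (memvf x).
have bE x : x = \sum_k coord b k x *: b`_k by exact: coord_basis bb (memvf x).
transitivity (\sum_(i < n) \sum_k \sum_l
    coord e k b`_i * (coord e l (f e`_k) * coord b i e`_l)); last first.
  apply: eq_bigr => i _; rewrite {2}(eE b`_i) !linear_sum; apply: eq_bigr => k _.
  rewrite !linearZ /= {2}(eE (f e`_k)) linear_sum mulr_sumr.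
  by apply: eq_bigr => l _; rewrite linearZ.
rewrite exchange_big /= /endo_trace -/e; apply: eq_bigr => k _.
rewrite exchange_big /=.
transitivity (\sum_l coord e l (f e`_k) * coord e k e`_l).
  rewrite (bigD1 k)//= coord_free ?(basis_free be)// eqxx mulr1 big1 ?addr0// => l lk.
  rewrite coord_free ?(basis_free be)//.
  by case: eqP lk => [->|_ _]; rewrite ?eqxx ?mulr0.
apply: eq_bigr => l _; rewrite [in LHS](bE e`_l) linear_sum mulr_sumr.
by apply: eq_bigr => i _; rewrite linearZ /=; ring.
Qed.

Lemma endo_trace_conj (V W : vectType R) (F : 'Hom(V, W)) (J : 'End(V)) (J' : 'End(W)) :
  bijective F -> (forall x, F (J x) = J' (F x)) -> endo_trace J' = endo_trace J.
Proof.
move=> bF FJ; have bV := vbasisP {:V}.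
rewrite (endo_trace_basis J' (basis_image bF bV)) (endo_trace_basis J bV).
apply: eq_bigr => i _; rewrite -(coord_image i _ bF bV) FJ.
by rewrite (nth_map 0)// size_tuple.
Qed.

Lemma has_signature_image (V W : vectType R) (F : 'Hom(V, W)) p q ip ip' :
  bijective F -> (forall x y, ip x y = ip' (F x) (F y)) ->
  has_signature p q ip -> has_signature p q ip'.
Proof.
move=> bF FE [b [bb bG]]; exists (map_tuple F b); split; first exact: basis_image.
by move=> i j; rewrite !(nth_map 0) ?size_tuple// -FE bG.
Qed.

End Trace.

(** * Almost Hermitian metrics as pullbacks *)

Section AlmostHermitian.
Context {R : realType} {m : nat}.
Local Notation E := 'rV[R]_m.
Local Notation M := (@torus_manifold R m).
Implicit Types (u v w z x : E) (G K : E -> 'M[R]_m).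

Lemma msmooth_mul G K : msmooth G -> msmooth K -> msmooth (fun x => G x *m K x).
Proof.
move=> sG sK i j; apply: (smooth_ext (f := fun x => \sum_k G x i k * K x k j)) => [x|].
  by rewrite mxE.
by apply: smooth_sum => k; apply: smoothM; [exact: sG|exact: sK].
Qed.

Lemma msmooth_cst (K : 'M[R]_m) : msmooth (fun _ : E => K).
Proof. by move=> i j; exact: smooth_cst. Qed.

Lemma dm_mul u x G K : msmooth G -> msmooth K ->
  dm u (fun x => G x *m K x) x = dm u G x *m K x + G x *m dm u K x.
Proof.
move=> sG sK; apply/matrixP => i j; rewrite !mxE -big_split.
transitivity (dd u (fun x => \sum_k G x i k * K x k j) x).
  by congr (dd u _ x); apply/funext => y; rewrite mxE.
rewrite dd_sum => [|k]; last by apply: smoothM; [exact: sG|exact: sK].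
apply: eq_bigr => k _; rewrite ddM; [|exact: sG|exact: sK].
by rewrite !mxE.
Qed.

Lemma dm_cst u x (K : 'M[R]_m) : dm u (fun=> K) x = 0.
Proof. by apply/matrixP => i j; rewrite !mxE dd_cst. Qed.

Lemma dm_add u x G K : msmooth G -> msmooth K ->
  dm u (fun x => G x + K x) x = dm u G x + dm u K x.
Proof.
move=> sG sK; apply/matrixP => i j; rewrite !mxE -ddD; [|exact: sG|exact: sK].
by congr (dd u _ x); apply/funext => y; rewrite mxE.
Qed.

Lemma linear_mulmxr (K : 'M[R]_m) : exists F : 'End(E), forall v, F v = v *m K.
Proof. by apply: linfunP => c a b; rewrite mulmxDl scalemxAl. Qed.

Lemma vsmooth_mulmx (X : E -> E) G : vsmooth X -> msmooth G -> vsmooth (fun x => X x *m G x).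
Proof.
move=> sX sG j; apply: (smooth_ext (f := fun x => \sum_k X x 0 k * G x k j)) => [x|].
  by rewrite mxE.
by apply: smooth_sum => k; apply: smoothM; [exact: sX|exact: sG].
Qed.

(* For symmetric S close to A0 the form [S A0^-1 S] is the pullback of A0 under
   [v |-> v S A0^-1], hence of the same type, and compatible with the pullback of J. *)
Lemma square_jet p q ip H : inner_product p q ip -> tensor4 H ->
  (forall u v w z, H u v w z = H v u w z) -> (forall u v w z, H u v w z = H u v z w) ->
  exists G Phi, [/\ metric_jet p q ip H G, msmooth Phi /\ periodic_map Phi,
    forall x, Phi x \in unitmx, Phi 0 = 1%:M
    & forall x u v, gform (G x) u v = ip (u *m Phi x) (v *m Phi x)].
Proof.
move=> iip tH s1 s2; have T := tensor4P tH.
(* At a critical point the Hessian of S A0^-1 S is twice that of S, so S carries half of [H]. *)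
have tH2 : tensor4 (fun x y z w => 2^-1 * H x y z w).
  by split=> a c d e x y /=; rewrite !T /=; ring.
have [S jS _] := hess_metric_jet iip tH2
  (fun x y z w => f_equal _ (s1 x y z w)) (fun x y z w => f_equal _ (s2 x y z w)).
have sS := jet_smooth jS; have S0 := jet_value jS.
have uS x : S x \in unitmx by exact: inner_product_unitmx (jet_signature jS x).
have Ss x : (S x)^T = S x by exact: metric_sym (jet_signature jS) x.
pose K := invmx (S 0).
have sK := msmooth_cst K.
pose Phi x := S x *m K; pose G x := S x *m K *m S x.
have KT : K^T = K by rewrite /K trmx_inv Ss.
have uPhi x : Phi x \in unitmx by rewrite unitmx_mul uS unitmx_inv uS.
have GE x u v : gform (G x) u v = ip (u *m Phi x) (v *m Phi x).
  rewrite -S0 /gform /Phi /G trmx_mul trmx_mul KT Ss !mulmxA.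
  by rewrite mulmxKV ?uS// -!mulmxA.
have sPhi : msmooth Phi by exact: msmooth_mul.
have sG : msmooth G by exact: msmooth_mul.
have pS := jet_periodic jS.
have dS0 := jet_gradient jS.
exists G, Phi; split=> //.
- split=> //.
  + by move=> x k; rewrite /G pS.
  + move=> x; have [F FE] := linear_mulmxr (Phi x).
    have [F' FE'] := linear_mulmxr (invmx (Phi x)).
    have bF : bijective F'.
      exists F => v; rewrite FE FE'; first by rewrite mulmxKV.
      by rewrite mulmxK.
    have [bip ips sip] := iip; split; first exact: gform_bilinear.
      by move=> u v; rewrite !GE ips.
    apply: has_signature_image bF _ sip => u v.
    by rewrite GE !FE' !mulmxKV.
  + by move=> u v; rewrite GE /Phi /K mulmxV ?uS// !mulmx1.
  + move=> u; transitivity (dm u (fun x => Phi x *m S x) 0); first by [].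
    rewrite (dm_mul u 0 sPhi sS) (dm_mul u 0 sS sK) dm_cst dS0.
    by rewrite mul0mx !mulmx0 !addr0 mul0mx.
  + move=> u v w z.
    have sdS := msmooth_dm v sS.
    have dGE : dm v G = fun x => dm v S x *m K *m S x + S x *m K *m dm v S x.
      apply/funext => x; transitivity (dm v (fun x => Phi x *m S x) x); first by [].
      by rewrite (dm_mul v x sPhi sS) (dm_mul v x sS sK) dm_cst mulmx0 addr0.
    have sm1 : msmooth (fun x => dm v S x *m K) by exact: msmooth_mul.
    have sm2 : msmooth (fun x => S x *m K) by exact: msmooth_mul.
    rewrite dGE dm_add; [|exact: msmooth_mul|exact: msmooth_mul].
    rewrite (dm_mul u 0 sm1 sS) (dm_mul u 0 sm2 sdS) (dm_mul u 0 sdS sK).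
    rewrite !dS0 dm_cst !(mul0mx, mulmx0, addr0, add0r) /K mulmxKV ?uS//.
    by rewrite mulmxV ?uS// mul1mx gformD !(jet_hessian jS); field.
- by split=> // x k; rewrite /Phi pS.
- by rewrite /Phi /K mulmxV ?uS.
Qed.

(** The normal-coordinate Hessian need not be compatible with [J], so the complex structure has to
    vary with the metric. Conjugating [J] by the field [Phi] keeps its square, its trace and its
    compatibility; integrability is not asked here. *)
Lemma almost_hermitian_realization pc p q ip (J : 'End(E)) A :
  almost_hermitian_model pc p q ip J A ->
  exists (g : M -> E -> E -> R) (JM : M -> 'End(E))
    (nabla : (M -> E) -> (M -> E) -> M -> E) Rm,
  [/\ almost_hermitian_structure pc p q g JM, levi_civita g nabla,
      curvature_at nabla (proj 0 : M) Rm,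
      (forall x y, g (proj 0) x y = ip x y) /\ (forall x, JM (proj 0) x = J x)
    & forall x y z w, lower g (proj 0) Rm x y z w = A x y z w].
Proof.
case=> iip [JJ trJ] Jip rA; have [tA _ _ _] := rA.
have hs1 x y z w := (riemann_hess_sym rA x y z w).1.
have [G [Phi [jG [sPhi pPhi] uPhi Phi0 GE]]] := square_jet iip (riemann_hess_tensor tA) hs1
  (fun x y z w => (riemann_hess_sym rA x y z w).2).
have [nabla [Rm [_ pm lc cR RE]]] := jet_levi_civita jG hs1.
have lJ x : linear (fun v => J (v *m Phi x) *m invmx (Phi x)).
  by move=> c a b; rewrite mulmxDl -scalemxAl linearP mulmxDl scalemxAl.
pose Jx x : 'End(E) := sval (cid (linfunP (lJ x))).
have JxE x v : Jx x v = J (v *m Phi x) *m invmx (Phi x).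
  exact: (svalP (cid (linfunP (lJ x)))).
exists (torus_metric G), (fun P => Jx (rep P)), nabla, Rm; split.
- split; first exact: pm.
    split=> [P|X /smooth_fieldE sX].
      split=> [v|]; first by rewrite !JxE mulmxKV// JJ scalemxAl mulmxK.
      have [F FE] := linear_mulmxr (invmx (Phi (rep P))).
      rewrite -[RHS]trJ; apply: (@endo_trace_conj _ _ _ F).
        have [F' FE'] := linear_mulmxr (Phi (rep P)).
        by exists F' => v; rewrite FE FE' ?mulmxKV ?mulmxK.
      by move=> v; rewrite JxE !FE mulmxKV.
    apply/smooth_fieldE.
    rewrite (_ : _ \o proj = fun x => J ((X \o proj) x *m Phi x) *m invmx (Phi x)).
      apply: vsmooth_mulmx; last exact: msmooth_invmx.
      by apply: vsmooth_linear; exact: vsmooth_mulmx.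
    by apply/funext => x; rewrite /= JxE; have [k ->] := rep_proj x; rewrite pPhi.
  by move=> P u v; rewrite /torus_metric !GE !JxE !mulmxKV// Jip.
- exact: lc.
- exact: cR.
- split; first exact: torus_metric0 jG.
  by move=> x; rewrite JxE rep_proj0 Phi0 mulmx1 invmx1 mulmx1.
by move=> x y z w; rewrite RE riemann_hess_curv.
Qed.

End AlmostHermitian.

Section ConstantStructure.
Context {R : realType} {m : nat}.
Local Notation E := 'rV[R]_m.
Local Notation M := (@torus_manifold R m).
Implicit Types (u v w z x : E).
Variables (pc : bool) (p q : nat) (ip : E -> E -> R) (J : 'End(E)).

Definition standard_structure : Prop := exists2 k, m = k.*2 &
  forall i j : 'I_m, j = (i + k)%N :> nat ->
    J (delta_mx 0 i) = delta_mx 0 j /\ J (delta_mx 0 j) = sgn pc *: (delta_mx 0 i : E).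

Hypotheses (sJ : standard_structure) (cJ : almost_cpx pc J) (Jip : J_compatible pc ip J).

Lemma integrable_cst : Defs.integrable pc (fun _ : M => J).
Proof.
have [k mk Jk] := sJ; exists k => // P; exists (chart_at P).
split; [exact: smooth_chart_at|exact: chart_at_dom|].
by move=> Q dQ i j ij; rewrite !coordvecE//; exact: Jk.
Qed.

Lemma almost_hermitian_torus H G : metric_jet p q ip H G ->
  (forall x, J_compatible pc (gform (G x)) J) ->
  almost_hermitian_structure pc p q (torus_metric G) (fun _ : M => J).
Proof.
move=> jG JG; split; last by move=> P; exact: JG.
  exact: torus_pseudo_metric (jet_smooth jG) (jet_periodic jG) (jet_signature jG).
split=> [_|X sX]; first exact: cJ.
exact: smooth_field_cst.
Qed.

Lemma hermitian_realization A : hermitian_model pc p q ip J A ->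
  exists (g : M -> E -> E -> R) (JM : M -> 'End(E))
    (nabla : (M -> E) -> (M -> E) -> M -> E) Rm,
  [/\ hermitian_structure pc p q g JM, levi_civita g nabla,
      curvature_at nabla (proj 0 : M) Rm,
      (forall x y, g (proj 0) x y = ip x y) /\ (forall x, JM (proj 0) x = J x)
    & forall x y z w, lower g (proj 0) Rm x y z w = A x y z w].
Proof.
move=> [[iip _ _ rA] hA]; have [tA _ _ _] := rA; have [JJ _] := cJ.
pose H := hermitian_hess pc J A.
have s1 x y z w : H x y z w = H y x z w by exact: (sym_hess_sym _ _ _ _ _ _ _).1.
have s2 x y z w : H x y z w = H x y w z by exact: (sym_hess_sym _ _ _ _ _ _ _).2.
have [G jG JG] := hess_metric_jet iip (hermitian_hess_tensor pc J tA) s1 s2.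
have JGx : forall x, J_compatible pc (gform (G x)) J.
  apply: JG => // u v; apply: sym_hess_compatible => //.
  have T := tensor4P tA.
  by split=> a c d e x y /=; rewrite ?linearP !T /=; ring.
have [nabla [Rm [_ _ lc cR RE]]] := jet_levi_civita jG s1.
exists (torus_metric G), (fun=> J), nabla, Rm; split.
- by split; [exact: almost_hermitian_torus jG JGx|exact: integrable_cst].
- exact: lc.
- exact: cR.
- by split; [exact: torus_metric0 jG|].
by move=> x y z w; rewrite RE hermitian_hess_curv.
Qed.

(** Stated for the tensor alone, so that it also serves Kaehler-Weyl models whose form psi
    vanishes. *)
Lemma kaehler_torus A : inner_product p q ip -> riemann_tensor A -> kaehler_identity pc J A ->
  exists G, [/\ metric_jet p q ip (kaehler_hess pc J A) G,
    forall x, J_compatible pc (gform (G x)) J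
  & parallel (nabla_of (weyl_gamma G (fun=> 0)) : _ -> _ -> M -> E) (fun=> J)].
Proof.
move=> iip rA kA; have [tA _ _ _] := rA; have [JJ _] := cJ.
have [G [[sG pG] iG v0 [g0 h0] cycG]] :=
  kaehler_metric JJ iip Jip (kaehler_quartic_tensor pc J tA).
exists G; split.
- by split=> // x; have [] := iG x.
- by move=> x; have [] := iG x.
apply: parallel_cst; apply: (weyl_gamma_J JJ sG (fun x => (iG x).1) (fun x => (iG x).2)).
move=> x u v w; rewrite /weyl_dform (_ : dot 0 = fun=> 0); first by rewrite !mulr0 !mul0r
  !addr0 cycG.
by apply/funext => y; rewrite /dot big1// => i _; rewrite mxE mul0r.
Qed.

Lemma kaehler_hess_sym A x y z w : kaehler_hess pc J A x y z w = kaehler_hess pc J A y x z w.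
Proof. by rewrite /kaehler_hess /sym4; ring. Qed.

Lemma kaehler_realization A : kaehler_model pc p q ip J A ->
  exists (g : M -> E -> E -> R) (JM : M -> 'End(E))
    (nabla : (M -> E) -> (M -> E) -> M -> E) Rm,
  [/\ hermitian_structure pc p q g JM /\ parallel nabla JM, levi_civita g nabla,
      curvature_at nabla (proj 0 : M) Rm,
      (forall x y, g (proj 0) x y = ip x y) /\ (forall x, JM (proj 0) x = J x)
    & forall x y z w, lower g (proj 0) Rm x y z w = A x y z w].
Proof.
move=> [[iip _ _ rA] kA]; have [G [jG JG pJ]] := kaehler_torus iip rA kA.
have [JJ _] := cJ.
have [nabla [Rm [nE _ lc cR RE]]] := jet_levi_civita jG (kaehler_hess_sym A).
exists (torus_metric G), (fun=> J), nabla, Rm; split.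
- split; last by rewrite nE.
  by split; [exact: almost_hermitian_torus jG JG|exact: integrable_cst].
- exact: lc.
- exact: cR.
- by split; [exact: torus_metric0 jG|].
by move=> x y z w; rewrite RE kaehler_hess_curv.
Qed.

End ConstantStructure.

(** * Kaehler-Weyl metrics *)

Section Contraction.
Context {R : realType} {V : vectType R}.
Variables (pc : bool) (p q : nat) (ip : V -> V -> R) (J : 'End(V)).
Hypotheses (iip : inner_product p q ip) (Jip : J_compatible pc ip J)
  (JJ : forall v, J (J v) = sgn pc *: v).

Lemma signature_dim : (p + q)%N = \dim {:V}.
Proof. by have [_ _ [b [bb _]]] := iip; rewrite -(span_basis bb) (eqnP (basis_free bb))
  size_tuple. Qed.

(** A pseudo-orthonormal basis [b] with its signs [e]: summing with these weights is contraction
    with the metric, and it replaces a pairing against [y] by evaluation at [y]. *)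
Lemma orthonormal_contract : exists (b : 'I_(p + q) -> V) (e : 'I_(p + q) -> R),
  (forall i, e i * ip (b i) (b i) = 1) /\
  forall (f : V -> R) y, scalar f -> \sum_i e i * (ip y (b i) * f (b i)) = f y.
Proof.
have [[i1 i2] _ [b [bb bG]]] := iip.
pose e (i : 'I_(p + q)) : R := if (i < p)%N then -1 else 1.
have e2 i : e i * e i = 1 by rewrite /e; case: ifP => _; rewrite ?mulrNN mulr1.
exists (fun i => b`_i), e; split=> [i|f y fl]; first by rewrite bG eqxx e2.
have sum_scalar g : scalar g -> g y = \sum_i coord b i y * g b`_i.
  move=> gl; rewrite {1}(coord_basis bb (memvf y)).
  elim/big_rec2: _ => [|i a x _ IH]; last by rewrite gl IH.
  by have := scalarZ 0 0 gl; rewrite scale0r mul0r.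
rewrite (sum_scalar f fl); apply: eq_bigr => i _.
rewrite (sum_scalar _ (i2 b`_i)) /= (bigD1 i)//= bG eqxx -/(e i) big1 => [|j ji].
  by rewrite addr0 mulrA [e i * _]mulrCA e2 mulr1.
by rewrite bG (negPf ji) mulr0.
Qed.

Let Zi : forall c x y, (ip (c *: x) y = c * ip x y) * (ip x (c *: y) = c * ip x y).
Proof. by have [bip _ _] := iip; exact: bilinearZ. Qed.

Let skew x y : ip (J x) y = - ip x (J y).
Proof.
by have [bip ips _] := iip; have [[[[[_ ->] _] _] _] _] := ip_rules JJ bip ips Jip x y.
Qed.

Let Om x y := ip x (J y).

Let Om_rules x y : (Om x (J y) = sgn pc * ip x y) * (Om (J x) y = - sgn pc * ip x y) *
  (Om x y = - ip (J x) y) * (Om y x = - Om x y).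
Proof.
have [_ ips _] := iip.
by rewrite /Om JJ Zi Jip skew opprK [ip y (J x)]ips skew.
Qed.

(** Contracting th /\ Omega with Omega, that is, taking [b i] and [J (b i)] for two of the
    arguments, leaves th up to the factor [sgn pc] (n - 2), where n = p + q. *)
Lemma wedge_fundamental_inj (th : V -> R) : scalar th -> (p + q)%N != 2 ->
  (forall a b c, th a * ip b (J c) + th b * ip c (J a) + th c * ip a (J b) = 0) ->
  forall a, th a = 0.
Proof.
move=> thl pq2 H a; have [b [e [e1 eC]]] := orthonormal_contract.
have thJ : scalar (th \o J) by move=> c x y; rewrite /= linearP thl.
have : \sum_i e i * (th a * Om (b i) (J (b i)) + th (b i) * Om (J (b i)) a
    + th (J (b i)) * Om a (b i)) = 0.
  by rewrite big1// => i _; rewrite H mulr0.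
rewrite (eq_bigr (fun i => sgn pc * th a * (e i * ip (b i) (b i)) -
    sgn pc * (e i * (ip a (b i) * th (b i))) -
    e i * (ip (J a) (b i) * (th \o J) (b i)))) => [|i _]; last first.
  have [_ ips _] := iip.
  by rewrite (Om_rules (b i) (b i)).1.1.1 (Om_rules (b i) a).1.1.2
    (Om_rules a (b i)).1.2 /= (ips (b i) a); ring.
rewrite !sumrB -!mulr_sumr (eC _ _ thl) (eC _ _ thJ) /= JJ (scalarZ _ _ thl).
rewrite (eq_bigr (fun=> 1)) => [|i _]; last exact: e1.
rewrite sumr_const card_ord => h.
have : sgn pc * ((p + q)%:R - 2) * th a = 0 by rewrite -h; ring.
move/eqP; rewrite !mulf_eq0 subr_eq0 eqr_nat (negPf pq2) orbF => /orP[|/eqP//].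
by case: (pc); rewrite /sgn ?oppr_eq0 oner_eq0.
Qed.

(* The contraction of [psi /\ Omega] with Omega is a combination of [psi] and Omega. *)
Lemma wedge_fundamental_eq0 (psi : V -> V -> R) : bilinear_form psi ->
  (forall x y, psi x y = - psi y x) -> (p + q)%N != 2 -> (p + q)%N != 4 ->
  (forall x y z w, psi x y * ip z (J w) - psi x z * ip y (J w)
    + psi x w * ip y (J z) + psi y z * ip x (J w) - psi y w * ip x (J z)
    + psi z w * ip x (J y) = 0) ->
  forall x y, psi x y = 0.
Proof.
move=> [p1 p2] pa pq2 pq4 H; have [b [e [e1 eC]]] := orthonormal_contract.
pose L := \sum_i e i * psi (b i) (J (b i)).
have sl x : scalar (psi x) by exact: p1.
have slJ x : scalar (psi x \o J) by move=> c u v; rewrite /= linearP sl.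
have key x y : sgn pc * ((p + q)%:R - 4) * psi x y + L * Om x y = 0.
  have : \sum_i e i * (psi x y * Om (b i) (J (b i)) - psi x (b i) * Om y (J (b i))
      + psi x (J (b i)) * Om y (b i) + psi y (b i) * Om x (J (b i))
      - psi y (J (b i)) * Om x (b i) + psi (b i) (J (b i)) * Om x y) = 0.
    by rewrite big1// => i _; rewrite H mulr0.
  rewrite (eq_bigr (fun i => sgn pc * psi x y * (e i * ip (b i) (b i)) -
      sgn pc * (e i * (ip y (b i) * psi x (b i))) -
      e i * (ip (J y) (b i) * (psi x \o J) (b i)) +
      sgn pc * (e i * (ip x (b i) * psi y (b i))) +
      e i * (ip (J x) (b i) * (psi y \o J) (b i)) +
      e i * psi (b i) (J (b i)) * Om x y)) => [|i _]; last first.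
    by rewrite !(Om_rules _ (b i)).1.1.1 (Om_rules x (b i)).1.2 (Om_rules y (b i)).1.2 /=; ring.
  rewrite !big_split /= !sumrN -!mulr_sumr -mulr_suml -/L.
  rewrite !(eC _ _ (sl _)) !(eC _ _ (slJ _)) /= !JJ !(scalarZ _ _ (sl _)) (pa y x).
  rewrite (eq_bigr (fun=> 1)) => [|i _]; last exact: e1.
  by rewrite sumr_const card_ord => <-; ring.
have s0 : sgn pc != 0 :> R by case: (pc); rewrite /sgn ?oppr_eq0 oner_eq0.
(* Contracting [key] once more with Omega gives the factor (n - 4) + n = 2 (n - 2) in front of
   [L]. *)
have L0 : L = 0.
  have : \sum_i e i * (sgn pc * ((p + q)%:R - 4) * psi (b i) (J (b i)) +
      L * Om (b i) (J (b i))) = 0.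
    by rewrite big1// => i _; rewrite key mulr0.
  rewrite (eq_bigr (fun i => sgn pc * ((p + q)%:R - 4) * (e i * psi (b i) (J (b i))) +
      L * sgn pc * (e i * ip (b i) (b i)))) => [|i _]; last first.
    by rewrite (Om_rules (b i) (b i)).1.1.1; ring.
  rewrite big_split /= -!mulr_sumr -/L (eq_bigr (fun=> 1)) => [|i _]; last exact: e1.
  rewrite sumr_const card_ord => h.
  have : 2 * sgn pc * ((p + q)%:R - 2) * L = 0 by rewrite -h; ring.
  move/eqP; rewrite !mulf_eq0 subr_eq0 eqr_nat (negPf pq2) (negPf s0) pnatr_eq0 /=.
  by move/eqP.
move=> x y; have /eqP := key x y.
by rewrite L0 mul0r addr0 !mulf_eq0 subr_eq0 eqr_nat (negPf pq4) (negPf s0) => /eqP.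
Qed.

End Contraction.

(** * Alternating 3-forms *)

Section AlternatingForms.
Context {R : realType} {m : nat}.
Local Notation E := 'rV[R]_m.
Implicit Types (u v w x : E) (C T : E -> E -> E -> R).

Record alternating3 C : Prop := {
  alt3_scalar : forall v w, scalar (fun u => C u v w);
  alt3_swap12 : forall u v w, C u v w = - C v u w;
  alt3_swap23 : forall u v w, C u v w = - C u w v }.

Lemma scalar_eq0 (f : E -> R) : scalar f -> (forall i, f (delta_mx 0 i) = 0) ->
  forall u, f u = 0.
Proof.
move=> fl f0 u; rewrite (row_sum_delta u).
elim/big_rec: _ => [|i x _ IH]; last by rewrite fl f0 IH /= mulr0 addr0.
by have := scalarZ 0 0 fl; rewrite scale0r mul0r.
Qed.

Lemma dot_row (f : E -> R) u : scalar f -> dot (\row_i f (delta_mx 0 i)) u = f u.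
Proof.
move=> fl; apply/eqP; rewrite -subr_eq0; apply/eqP.
apply: (@scalar_eq0 (fun u => dot _ u - f u)) => [c x y|i].
  by rewrite dotDr dotZr fl; ring.
rewrite /dot (bigD1 i)//= big1 => [|j ji]; rewrite !mxE ?eqxx ?(negPf ji) ?mulr0//.
by rewrite mulr1 addr0 subrr.
Qed.

Lemma alternating3_eq0 C : alternating3 C ->
  (forall i j k : 'I_m, (i < j < k)%N ->
    C (delta_mx 0 i) (delta_mx 0 j) (delta_mx 0 k) = 0) ->
  forall u v w, C u v w = 0.
Proof.
move=> aC C0; have s1 := alt3_scalar aC; have s12 := alt3_swap12 aC.
have s23 := alt3_swap23 aC.
have rot u v w : C u v w = C v w u by rewrite s12 s23 opprK.
have C12 u w : C u u w = 0 by have := s12 u u w; lra.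
have C23 u w : C w u u = 0 by have := s23 w u u; lra.
have C0' (i j k : 'I_m) : C (delta_mx 0 i) (delta_mx 0 j) (delta_mx 0 k) = 0.
  have [ij|ji|/val_inj->] := ltngtP i j; last by rewrite C12.
    have [jk|kj|/val_inj->] := ltngtP j k; [by rewrite C0 ?ij| |by rewrite C23].
    have [ik|ki|/val_inj->] := ltngtP i k; last by rewrite rot C23.
      by rewrite s23 C0 ?oppr0// ik.
    by rewrite -rot C0 ?ki.
  have [jk|kj|/val_inj->] := ltngtP j k; last by rewrite C23.
    have [ik|ki|/val_inj->] := ltngtP i k; last by rewrite rot C23.
      by rewrite s12 C0 ?oppr0// ji.
    by rewrite rot C0 ?jk.
  by rewrite s12 rot rot C0 ?oppr0// kj.
move=> u v w; apply: (scalar_eq0 (s1 v w)) => i; rewrite rot.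
apply: (scalar_eq0 (s1 w _)) => j; rewrite rot.
by apply: (scalar_eq0 (s1 _ _)) => k; rewrite rot.
Qed.

(** Symmetry and compatibility make [T u v (J w)] skew in [v] and [w] for each [u]. The cyclic sum
    is then alternating, as for the exterior derivative of a 2-form. *)
Lemma cyclic_alternating pc (J : 'End(E)) T : (forall v, J (J v) = sgn pc *: v) ->
  (forall v w, scalar (fun u => T u v w)) -> (forall u w, scalar (fun v => T u v w)) ->
  (forall u v w, T u v w = T u w v) -> (forall u, J_compatible pc (T u) J) ->
  alternating3 (fun u v w => T u v (J w) + T v w (J u) + T w u (J v)).
Proof.
move=> JJ T1 T2 Ts TJ.
have T3 u v : scalar (fun w => T u v w) by move=> c a b; rewrite !(Ts u v) T2.
have sk u v w : T u (J v) w = - T u v (J w).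
  by apply: (compatible_skew JJ _ _ (TJ u)) => c a b;
    [exact: scalarZ (T2 u b)|exact: scalarZ (T3 u a)].
split=> [v w c a b|u v w|u v w].
- by rewrite T1 linearP T3 T2 /=; ring.
- by rewrite (Ts v u) (Ts u w) (Ts w v) !sk; ring.
by rewrite (Ts u w) (Ts w v) (Ts v u) !sk; ring.
Qed.

End AlternatingForms.

(** * The wedge product with a symplectic form in dimension 4 *)

Section Pfaffian.
Context {R : realType}.
Local Notation E := 'rV[R]_4.
Implicit Types (u v w : E).
Let e k : E := delta_mx 0 (inord k).
Variable Om : E -> E -> R.
Hypotheses (bOm : bilinear_form Om) (aOm : forall u v, Om u v = - Om v u).

Definition pfaffian : R := Om (e 0) (e 1) * Om (e 2) (e 3)
  - Om (e 0) (e 2) * Om (e 1) (e 3) + Om (e 0) (e 3) * Om (e 1) (e 2).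

(* The solution [th] of [th /\ Om = C]. *)
Definition wedge_quotient (C : E -> E -> E -> R) u : R := pfaffian^-1 *
  (Om (e 2) (e 3) * C u (e 0) (e 1) - Om (e 1) (e 3) * C u (e 0) (e 2)
   + Om (e 1) (e 2) * C u (e 0) (e 3) + Om (e 0) (e 3) * C u (e 1) (e 2)
   - Om (e 0) (e 2) * C u (e 1) (e 3) + Om (e 0) (e 1) * C u (e 2) (e 3)).

Lemma scalar_basis4_eq0 (f : E -> R) : scalar f ->
  f (e 0) = 0 -> f (e 1) = 0 -> f (e 2) = 0 -> f (e 3) = 0 -> forall u, f u = 0.
Proof.
move=> fl f0 f1 f2 f3; apply: scalar_eq0 => // i; rewrite -[i]inord_val.
by case: i => [[|[|[|[|i]]]] hi].
Qed.

(** If the Pfaffian vanishes, the columns of the Pfaffian adjoint lie in the radical of [Om], hence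
    are zero. Their entries are, up to sign, the values of [Om] on pairs of basis vectors, so [Om]
    itself would be degenerate. *)
Lemma pfaffian_neq0 : (forall v, (forall w, Om w v = 0) -> v = 0) -> pfaffian != 0.
Proof.
move=> nd; apply/eqP; rewrite /pfaffian => pf0; have [b1 b2] := bOm.
have b11 a : Om a a = 0 by have := aOm a a; lra.
have OmE a b c d w : Om w (a *: b + c *: d) = a * Om w b + c * Om w d.
  by rewrite b1 /= (scalarZ _ _ (b1 w)).
have inj a b c i j k : (forall l, (l < 4)%N -> Om (e l) (a *: e i + (b *: e j + c *: e k)) = 0) ->
  i != j -> i != k -> j != k -> (i < 4)%N -> (j < 4)%N -> (k < 4)%N -> [/\ a = 0, b = 0 & c = 0].
  move=> H ij ik jk i4 j4 k4.
  have /rowP v0 : a *: e i + (b *: e j + c *: e k) = 0.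
    by apply: nd; apply: scalar_basis4_eq0; [exact: b2|exact: H..].
  have ent l n : (l < 4)%N -> (n < 4)%N -> (inord l == inord n :> 'I_4) = (l == n).
    by move=> l4 n4; rewrite -(inj_eq val_inj) /= !inordK.
  have [ji ki kj] : [/\ (j == i) = false, (k == i) = false & (k == j) = false].
    by rewrite ![k == _]eq_sym [j == _]eq_sym (negPf ij) (negPf ik) (negPf jk).
  by split; [have := v0 (inord i)|have := v0 (inord j)|have := v0 (inord k)];
    rewrite !mxE !eqxx /= !ent// ?eqxx ?(negPf ij) ?(negPf ik) ?(negPf jk) ?ji ?ki ?kj /= =>
      <-; ring.
have [| | | | | | |O23 O13 O12] := @inj (Om (e 2) (e 3)) (- Om (e 1) (e 3)) (Om (e 1) (e 2))
  1%N 2%N 3%N => //.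
  case=> [|[|[|[|l]]]]// _; rewrite b1 OmE ?b11.
  - lra.
  - by rewrite /=; ring.
  - by rewrite (aOm (e 2) (e 1)); ring.
  - by rewrite (aOm (e 3) (e 1)) (aOm (e 3) (e 2)); ring.
have [| | | | | | |_ O03 O02] := @inj (Om (e 2) (e 3)) (- Om (e 0) (e 3)) (Om (e 0) (e 2))
  0%N 2%N 3%N => //.
  case=> [|[|[|[|l]]]]// _; rewrite b1 OmE ?b11.
  - by rewrite /=; ring.
  - by rewrite (aOm (e 1) (e 0)); lra.
  - by rewrite (aOm (e 2) (e 0)); ring.
  - by rewrite (aOm (e 3) (e 0)) (aOm (e 3) (e 2)); ring.
have [| | | | | | |_ _ O01] := @inj (Om (e 1) (e 3)) (- Om (e 0) (e 3)) (Om (e 0) (e 1)) 0%N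
  1%N 3%N => //.
  case=> [|[|[|[|l]]]]// _; rewrite b1 OmE ?b11.
  - by rewrite /=; ring.
  - by rewrite (aOm (e 1) (e 0)); ring.
  - by rewrite (aOm (e 2) (e 0)) (aOm (e 2) (e 1)); lra.
  - by rewrite (aOm (e 3) (e 0)) (aOm (e 3) (e 1)); ring.
(* Now [e 0] is orthogonal to every basis vector, so the combination with coefficients 1, 0, 0 lies
   in the radical, which would force 1 = 0. *)
have [| | | | | | |/eqP + _ _] := @inj 1 0 0 0%N 1%N 2%N => //; last by rewrite oner_eq0.
case=> [|[|[|[|l]]]]// _; rewrite b1 OmE ?b11 !(mul0r, addr0, mul1r)//.
- by rewrite aOm O01 oppr0.
- by rewrite aOm O02 oppr0.
by rewrite aOm; lra.
Qed.

(** Both sides are alternating, so the four increasing triples of basis vectors suffice; on each of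
    them the difference is a multiple of the defining relation of the Pfaffian. *)
Lemma wedge_quotientP C : alternating3 C -> pfaffian != 0 -> forall u v w,
  C u v w = wedge_quotient C u * Om v w + wedge_quotient C v * Om w u
    + wedge_quotient C w * Om u v.
Proof.
move=> [C1 C12 C23] pf0; have [b1 b2] := bOm.
pose q := wedge_quotient C.
have ql : scalar q by move=> c a b; rewrite /q /wedge_quotient !C1 /=; ring.
have l2 c a b w : Om (c *: a + b) w = c * Om a w + Om b w by exact: b2.
have C11 u w : C u u w = 0 by have := C12 u u w; lra.
have C22 u w : C w u u = 0 by have := C23 w u u; lra.
have C1x u w : C u w u = 0 by rewrite C23 C11 oppr0.
suff: forall u v w, C u v w - (q u * Om v w + q v * Om w u + q w * Om u v) = 0.
  by move=> H u v w; apply/eqP; rewrite -subr_eq0 H.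
have rules a b c : (C b a c = - C a b c) * (C a c b = - C a b c) * (C c a b = C a b c)
    * (C b c a = C a b c) * (C c b a = - C a b c).
  by rewrite (C12 b a) (C23 a c) (C12 c a) (C23 a c) (C23 b c) (C12 b a)
    (C12 c b) (C23 b c) (C12 b a) !opprK.
have r012 := rules (e 0) (e 1) (e 2); have r013 := rules (e 0) (e 1) (e 3).
have r023 := rules (e 0) (e 2) (e 3); have r123 := rules (e 1) (e 2) (e 3).
have a10 := aOm (e 1) (e 0); have a20 := aOm (e 2) (e 0).
have a30 := aOm (e 3) (e 0); have a21 := aOm (e 2) (e 1).
have a31 := aOm (e 3) (e 1); have a32 := aOm (e 3) (e 2).
have q012 : C (e 0) (e 1) (e 2) - (q (e 0) * Om (e 1) (e 2) + q (e 1) * Om (e 2) (e 0)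
    + q (e 2) * Om (e 0) (e 1)) = 0.
  rewrite /q /wedge_quotient !(C11, C22, C1x) !r012 ?r013 ?r023 ?r123 a20.
  by move: pf0; rewrite /pfaffian => pf0; field.
have q013 : C (e 0) (e 1) (e 3) - (q (e 0) * Om (e 1) (e 3) + q (e 1) * Om (e 3) (e 0)
    + q (e 3) * Om (e 0) (e 1)) = 0.
  rewrite /q /wedge_quotient !(C11, C22, C1x) ?r012 ?r013 ?r023 ?r123 a30.
  by move: pf0; rewrite /pfaffian => pf0; field.
have q023 : C (e 0) (e 2) (e 3) - (q (e 0) * Om (e 2) (e 3) + q (e 2) * Om (e 3) (e 0)
    + q (e 3) * Om (e 0) (e 2)) = 0.
  rewrite /q /wedge_quotient !(C11, C22, C1x) ?r012 ?r013 ?r023 ?r123 a30.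
  by move: pf0; rewrite /pfaffian => pf0; field.
have q123 : C (e 1) (e 2) (e 3) - (q (e 1) * Om (e 2) (e 3) + q (e 2) * Om (e 3) (e 1)
    + q (e 3) * Om (e 1) (e 2)) = 0.
  rewrite /q /wedge_quotient !(C11, C22, C1x) ?r012 ?r013 ?r023 ?r123 a31.
  by move: pf0; rewrite /pfaffian => pf0; field.
apply: alternating3_eq0 => [|i j k]; first split.
- by move=> v w c a b; rewrite C1 ql b1 l2 /=; ring.
- by move=> u v w; rewrite C12 (aOm v w) (aOm w u) (aOm u v); ring.
- by move=> u v w; rewrite C23 (aOm v w) (aOm w u) (aOm u v); ring.
have dE (l : 'I_4) : delta_mx 0 l = e l by rewrite /e inord_val.
rewrite !dE.
case: i => [[|[|[|[|i]]]] hi]; case: j => [[|[|[|[|j]]]] hj];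
  case: k => [[|[|[|[|k]]]] hk] //=.
Qed.

End Pfaffian.

Section KaehlerWeyl.
Context {R : realType} {m : nat}.
Local Notation E := 'rV[R]_m.
Local Notation M := (@torus_manifold R m).
Implicit Types (u v w z x : E).
Variables (pc : bool) (J : 'End(E)).
Hypothesis JJ : forall v, J (J v) = sgn pc *: v.

(** The 3-form d Omega + 2 om /\ Omega, for Omega(u, v) = g(u, J v). *)
Definition weyl_cyc (G : E -> 'M[R]_m) om x u v w : R := weyl_dform G om x u v (J w)
  + weyl_dform G om x v w (J u) + weyl_dform G om x w u (J v).

Lemma weyl_cyc_alternating p q (G : E -> 'M[R]_m) om x : msmooth G ->
  (forall x, inner_product p q (gform (G x))) ->
  (forall x, J_compatible pc (gform (G x)) J) -> alternating3 (weyl_cyc G om x).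
Proof.
move=> sG iG JG; apply: (cyclic_alternating JJ).
- by move=> v w c a b; exact: weyl_dform_lin1.
- by move=> u w c a b; exact: weyl_dform_lin2.
- by move=> u v w; exact: (weyl_dform_sym om iG).
move=> u v w; rewrite /weyl_dform JG (dm_compatible u x sG JG); ring.
Qed.

Lemma weyl_cycE (G : E -> 'M[R]_m) om x u v w : weyl_cyc G om x u v w =
  weyl_cyc G (fun=> 0) x u v w + 2 * (dot (om x) u * gform (G x) v (J w) +
    dot (om x) v * gform (G x) w (J u) + dot (om x) w * gform (G x) u (J v)).
Proof.
rewrite /weyl_cyc /weyl_dform (_ : dot 0 = fun=> 0); first by ring.
by apply/funext => y; rewrite /dot big1// => i _; rewrite mxE mul0r.
Qed.

Variables (p q : nat) (ip psi : E -> E -> R) (G : E -> 'M[R]_m) (H : E -> E -> E -> E -> R).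
Hypotheses (jG : metric_jet p q ip H G) (JG : forall x, J_compatible pc (gform (G x)) J)
  (bpsi : bilinear_form psi).

(** In dimension 2 every 3-form vanishes, there being no increasing triple of indices, so any 1-form
    with the prescribed derivative will do. *)
Lemma closing_weyl_form2 : m = 2 -> exists om, [/\ vsmooth om, periodic_map om, om 0 = 0,
    forall u v, 2 * dot (dv u om 0) v = psi u v & forall x u v w, weyl_cyc G om x u v w = 0].
Proof.
move=> m2; have [om [so po o0 dom]] := weyl_form bpsi.
exists om; split=> // x.
apply: alternating3_eq0; first exact: weyl_cyc_alternating (jet_smooth jG) (jet_signature jG) JG.
by move=> [i hi] [j hj] [k hk] /=; lia.
Qed.

End KaehlerWeyl.

Section KaehlerWeyl4.
Context {R : realType}.
Local Notation E := 'rV[R]_4.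
Implicit Types (u v w z x : E).
Variables (pc : bool) (J : 'End(E)).
Hypothesis JJ : forall v, J (J v) = sgn pc *: v.
Variables (p q : nat) (ip psi : E -> E -> R) (G : E -> 'M[R]_4) (H : E -> E -> E -> E -> R).
Hypotheses (jG : metric_jet p q ip H G) (JG : forall x, J_compatible pc (gform (G x)) J)
  (bpsi : bilinear_form psi) 
  (Hcyc : forall u v w z, let K u v a b := H u v a b + psi u v * ip a b in
     K u v w (J z) + K u w z (J v) + K u z v (J w) = 0).

Let Om x u v := gform (G x) u (J v).

Let bOm x : bilinear_form (Om x).
Proof.
by split=> [u c a b|v c a b]; rewrite /Om /= ?linearP ?gform_lin1 ?gform_lin2.
Qed.

Let aOm x u v : Om x u v = - Om x v u.
Proof.
have [big sg _] := jet_signature jG x.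
have [[[[[_ h] _] _] _] _] := ip_rules JJ big sg (JG x) u v.
by rewrite /Om [in RHS]sg h opprK.
Qed.

Let pf0 x : pfaffian (Om x) != 0.
Proof.
apply: pfaffian_neq0 => // v Hv.
have uG := inner_product_unitmx (jet_signature jG x).
have Jv0 : J v = 0.
  apply: (gform_nondeg uG) => w; have [_ sg _] := jet_signature jG x.
  by rewrite gform0l sg; exact: Hv.
have := JJ v; rewrite Jv0 linear0 => /esym/eqP; rewrite scaler_eq0.
by case: (pc); rewrite /sgn ?oppr_eq0 oner_eq0 => /eqP.
Qed.

(* In dimension 4 the wedge product with Omega maps the 1-forms onto the 3-forms;
   the derivative of [om] is then forced because it is also injective. *)
Lemma closing_weyl_form4 : exists om, [/\ vsmooth om, periodic_map om, om 0 = 0,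
  forall u v, 2 * dot (dv u om 0) v = psi u v & forall x u v w, weyl_cyc J G om x u v w = 0].
Proof.
pose C x := weyl_cyc J G (fun=> 0) x.
have sG := jet_smooth jG; have pG := jet_periodic jG.
have s0 := cst0_smooth (R := R) (m := 4).
have aC x : alternating3 (C x) by exact: (weyl_cyc_alternating JJ (fun=> 0) x sG
  (jet_signature jG) JG).
have ql x : scalar (wedge_quotient (Om x) (C x)).
  by move=> c a b; rewrite /wedge_quotient !(alt3_scalar (aC x)) /=; ring.
(* [C] is d Omega, so d Omega + 2 om /\ Omega vanishes when om is -1/2 times the quotient of [C] by
   Omega. *)
pose om x : E := - 2^-1 *: \row_i wedge_quotient (Om x) (C x) (delta_mx 0 i).
have omE x u : dot (om x) u = - 2^-1 * wedge_quotient (Om x) (C x) u.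
  rewrite -(dot_row u (ql x)) /dot mulr_sumr; apply: eq_bigr => i _.
  by rewrite [om x 0 i]mxE mulrA.
have sOm u v : smooth (fun x => Om x u v) by apply: smooth_gform => //; exact: vsmooth_cst.
have sC u v w : smooth (fun x => C x u v w).
  by apply: smoothD; [apply: smoothD|]; exact: smooth_weyl_dform.
have so : vsmooth om.
  move=> i; apply: (smooth_ext (f := fun x => - 2^-1 *
      wedge_quotient (Om x) (C x) (delta_mx 0 i))) => [x|]; first by rewrite !mxE.
  apply: smoothM; first exact: smooth_cst.
  have sOC a b c d e : smooth (fun x => Om x a b * C x c d e) by exact: smoothM.
  apply: smoothM.
    apply: smoothV; last exact: pf0.
    by apply: smoothD; [apply: smoothB|]; exact: smoothM.
  by apply: smoothD => //; apply: smoothB => //; do 2 apply: smoothD => //; apply: smoothB.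
have po : periodic_map om.
  move=> x k; apply/rowP => i; rewrite !mxE /wedge_quotient /pfaffian /C /weyl_cyc /Om.
  by rewrite /weyl_dform pG !dm_periodic.
have o0 : om 0 = 0.
  apply/rowP => i; rewrite !mxE /wedge_quotient.
  have C0 u v w : C 0 u v w = 0.
    rewrite /C /weyl_cyc /weyl_dform !(jet_gradient jG) /dot.
    by rewrite /gform !mulmx0 !mul0mx mxE !big1 ?mulr0 ?mul0r ?addr0// => ? _; rewrite mxE mul0r.
  by rewrite !C0 !mulr0 !(subr0, addr0) mulr0 mulr0.
have cyc0 x u v w : weyl_cyc J G om x u v w = 0.
  rewrite weyl_cycE -/(C x) !omE -!/(Om x _ _).
  by rewrite (wedge_quotientP (bOm x) (aOm x) (aC x) (pf0 x)); field.
exists om; split=> // u v.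
apply/eqP; rewrite -subr_eq0; apply/eqP.
(* The wedge product of [th] with Omega is the difference between the derivative at 0 of the closing
   equation and the hypothesis [Hcyc], hence zero; injectivity of the wedge product gives [th] =
   0. *)
pose th v := 2 * dot (dv u om 0) v - psi u v.
have p4 : (p + q)%N = 4.
  by rewrite (signature_dim (jet_signature jG 0)) dimvf /dim /=.
have [bi1 bi2] := bpsi.
apply: (@wedge_fundamental_inj _ _ pc p q (gform (G 0)) J (jet_signature jG 0) (JG 0) JJ th).
- by move=> c a b; rewrite /th dotDr dotZr bi1 /=; ring.
- by rewrite p4.
move=> a b c; rewrite /th; have /= hc := Hcyc u a b c.
suff : weyl_hess G om u a b (J c) + weyl_hess G om u b c (J a) + weyl_hess G om u c a (J b) = 0.
  rewrite !(weyl_hessE _ _ _ _ sG so o0) !(jet_hessian jG) !(jet_value jG) => h; lra.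
transitivity (dd u (fun x => weyl_cyc J G om x a b c) 0).
  have st d e f : smooth (fun x => weyl_dform G om x d e f) by exact: smooth_weyl_dform.
  by rewrite /weyl_cyc /weyl_hess -!ddD//; exact: smoothD.
have -> : (fun x => weyl_cyc J G om x a b c) = fun=> 0 by apply/funext.
exact: dd_cst.
Qed.

End KaehlerWeyl4.

Section KaehlerWeylRealization.
Context {R : realType} {m : nat}.
Local Notation E := 'rV[R]_m.
Local Notation M := (@torus_manifold R m).
Variables (pc : bool) (p q : nat) (ip : E -> E -> R) (J : 'End(E)).

Lemma closing_weyl_form psi G H : (forall v, J (J v) = sgn pc *: v) ->
  metric_jet p q ip H G -> (forall x, J_compatible pc (gform (G x)) J) ->
  bilinear_form psi ->
  (forall u v w z, let K u v a b := H u v a b + psi u v * ip a b in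
     K u v w (J z) + K u w z (J v) + K u z v (J w) = 0) -> (m == 2) || (m == 4) ->
  exists om, [/\ vsmooth om, periodic_map om, om 0 = 0,
    forall u v, 2 * dot (dv u om 0) v = psi u v & forall x u v w, weyl_cyc J G om x u v w = 0].
Proof.
move=> JJ jG JG bpsi Hcyc /orP[/eqP m2|/eqP m4].
  exact: (closing_weyl_form2 JJ jG JG bpsi m2).
move: ip J G psi H JJ jG JG bpsi Hcyc; rewrite m4 => ip' J' G' psi' H' JJ jG JG bpsi Hcyc.
exact: (closing_weyl_form4 JJ jG JG bpsi Hcyc).
Qed.

Lemma kaehler_weyl_realization A : standard_structure pc J ->
  kaehler_weyl_model pc p q ip J A ->
  exists (g : M -> E -> E -> R) (JM : M -> 'End(E))
    (nabla : (M -> E) -> (M -> E) -> M -> E) Rm,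
  [/\ kaehler_weyl_structure pc p q g JM nabla, curvature_at nabla (proj 0 : M) Rm,
      (forall x y, g (proj 0) x y = ip x y) /\ (forall x, JM (proj 0) x = J x)
    & forall x y z w, lower g (proj 0) Rm x y z w = A x y z w].
Proof.
move=> sJ [iip cJ Jip [tA a12 b [psi [bpsi psi0 a34]]] kA].
have [bip ips _] := iip; have [JJ _] := cJ.
have pa := psi_anti bpsi psi0.
(* All dimensions share what follows the choice of the metric and the Weyl form. *)
have final G H om : metric_jet p q ip H G -> (forall x, J_compatible pc (gform (G x)) J) ->
    vsmooth om -> periodic_map om -> om 0 = 0 ->
    (forall u v, 2 * dot (dv u om 0) v = psi u v) ->
    parallel (nabla_of (weyl_gamma G om) : _ -> _ -> M -> E) (fun=> J) ->
    (forall u v w z, H u v w z = H v u w z) ->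
    (forall x y z w, hess_curv H x y z w + weyl_part ip psi x y z w = A x y z w) ->
  exists (g : M -> E -> E -> R) (JM : M -> 'End(E))
    (nabla : (M -> E) -> (M -> E) -> M -> E) Rm,
  [/\ kaehler_weyl_structure pc p q g JM nabla, curvature_at nabla (proj 0 : M) Rm,
      (forall x y, g (proj 0) x y = ip x y) /\ (forall x, JM (proj 0) x = J x)
    & forall x y z w, lower g (proj 0) Rm x y z w = A x y z w].
  move=> jG JG so po o0 dom pJ Hs HA.
  have [Rm [cR RE]] := jet_curvature jG so po o0 dom pa Hs.
  exists (torus_metric G), (fun=> J), (nabla_of (weyl_gamma G om)), Rm; split.
  - split; last exact: pJ.
      by split; [exact: (almost_hermitian_torus cJ jG JG)|exact: integrable_cst].
    exact: weyl_structure_torus (jet_smooth jG) (jet_periodic jG) (jet_signature jG) so po.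
  - exact: cR.
  - by split; [exact: torus_metric0 jG|].
  by move=> x y z w; rewrite RE HA.
have [m24|] := boolP ((m == 2) || (m == 4)).
  pose H := kaehler_weyl_hess pc J A.
  have s1 x y z w : H x y z w = H y x z w by exact: (sym_hess_sym _ _ _ _ _ _ _).1.
  have s2 x y z w : H x y z w = H x y w z by exact: (sym_hess_sym _ _ _ _ _ _ _).2.
  have [G jG JG] := hess_metric_jet iip (kaehler_weyl_hess_tensor pc J tA) s1 s2.
  have JGx : forall x, J_compatible pc (gform (G x)) J.
    apply: JG => // u v; apply: sym_hess_compatible => //.
    have T := tensor4P tA.
    by split=> a c d e x y /=; rewrite ?linearP !T /=; ring.
  have cyc := kaehler_weyl_hess_cyc JJ bip ips Jip bpsi psi0 tA a12 b a34 kA.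
  have [om [so po o0 dom cyc0]] := closing_weyl_form JJ jG JGx bpsi cyc m24.
  apply: (final G H om jG JGx so po o0 dom).
  - apply: parallel_cst.
    exact: (weyl_gamma_J JJ (jet_smooth jG) (jet_signature jG) JGx cyc0).
  - exact: s1.
  exact: (kaehler_weyl_hess_curv JJ bip ips Jip bpsi psi0 tA a12 b a34 kA).
(* Here psi vanishes, so [A] is an ordinary Kaehler curvature tensor and the zero Weyl form
   suffices. *)
rewrite negb_or => /andP[m2 m4].
have pqm : (p + q)%N = m by rewrite (signature_dim iip) dimvf /dim /= mul1n.
have psi00 x y : psi x y = 0.
  apply: (wedge_fundamental_eq0 iip Jip JJ bpsi pa); rewrite ?pqm//.
  exact: (psi_wedge JJ bip ips Jip bpsi psi0 tA a12 b a34 kA).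
have rA : riemann_tensor A by split=> // x y z w; rewrite a34 psi00 mulr0 mul0r.
have [G [jG JG pJ]] := kaehler_torus cJ Jip iip rA kA.
have dom u v : 2 * dot (dv u (fun _ : E => 0 : E) 0) v = psi u v.
  by rewrite psi00 dv_cst /dot big1 ?mulr0// => i _; rewrite mxE mul0r.
have s0 := @cst0_smooth R m; have p0 := @cst0_periodic R m.
apply: (final G (kaehler_hess pc J A) _ jG JG s0 p0 erefl dom pJ (kaehler_hess_sym pc J A)).
move=> x y z w; rewrite kaehler_hess_curv// /weyl_part !psi00.
by rewrite !mul0r !(subr0, addr0, mulr0).
Qed.

End KaehlerWeylRealization.

(** * Transport to coordinates *)

Section AdaptedBasis.
Context {R : realType} {V : vectType R}.
Implicit Types (J : 'End(V)) (us : seq V).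

Lemma complex_span_stable J us : (forall x, J (J x) = - x) ->
  forall x, x \in <<us ++ map J us>>%VS -> J x \in <<us ++ map J us>>%VS.
Proof.
move=> JJ x /(memv_img J); rewrite limg_span; apply: subvP.
apply/span_subvP => _ /mapP[y + ->]; rewrite mem_cat => /orP[yu|/mapP[z zu ->]].
  by apply: memv_span; rewrite mem_cat map_f ?orbT.
by rewrite JJ memvN memv_span// mem_cat zu.
Qed.

(** The span W of the old vectors is J-stable, and J has no real eigenvalue modulo W: a relation v =
    c J v + w with w in W would give (1 + c^2) v in W. *)
Lemma complex_adapted_extend J us v : (forall x, J (J x) = - x) ->
  free (us ++ map J us) -> v \notin <<us ++ map J us>>%VS ->
  free ((v :: us) ++ map J (v :: us)).
Proof.
move=> JJ fus vW; have stab := complex_span_stable JJ.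
have pe : perm_eq ((v :: us) ++ map J (v :: us)) [:: v, J v & us ++ map J us].
  by rewrite /= perm_cons -cat1s perm_catCA.
rewrite (perm_free pe) !free_cons fus andbT span_cons.
have JvW : J v \notin <<us ++ map J us>>%VS.
  by apply: contra vW => /stab; rewrite JJ memvN.
rewrite JvW andbT; apply: contra vW => /memv_addP[_ /vlineP[c ->] [w wW vE]].
have vE2 : (1 + c ^+ 2) *: v = c *: J w + w.
  have : J v = - c *: v + J w by rewrite {1}vE linearD linearZ /= JJ scalerN scaleNr.
  move=> Jv; rewrite scalerDl scale1r {1}vE Jv scalerDr scalerA.
  by rewrite addrC expr2 mulrN scaleNr -!addrA addNKr.
have c0 : 1 + c ^+ 2 != 0 by rewrite gt_eqF// ltr_wpDr// sqr_ge0.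
by rewrite -[v](scalerK c0) vE2; apply: memvZ; apply: memvD => //; apply: memvZ; exact: stab.
Qed.

Lemma complex_adapted_basis J : (forall x, J (J x) = - x) ->
  exists us, basis_of {:V} (us ++ map J us).
Proof.
move=> JJ.
suff: forall n us, free (us ++ map J us) -> (\dim {:V} <= size us + n)%N ->
    exists us, basis_of {:V} (us ++ map J us).
  by move/(_ (\dim {:V}) [::]); apply=> //; exact: nil_free.
elim=> [|n IH] us fus dn.
  exists us; rewrite basisEfree fus subvf /= size_cat size_map.
  by rewrite (leq_trans dn)// addn0 leq_addr.
have [sf|] := boolP (<<us ++ map J us>> == {:V})%VS.
  by exists us; rewrite /basis_of sf.
rewrite eqEsubv subvf /= => /subvPn[v _ vW].
by apply: IH (complex_adapted_extend JJ fus vW) _; rewrite addSnnS.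
Qed.

(* The eigenspaces of J have the same dimension because the trace vanishes; the
   sums of the vectors of two of their bases will do. *)
Lemma para_adapted_basis J : (forall x, J (J x) = x) -> endo_trace J = 0 ->
  exists us, basis_of {:V} (us ++ map J us).
Proof.
move=> JJ trJ.
pose U := lker (J - \1)%VF; pose W := lker (J + \1)%VF.
have UE x : (x \in U) = (J x == x).
  by rewrite memv_ker add_lfunE opp_lfunE id_lfunE subr_eq0.
have WE x : (x \in W) = (J x == - x).
  by rewrite memv_ker add_lfunE id_lfunE addr_eq0.
have UW : directv (U + W).
  apply/directv_addP/eqP; rewrite -subv0; apply/subvP => x.
  rewrite memv_cap UE WE memv0 => /andP[/eqP-> /eqP xx].
  have := addrN x; rewrite {2}xx opprK => /eqP.
  by rewrite -mulr2n -scaler_nat scaler_eq0 pnatr_eq0.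
have UWf : (U + W = {:V})%VS.
  apply/eqP; rewrite eqEsubv subvf; apply/subvP => x _.
  have -> : x = 2^-1 *: (x + J x) + 2^-1 *: (x - J x).
    by rewrite -scalerDr addrACA subrr addr0 -mulr2n -(scaler_nat 2 x) scalerA mulVf
      ?scale1r// pnatr_eq0.
  apply: memv_add; apply: memvZ; rewrite ?UE ?WE !linearD ?linearN /= JJ.
    by rewrite addrC.
  by rewrite opprK addrC.
pose b := cat_tuple (vbasis U) (vbasis W).
have bb : basis_of {:V} b by rewrite -UWf; apply: cat_basis => //; exact: vbasisP.
have bU i : (i < \dim U)%N -> b`_i = (vbasis U)`_i.
  by move=> iU; rewrite nth_cat size_tuple iU.
have bW i : b`_(\dim U + i) = (vbasis W)`_i.
  by rewrite nth_cat size_tuple ltnNge leq_addr /= addKn.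
have mU i : (i < \dim U)%N -> J (vbasis U)`_i = (vbasis U)`_i.
  by move=> iU; apply/eqP; rewrite -UE vbasis_mem// mem_nth// size_tuple.
have mW i : (i < \dim W)%N -> J (vbasis W)`_i = - (vbasis W)`_i.
  by move=> iW; apply/eqP; rewrite -WE vbasis_mem// mem_nth// size_tuple.
(* In the basis [b] of eigenvectors the trace of [J] is dim U - dim W. *)
have dUW : \dim U = \dim W.
  apply/eqP; rewrite -(eqr_nat R) -subr_eq0 -trJ (endo_trace_basis _ bb) big_split_ord /=.
  have cf i : coord b i b`_i = 1 by rewrite coord_free ?eqxx ?(basis_free bb).
  rewrite (eq_bigr (fun=> 1)) => [|i _]; last first.
    by rewrite -[RHS](cf (lshift _ i)) /= bU ?ltn_ord// mU ?ltn_ord.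
  rewrite [X in _ == _ + X](eq_bigr (fun=> -1)) => [|i _]; last first.
    by rewrite -(cf (rshift _ i)) /= bW mW ?ltn_ord// linearN.
  by rewrite !sumr_const !card_ord mulNrn.
have dV : (\dim {:V} = \dim U + \dim U)%N by rewrite -UWf (directvP UW) /= -dUW.
exists [seq (vbasis U)`_i + (vbasis W)`_i | i <- iota 0 (\dim U)].
set us := map _ _.
rewrite basisEdim -[X in (X <= _)%VS](span_basis bb) size_cat !size_map size_iota.
rewrite dV leqnn andbT.
have usP i : (i < \dim U)%N ->
    ((vbasis U)`_i + (vbasis W)`_i \in <<us ++ map J us>>%VS) &&
    ((vbasis U)`_i - (vbasis W)`_i \in <<us ++ map J us>>%VS).
  move=> iU; have ui : (vbasis U)`_i + (vbasis W)`_i \in us.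
    by apply: map_f; rewrite mem_iota.
  rewrite !memv_span// mem_cat ?ui//; apply/orP; right.
  by apply/mapP; exists ((vbasis U)`_i + (vbasis W)`_i) => //; rewrite linearD /= mU// mW// -dUW.
have half (X : {vspace V}) (x y z : V) : x \in X -> y \in X -> x + y = 2 *: z -> z \in X.
  move=> xX yX xyz; rewrite (_ : z = 2^-1 *: (x + y)) ?memvZ ?memvD//.
  by rewrite xyz scalerA mulVf ?scale1r// pnatr_eq0.
apply/span_subvP => x /=; rewrite mem_cat => /orP[|] /(nthP 0)[i]; rewrite size_tuple => id <-.
  have /andP[h1 h2] := usP i id; apply: (half _ _ _ _ h1 h2).
  by rewrite addrACA subrr addr0 scaler_nat mulr2n.
rewrite -dUW in id; have /andP[h1 h2] := usP i id; rewrite -memvN in h2.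
apply: (half _ _ _ _ h1 h2).
by rewrite opprB addrC addrA subrK scaler_nat mulr2n.
Qed.

Lemma adapted_basis pc J : almost_cpx pc J -> exists us, basis_of {:V} (us ++ map J us).
Proof.
case: pc => -[JJ trJ].
  by apply: para_adapted_basis => // x; rewrite JJ scale1r.
by apply: complex_adapted_basis => x; rewrite JJ scaleN1r.
Qed.

Lemma basis_coordinates m (b : m.-tuple V) : basis_of {:V} b ->
  exists (F : 'Hom(V, 'rV[R]_m)) (K : 'Hom('rV[R]_m, V)),
    [/\ cancel F K, cancel K F & forall i : 'I_m, F b`_i = delta_mx 0 i].
Proof.
move=> bb; have fb := basis_free bb.
pose f x : 'rV[R]_m := \row_i coord b i x.
pose k (r : 'rV[R]_m) : V := \sum_i r 0 i *: b`_i.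
have fl : linear f by move=> c x y; apply/rowP => i; rewrite !mxE linearP.
have kl : linear k.
  move=> c x y; rewrite /k scaler_sumr -big_split; apply: eq_bigr => i _.
  by rewrite !mxE scalerDl scalerA.
have [F FE] := linfunP fl; have [K KE] := linfunP kl.
exists F, K; split.
- move=> x; rewrite KE FE [RHS](coord_basis bb (memvf x)).
  by apply: eq_bigr => i _; rewrite mxE.
- by move=> r; rewrite FE KE; apply/rowP => i; rewrite mxE coord_sum_free.
move=> i; rewrite FE; apply/rowP => j; rewrite !mxE coord_free// eqxx.
by rewrite eq_sym.
Qed.

End AdaptedBasis.

Section ModelTransport.
Context {R : realType} {V : vectType R} {m : nat}.
Local Notation E := 'rV[R]_m.
Variables (F : 'Hom(V, E)) (K : 'Hom(E, V)).
Hypotheses (FK : cancel F K) (KF : cancel K F).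
Variables (pc : bool) (p q : nat) (ip : V -> V -> R) (A : V -> V -> V -> V -> R)
  (J : 'End(V)) (J' : 'End(E)).
Hypothesis J'E : forall x, J' x = F (J (K x)).
Local Notation ip' := (fun u v => ip (K u) (K v)).
Local Notation A' := (fun x y z w => A (K x) (K y) (K z) (K w)).

Lemma bilinear_pull (f : V -> V -> R) :
  bilinear_form f -> bilinear_form (fun u v => f (K u) (K v)).
Proof.
case=> f1 f2; split=> [x c u v|y c u v] /=; rewrite linearP; [exact: f1|exact: (f2 (K y))].
Qed.

Lemma inner_product_pull : inner_product p q ip -> inner_product p q ip'.
Proof.
case=> bip ips sip; split; [exact: bilinear_pull|by move=> x y; exact: ips|].
by apply: has_signature_image (Bijective FK KF) _ sip => x y; rewrite !FK.
Qed.

Lemma tensor4_pull : tensor4 A -> tensor4 A'.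
Proof. by move=> /tensor4P T; split=> a c d e x y /=; rewrite linearP !T. Qed.

Lemma riemann_pull : riemann_tensor A -> riemann_tensor A'.
Proof.
case=> tA a12 b a34; split; [exact: tensor4_pull|move=> x y z w; exact: a12|
  move=> x y z w; exact: b|move=> x y z w; exact: a34].
Qed.

Lemma weyl_pull : weyl_tensor ip A -> weyl_tensor ip' A'.
Proof.
case=> tA a12 b [psi [bpsi psi0 a34]]; split; [exact: tensor4_pull|move=> x y z w; exact: a12|
  move=> x y z w; exact: b|exists (fun u v => psi (K u) (K v))].
split; [exact: bilinear_pull|by move=> x; exact: psi0|].
by move=> x y z w; exact: a34.
Qed.

Let KJ' x : K (J' x) = J (K x). Proof. by rewrite J'E FK. Qed.

Lemma almost_cpx_pull : almost_cpx pc J -> almost_cpx pc J'.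
Proof.
case=> JJ trJ; split=> [x|]; first by rewrite !J'E FK JJ linearZ /= KF.
by rewrite -[RHS]trJ; apply: endo_trace_conj (Bijective FK KF) _ => x; rewrite J'E FK.
Qed.

Lemma compatible_pull : J_compatible pc ip J -> J_compatible pc ip' J'.
Proof. by move=> Jip x y; rewrite /= !KJ' Jip. Qed.

Lemma hermitian_identity_pull : hermitian_identity pc J A -> hermitian_identity pc J' A'.
Proof. by move=> hA x y z w; rewrite /= !KJ' -hA. Qed.

Lemma kaehler_identity_pull : kaehler_identity pc J A -> kaehler_identity pc J' A'.
Proof. by move=> kA x y z w; rewrite /= !KJ' -kA. Qed.

Lemma almost_hermitian_pull : almost_hermitian_model pc p q ip J A ->
  almost_hermitian_model pc p q ip' J' A'.
Proof.
case=> iip cJ Jip rA; split; [exact: inner_product_pull|exact: almost_cpx_pull|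
  exact: compatible_pull|exact: riemann_pull].
Qed.

Lemma iso_metric_pull (g : E -> E -> R) B : (forall x y, g x y = ip' x y) ->
  (forall x y z w, B x y z w = A' x y z w) -> iso_metric ip A g B.
Proof.
move=> gE BE; exists F; split; first exact: Bijective FK KF.
  by move=> x y; rewrite gE !FK.
by move=> x y z w; rewrite BE !FK.
Qed.

Lemma iso_hermitian_pull (g : E -> E -> R) (JM : 'End(E)) B :
  (forall x y, g x y = ip' x y) /\ (forall x, JM x = J' x) ->
  (forall x y z w, B x y z w = A' x y z w) -> iso_hermitian ip J A g JM B.
Proof.
move=> [gE JE] BE; exists F; split; first exact: Bijective FK KF.
- by move=> x y; rewrite gE !FK.
- by move=> x; rewrite JE J'E FK.
by move=> x y z w; rewrite BE !FK.
Qed.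

End ModelTransport.

Section Coordinates.
Context {R : realType} {V : vectType R} {m : nat}.
Local Notation E := 'rV[R]_m.

Lemma linear_coordinates : \dim {:V} = m ->
  exists (F : 'Hom(V, E)) (K : 'Hom(E, V)), cancel F K /\ cancel K F.
Proof.
move=> <-; have [F [K [FK KF _]]] := basis_coordinates (vbasisP {:V}).
by exists F, K.
Qed.

(** A basis of the form us, J us puts [J] into the block form that integrability demands of
    coordinate vectors; the constant structure on the torus is then integrable in its own charts. *)
Lemma adapted_coordinates pc (J : 'End(V)) : \dim {:V} = m -> almost_cpx pc J ->
  exists (F : 'Hom(V, E)) (K : 'Hom(E, V)) (J' : 'End(E)),
  [/\ cancel F K, cancel K F, forall x, J' x = F (J (K x)) & standard_structure pc J'].
Proof.
move=> dV cJ; have [us bus] := adapted_basis cJ; have [JJ _] := cJ.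
have sz : size (us ++ map J us) == m.
  by rewrite -dV -(span_basis bus) (eqnP (basis_free bus)).
have mk : m = (size us).*2 by rewrite -(eqP sz) size_cat size_map addnn.
have [F [K [FK KF Fb]]] := basis_coordinates (b := Tuple sz) bus.
have [|J' J'E] := @linfunP R _ _ (fun x => F (J (K x))); first by move=> c x y; rewrite !linearP.
exists F, K, J'; split=> //; exists (size us) => // i j ij.
have ik : (i < size us)%N by rewrite -(ltn_add2r (size us)) -ij addnn -mk.
have Fi : delta_mx 0 i = F us`_i by rewrite -Fb /= nth_cat ik.
have Fj : delta_mx 0 j = F (J us`_i).
  by rewrite -Fb /= nth_cat ij ltnNge leq_addl /= addnK (nth_map 0).
by rewrite Fi Fj !J'E !FK JJ linearZ.
Qed.

End Coordinates.

Theorem theorem1p3 (R : realType) (m : nat) (V : vectType R)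
    (dimV : \dim {:V} = m) :
  (* affine *)
  (forall A : V -> V -> 'End(V), affine_model A ->
    exists (M : manifold R m)
      (nabla : (M -> 'rV[R]_m) -> (M -> 'rV[R]_m) -> (M -> 'rV[R]_m))
      (P : M) (Rm : 'rV[R]_m -> 'rV[R]_m -> 'End('rV[R]_m)),
      [/\ compact [set: M], affine_structure nabla, curvature_at nabla P Rm
        & iso_affine A Rm])
  /\
  (* pseudo-Riemannian *)
  (forall (p q : nat) (ip : V -> V -> R) (A : V -> V -> V -> V -> R),
    riemannian_model p q ip A ->
    exists (M : manifold R m) (g : M -> 'rV[R]_m -> 'rV[R]_m -> R)
      (nabla : (M -> 'rV[R]_m) -> (M -> 'rV[R]_m) -> (M -> 'rV[R]_m))
      (P : M) (Rm : 'rV[R]_m -> 'rV[R]_m -> 'End('rV[R]_m)),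
      [/\ compact [set: M], pseudo_metric p q g, levi_civita g nabla,
          curvature_at nabla P Rm
        & iso_metric ip A (g P) (lower g P Rm)])
  /\
  (* almost (para)-Hermitian *)
  (forall (pc : bool) (p q : nat) (ip : V -> V -> R) (J : 'End(V))
      (A : V -> V -> V -> V -> R),
    almost_hermitian_model pc p q ip J A ->
    exists (M : manifold R m) (g : M -> 'rV[R]_m -> 'rV[R]_m -> R)
      (JM : M -> 'End('rV[R]_m))
      (nabla : (M -> 'rV[R]_m) -> (M -> 'rV[R]_m) -> (M -> 'rV[R]_m))
      (P : M) (Rm : 'rV[R]_m -> 'rV[R]_m -> 'End('rV[R]_m)),
      [/\ compact [set: M], almost_hermitian_structure pc p q g JM,
          levi_civita g nabla, curvature_at nabla P Rm
        & iso_hermitian ip J A (g P) (JM P) (lower g P Rm)])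
  /\
  (* (para)-Hermitian *)
  (forall (pc : bool) (p q : nat) (ip : V -> V -> R) (J : 'End(V))
      (A : V -> V -> V -> V -> R),
    hermitian_model pc p q ip J A ->
    exists (M : manifold R m) (g : M -> 'rV[R]_m -> 'rV[R]_m -> R)
      (JM : M -> 'End('rV[R]_m))
      (nabla : (M -> 'rV[R]_m) -> (M -> 'rV[R]_m) -> (M -> 'rV[R]_m))
      (P : M) (Rm : 'rV[R]_m -> 'rV[R]_m -> 'End('rV[R]_m)),
      [/\ compact [set: M], hermitian_structure pc p q g JM,
          levi_civita g nabla, curvature_at nabla P Rm
        & iso_hermitian ip J A (g P) (JM P) (lower g P Rm)])
  /\
  (* (para)-Kaehler *)
  (forall (pc : bool) (p q : nat) (ip : V -> V -> R) (J : 'End(V))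
      (A : V -> V -> V -> V -> R),
    kaehler_model pc p q ip J A ->
    exists (M : manifold R m) (g : M -> 'rV[R]_m -> 'rV[R]_m -> R)
      (JM : M -> 'End('rV[R]_m))
      (nabla : (M -> 'rV[R]_m) -> (M -> 'rV[R]_m) -> (M -> 'rV[R]_m))
      (P : M) (Rm : 'rV[R]_m -> 'rV[R]_m -> 'End('rV[R]_m)),
      [/\ compact [set: M],
          almost_hermitian_structure pc p q g JM /\ parallel nabla JM,
          levi_civita g nabla, curvature_at nabla P Rm
        & iso_hermitian ip J A (g P) (JM P) (lower g P Rm)])
  /\
  (* Weyl *)
  (forall (p q : nat) (ip : V -> V -> R) (A : V -> V -> V -> V -> R),
    weyl_model p q ip A ->
    exists (M : manifold R m) (g : M -> 'rV[R]_m -> 'rV[R]_m -> R)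
      (nabla : (M -> 'rV[R]_m) -> (M -> 'rV[R]_m) -> (M -> 'rV[R]_m))
      (P : M) (Rm : 'rV[R]_m -> 'rV[R]_m -> 'End('rV[R]_m)),
      [/\ compact [set: M], weyl_structure p q g nabla, curvature_at nabla P Rm
        & iso_metric ip A (g P) (lower g P Rm)])
  /\
  (* (para)-Kaehler-Weyl *)
  (forall (pc : bool) (p q : nat) (ip : V -> V -> R) (J : 'End(V))
      (A : V -> V -> V -> V -> R),
    kaehler_weyl_model pc p q ip J A ->
    exists (M : manifold R m) (g : M -> 'rV[R]_m -> 'rV[R]_m -> R)
      (JM : M -> 'End('rV[R]_m))
      (nabla : (M -> 'rV[R]_m) -> (M -> 'rV[R]_m) -> (M -> 'rV[R]_m))
      (P : M) (Rm : 'rV[R]_m -> 'rV[R]_m -> 'End('rV[R]_m)),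
      [/\ compact [set: M], kaehler_weyl_structure pc p q g JM nabla,
          curvature_at nabla P Rm
        & iso_hermitian ip J A (g P) (JM P) (lower g P Rm)]).
Proof.
have [F [K [FK KF]]] := linear_coordinates dimV.
have bF := Bijective FK KF.
have cM := @torus_compact R m.
split.
  move=> A [[A1 A2] A12 Ab].
  have Ax x y : exists B : 'End('rV[R]_m), forall z, B z = F (A (K x) (K y) (K z)).
    by apply: linfunP => c u v; rewrite !linearP.
  pose B x y := sval (cid (Ax x y)).
  have BE x y z : B x y z = F (A (K x) (K y) (K z)) by exact: (svalP (cid (Ax x y))).
  have [|nabla [Rm [nA nR RE]]] := @affine_realization R m B.
    split; first split.
    - move=> x c u v; apply/lfunP => z.
      by rewrite add_lfunE scale_lfunE !BE linearP A1 add_lfunE scale_lfunE linearP.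
    - move=> y c u v; apply/lfunP => z; rewrite add_lfunE scale_lfunE !BE linearP.
      by rewrite (A2 (K y) c) add_lfunE scale_lfunE linearP.
    - move=> x y; apply/lfunP => z.
      by rewrite opp_lfunE !BE A12 opp_lfunE linearN.
    by move=> x y z; rewrite !BE -!linearD Ab linear0.
  exists (@torus_manifold R m), nabla, (proj 0), Rm; split; [exact: cM|exact: nA|exact: nR|].
  by exists F; split=> // x y z; rewrite RE BE !FK.
split.
  move=> p q ip A [iip rA].
  have [g [nabla [Rm [pm lc cR gE RE]]]] := riemannian_realization
    (conj (inner_product_pull FK KF iip) (riemann_pull K rA)).
  exists (@torus_manifold R m), g, nabla, (proj 0), Rm.
  split; [exact: cM|exact: pm|exact: lc|exact: cR|exact: (iso_metric_pull FK KF gE RE)].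
split.
  move=> pc p q ip J A mA; have [_ cJ _ _] := mA.
  have [F' [K' [J' [FK' KF' J'E sJ]]]] := adapted_coordinates dimV cJ.
  have [g [JM [nabla [Rm [ah lc cR gJ RE]]]]] := almost_hermitian_realization
    (almost_hermitian_pull FK' KF' J'E mA).
  exists (@torus_manifold R m), g, JM, nabla, (proj 0), Rm.
  split; [exact: cM|exact: ah|exact: lc|exact: cR|].
  exact: (iso_hermitian_pull FK' KF' J'E gJ RE).
split.
  move=> pc p q ip J A [mA hA]; have [_ cJ _ _] := mA.
  have [F' [K' [J' [FK' KF' J'E sJ]]]] := adapted_coordinates dimV cJ.
  have mA' := almost_hermitian_pull FK' KF' J'E mA; have [_ cJ' Jip' _] := mA'.
  have [g [JM [nabla [Rm [ah lc cR gJ RE]]]]] := hermitian_realization sJ cJ' Jip'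
    (conj mA' (hermitian_identity_pull FK' J'E hA)).
  exists (@torus_manifold R m), g, JM, nabla, (proj 0), Rm.
  split; [exact: cM|exact: ah|exact: lc|exact: cR|].
  exact: (iso_hermitian_pull FK' KF' J'E gJ RE).
split.
  move=> pc p q ip J A [mA kA]; have [_ cJ _ _] := mA.
  have [F' [K' [J' [FK' KF' J'E sJ]]]] := adapted_coordinates dimV cJ.
  have mA' := almost_hermitian_pull FK' KF' J'E mA; have [_ cJ' Jip' _] := mA'.
  have [g [JM [nabla [Rm [[[ah _] pJ] lc cR gJ RE]]]]] := kaehler_realization sJ cJ' Jip'
    (conj mA' (kaehler_identity_pull FK' J'E kA)).
  exists (@torus_manifold R m), g, JM, nabla, (proj 0), Rm.
  split; [exact: cM|exact: (conj ah pJ)|exact: lc|exact: cR|].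
  exact: (iso_hermitian_pull FK' KF' J'E gJ RE).
split.
  move=> p q ip A [iip wA].
  have [g [nabla [Rm [ws cR gE RE]]]] := weyl_realization
    (conj (inner_product_pull FK KF iip) (weyl_pull K wA)).
  exists (@torus_manifold R m), g, nabla, (proj 0), Rm.
  split; [exact: cM|exact: ws|exact: cR|exact: (iso_metric_pull FK KF gE RE)].
move=> pc p q ip J A [iip cJ Jip wA kA].
have [F' [K' [J' [FK' KF' J'E sJ]]]] := adapted_coordinates dimV cJ.
have [g [JM [nabla [Rm [kw cR gJ RE]]]]] := kaehler_weyl_realization sJ
  (And5 (inner_product_pull FK' KF' iip) (almost_cpx_pull FK' KF' J'E cJ)
    (compatible_pull FK' J'E Jip) (weyl_pull K' wA) (kaehler_identity_pull FK' J'E kA)).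
exists (@torus_manifold R m), g, JM, nabla, (proj 0), Rm.
split; [exact: cM|exact: kw|exact: cR|].
exact: (iso_hermitian_pull FK' KF' J'E gJ RE).
Qed.
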